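(* Let $N\ge 4$ be an integer and let $\Gamma$ be any discrete group. Then for all elements $g_1,\dots,g_k$ and $h_1,\dots,h_l$ of $\Gamma$, $$\mathrm{Hom}_{H_N^+(\Gamma)}\bigl(a(g_1)\otimes\dots\otimes a(g_k),\ a(h_1)\otimes\dots\otimes a(h_l)\bigr)=\mathrm{span}\bigl\{T_p:\ p\in NC_\Gamma((g_1,\dots,g_k);(h_1,\dots,h_l))\bigr\}.$$
   Context: The compact quantum group $H_N^+(\Gamma)$ (isomorphic to the free wreath product $\widehat\Gamma\wr_*S_N^+$): $C(H_N^+(\Gamma))$ is the universal unital $C^*$-algebra with generators $a_{ij}(g)$, $1\le i,j\le N$, $g\in\Gamma$, and relations $a_{ij}(g)a_{ik}(h)=\delta_{jk}a_{ij}(gh)$, $a_{ji}(g)a_{ki}(h)=\delta_{jk}a_{ji}(gh)$, $\sum_{l}a_{il}(e)=1=\sum_l a_{li}(e)$, $a_{ij}(g)^*=a_{ij}(g^{-1})$, where $e$ is the neutral element of $\Gamma$; the coproduct is $\Delta(a_{ij}(g))=\sum_k a_{ik}(g)\otimes a_{kj}(g)$. The matrix $a(g)=(a_{ij}(g))_{i,j}$ is an $N$-dimensional unitary corepresentation, called a basic corepresentation. For corepresentations $u,v$ acting on $H_u,H_v$, $\mathrm{Hom}(u,v)$ is the space of linear maps $T:H_u\to H_v$ with $v(1\otimes T)=(1\otimes T)u$. The tensor product $u\otimes v$ has coefficients $u_{ij}v_{kl}$. An empty tensor product ($k=0$ or $l=0$) is the trivial corepresentation on $\mathbb{C}$. $NC(k,l)$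 is the set of non-crossing partitions of $k$ upper points and $l$ lower points (drawn in two rows, upper and lower, each ordered from left to right; blocks do not cross). For $p\in NC(k,l)$ the linear map $T_p:(\mathbb{C}^N)^{\otimes k}\to(\mathbb{C}^N)^{\otimes l}$ is $T_p(e_{i_1}\otimes\dots\otimes e_{i_k})=\sum_{j_1,\dots,j_l}\delta_p(i,j)\,e_{j_1}\otimes\dots\otimes e_{j_l}$, where $(e_i)$ is the canonical basis, and $\delta_p(i,j)=1$ if, after decorating the upper points with $i_1,\dots,i_k$ and the lower points with $j_1,\dots,j_l$, all indices in each block of $p$ are equal, and $\delta_p(i,j)=0$ otherwise. $NC_\Gamma((g_1,\dots,g_k);(h_1,\dots,h_l))$ is the set of $p\in NC(k,l)$ such that, putting $g_1,\dots,g_k$ on the upper points and $h_1,\dots,h_l$ on the lower points, in each block the product (from left to right) of the $g_i$ attached to its upper points equals the product (from left to right) of the $h_j$ attached to its lower points; a product of zero elements is $e$. *)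

(* Defs.v *)
From HB Require Import structures.
From mathcomp Require Import all_boot all_order all_fingroup all_algebra.
From mathcomp Require Import complex.
From mathcomp Require Import all_classical all_reals all_analysis.

Set Implicit Arguments.
Unset Strict Implicit.
Unset Printing Implicit Defensive.

Import Order.TTheory GRing.Theory Num.Theory.
Import numFieldNormedType.Exports.

Local Open Scope ring_scope.
Local Open Scope complex_scope.

(* Unital C*-algebras over the complex numbers R[i]. As algType requires
   1 != 0, the zero algebra is excluded. The norm is a field of the structure,
   since normedModType cannot be joined with algType (both structures are
   inherited by numDomainType); completeness is stated for Cauchy sequences. *)
HB.mixin Record Algebra_isCStarAlgebra (R : realType) A
    of GRing.Algebra R[i] A := {
  star : A -> A;
  cnorm : A -> R;
  starK : forall x : A, star (star x) = x;
  starD : forall x y : A, star (x + y) = star x + star y;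
  starZ : forall (c : R[i]) (x : A), star (c *: x) = c^* *: star x;
  starM : forall x y : A, star (x * y) = star y * star x;
  cnorm_ge0 : forall x : A, 0 <= cnorm x;
  cnorm_eq0 : forall x : A, cnorm x = 0 -> x = 0;
  ler_cnormD : forall x y : A, cnorm (x + y) <= cnorm x + cnorm y;
  cnormZ : forall (c : R[i]) (x : A), cnorm (c *: x) = Normc.normc c * cnorm x;
  ler_cnormM : forall x y : A, cnorm (x * y) <= cnorm x * cnorm y;
  cnorm_star : forall x : A, cnorm (star x * x) = cnorm x ^+ 2;
  cnorm_complete : forall u : nat -> A,
    (forall e : R, 0 < e -> exists n0 : nat, forall m n : nat,
       (n0 <= m)%N -> (n0 <= n)%N -> cnorm (u m - u n) < e) ->
    exists x : A, forall e : R, 0 < e -> exists n0 : nat, forall n : nat,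
      (n0 <= n)%N -> cnorm (u n - x) < e
}.

#[short(type="cstarAlgType")]
HB.structure Definition CStarAlgebra (R : realType) :=
  {A of GRing.Algebra R[i] A & Algebra_isCStarAlgebra R A}.

Section QuantumReflection.
Variables (R : realType) (G : groupType) (N : nat).

Record quantum_reflection_relations (A : cstarAlgType R)
    (a : G -> 'M[A]_N) : Prop := QuantumReflectionRelations {
  qr_row : forall (i j k : 'I_N) (g h : G),
    a g i j * a h i k = if j == k then a (g * h)%g i j else 0;
  qr_col : forall (i j k : 'I_N) (g h : G),
    a g j i * a h k i = if j == k then a (g * h)%g j i else 0;
  qr_row_sum : forall i : 'I_N, \sum_l a 1%g i l = 1;
  qr_col_sum : forall i : 'I_N, \sum_l a 1%g l i = 1;
  qr_star : forall (i j : 'I_N) (g : G), star (a g i j) = a (g^-1)%g i j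
}.

(* (A, a) is C(H_N^+(G)) with its generators; the universal property determines
   it up to a unique isomorphism respecting the generators. Norm bounds on the
   morphisms are automatic: unital *-morphisms of C*-algebras are contractive. *)
Definition is_quantum_reflection_algebra (A : cstarAlgType R)
    (a : G -> 'M[A]_N) : Prop :=
  quantum_reflection_relations a /\
  forall (B : cstarAlgType R) (b : G -> 'M[B]_N),
    quantum_reflection_relations b ->
    exists phi : {lrmorphism A -> B},
      [/\ forall x : A, phi (star x) = star (phi x),
          forall (g : G) (i j : 'I_N), phi (a g i j) = b g i j
        & forall psi : {lrmorphism A -> B},
            (forall x : A, psi (star x) = star (psi x)) ->
            (forall (g : G) (i j : 'I_N), psi (a g i j) = b g i j) ->
            psi =1 phi].

End QuantumReflection.

(* The Hilbert space (C^N)^{(x) k}, as functions of the multi-index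
   (i_1, ..., i_k); for k = 0 there is exactly one multi-index. *)
Notation multi_index N k := {ffun 'I_k -> 'I_N}.
Notation tensor_space R N k := {ffun multi_index N k -> R[i]^o}.

Definition basis_vector (R : realType) (I : finType) (i : I) :
    {ffun I -> R[i]^o} := [ffun i' => (i' == i)%:R].

(* Coefficients of u_1 (x) ... (x) u_k; the product in A is taken in the order
   of the indices. For k = 0 this is the trivial corepresentation. *)
Definition tensor_corep (A : pzRingType) (N k : nat) (u : 'I_k -> 'M[A]_N)
    (i j : multi_index N k) : A :=
  \prod_(r < k) u r (i r) (j r).

(* The maps T with v (1 (x) T) = (1 (x) T) u, written coefficientwise: the
   (j, i) coefficient of T is T (basis_vector i) j. *)
Definition corep_Hom (R : realType) (A : cstarAlgType R) (I J : finType)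
    (u : I -> I -> A) (v : J -> J -> A) :
    set 'Hom({ffun I -> R[i]^o}, {ffun J -> R[i]^o}) :=
  [set T : 'Hom({ffun I -> R[i]^o}, {ffun J -> R[i]^o}) |
   forall (j : J) (i : I),
     \sum_(j' : J) T (basis_vector R i) j' *: v j j' =
     \sum_(i' : I) T (basis_vector R i') j *: u i' i]%classic.

Section Partitions.
Variables k l : nat.
Local Open Scope nat_scope.

(* Clockwise position on the boundary of the strip: the upper points from left
   to right, followed by the lower points from right to left. *)
Definition boundary_pos (x : 'I_k + 'I_l) : nat :=
  match x with
  | inl i => i
  | inr j => k + (l - j.+1)
  end.

Definition noncrossing (p : {set {set 'I_k + 'I_l}}) : bool :=
  [forall B1 in p, forall B2 in p, (B1 != B2) ==>
    ~~ [exists x1 in B1, exists y1 in B2, exists x2 in B1, exists y2 in B2,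
        [&& boundary_pos x1 < boundary_pos y1,
            boundary_pos y1 < boundary_pos x2
          & boundary_pos x2 < boundary_pos y2]]].

Definition NC : {set {set {set 'I_k + 'I_l}}} :=
  [set p | finset.partition p [set: 'I_k + 'I_l] && noncrossing p].

Definition NC_group (G : groupType) (g : 'I_k -> G) (h : 'I_l -> G) :
    {set {set {set 'I_k + 'I_l}}} :=
  [set p in NC | [forall B in p,
     (\prod_(r < k | inl r \in B) g r == \prod_(s < l | inr s \in B) h s)%g]].

Definition delta_partition (N : nat) (p : {set {set 'I_k + 'I_l}})
    (i : multi_index N k) (j : multi_index N l) : bool :=
  let idx x := match x with inl r => i r | inr s => j s end in
  [forall B in p, forall x in B, forall y in B, idx x == idx y].

Local Open Scope ring_scope.

Definition T_partition (R : realType) (N : nat) (p : {set {set 'I_k + 'I_l}}) :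
    'Hom(tensor_space R N k, tensor_space R N l) :=
  linfun (fun x : tensor_space R N k =>
    \sum_(i : multi_index N k)
      x i *: \sum_(j : multi_index N l)
        ((delta_partition p i j)%:R : R[i]) *: basis_vector R j).

Lemma T_partition_basis (R : realType) (N : nat)
    (p : {set {set 'I_k + 'I_l}}) (i : multi_index N k) :
  T_partition R N p (basis_vector R i) =
  \sum_(j : multi_index N l)
    ((delta_partition p i j)%:R : R[i]) *: basis_vector R j.
Proof.
rewrite /T_partition.
set f := (X in linfun X).
have fL : linear f.
  move=> c x y; rewrite /f scaler_sumr -big_split /=.
  by apply: eq_bigr => i' _; rewrite !ffunE scalerDl scalerA.
pose fM := GRing.isLinear.Build _ _ _ _ f fL.
pose F : {linear _ -> _} := HB.pack f fM.
rewrite -[f]/(F : _ -> _) lfunE /= /f (bigD1 i) //= ffunE eqxx scale1r.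
rewrite [X in _ + X](_ : _ = 0) ?addr0 //.
by apply: big1 => i' /negPf ni; rewrite ffunE ni scale0r.
Qed.

End Partitions.

(* Main.v *)
Require Import Defs.
From HB Require Import structures.
From mathcomp Require Import all_boot all_order all_fingroup all_algebra.
From mathcomp Require Import ring lra complex.
From mathcomp Require Import all_classical all_reals all_analysis.

Set Implicit Arguments.
Unset Strict Implicit.
Unset Printing Implicit Defensive.

Import Order.TTheory GRing.Theory Num.Theory.
Import numFieldNormedType.Exports.

Local Open Scope ring_scope.

(* Tannaka-Krein duality with real coefficients.  Let
   V(w) be the span of the vectors T_p of the noncrossing partitions p of the
   letters of the word w whose blocks have product 1.  All of them are obtained
   from the empty word by inserting the letter 1 and by splitting a letter gh
   into g, h; V is stable under the adjoint operations (erase, merge) and under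
   tensor products and reversal, hence the spaces Hom(w, w') = V(w^-1 w') are
   closed under composition and adjoint.  Let P_w be the orthogonal projection
   onto V(w), and put haar(x_{i1 j1}(g1) ... x_{in jn}(gn)) = P_w(i, j) with
   w = g1 ... gn, on the *-algebra of noncommutative polynomials in the x_ij(g).
   This functional is positive because the conditional expectation of a matrix
   algebra onto a *-subalgebra is completely positive, and it respects the
   relations of the a_ij(g) because P_w commutes with splitting and merging.
   Its GNS representation is therefore a model of these relations, so the
   universal algebra maps onto it.  By unitarity, T is an intertwiner if and only
   if T = v T u^*; evaluating the vacuum state of the model on this identity
   gives T = P_w T, that is, T is in V(w). *)

(** * Words over a finite alphabet *)

(** The universal algebra is known only through the morphisms out of it, so an upper bound for its
    intertwiners requires a concrete C*-algebra in which the relations hold. This is why a Hilbert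
    space and the C*-algebra of its bounded operators are constructed in full. The main obstacle is
    positivity: P_w is defined word by word, whereas the form haar (x^* y) pairs monomials over
    different words. It is handled on the direct sum over the finitely many words that occur, where
    the spaces Hom(w, w') are the blocks of one algebra of matrices. Boundedness of the operators is
    cheaper: x_ij(g)^* x_ij(g) acts as x_ij(1), and the x_ij(1) of one row are positive with sum 1.
    Real scalars suffice up to there because partition vectors have coefficients 0 and 1, so that
    P_w is a real matrix; only the finished Hilbert space is complexified. Insertion and splitting
    carry the inductions because each matches one kind of defining relation: sums of the a_ij(1) for
    insertion, products of two generators in one row or column for splitting. *)

Section Words.
Variable I : finType.

(** Multi-indices are plain sequences here, so that they are cut and concatenated without casts
    between index types of different lengths. *)
Fixpoint words n : seq (seq I) :=
  if n is n'.+1 then [seq x :: s | x <- enum I, s <- words n'] else [:: [::]].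

Lemma mem_words n s : (s \in words n) = (size s == n).
Proof.
elim: n s => [|n IH] [|x s] //=.
  by apply/negbTE; apply/allpairsP => -[[y t] [_ _]].
rewrite eqSS -IH; apply/allpairsP/idP => [[[y t] /= [_ ht [_ ->]]] //|hs].
by exists (x, s); rewrite mem_enum.
Qed.

Lemma words_uniq n : uniq (words n).
Proof.
elim: n => //= n IH; apply: allpairs_uniq => //; first exact: enum_uniq.
by move=> [x s] [y t] /= _ _ [-> ->].
Qed.

Section Sums.
Variable V : nmodType.
Implicit Type F : seq I -> V.

Lemma sum_words0 F : \sum_(s <- words 0) F s = F [::].
Proof. by rewrite big_seq1. Qed.

Lemma sum_wordsS n F :
  \sum_(s <- words n.+1) F s = \sum_(x : I) \sum_(s <- words n) F (x :: s).
Proof.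
rewrite /= big_flatten big_map big_enum; apply: eq_bigr => x _.
by rewrite big_map.
Qed.

Lemma sum_words_cat m n F :
  \sum_(s <- words (m + n)) F s =
  \sum_(s <- words m) \sum_(t <- words n) F (s ++ t).
Proof.
elim: m F => [|m IH] F; first by rewrite sum_words0.
rewrite addSn !sum_wordsS; apply: eq_bigr => x _; exact: IH.
Qed.

Lemma sum_words_rev n F :
  \sum_(s <- words n) F (rev s) = \sum_(s <- words n) F s.
Proof.
rewrite -(big_map rev xpredT F); apply: perm_big; apply: uniq_perm.
- by rewrite map_inj_uniq ?words_uniq //; apply: inv_inj; apply: revK.
- exact: words_uniq.
move=> s; rewrite -{1}(revK s) mem_map; last by apply: inv_inj; apply: revK.
by rewrite !mem_words size_rev.
Qed.

Lemma eq_words n F1 F2 : (forall s, size s = n -> F1 s = F2 s) ->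
  \sum_(s <- words n) F1 s = \sum_(s <- words n) F2 s.
Proof.
move=> h; rewrite !big_seq; apply: eq_bigr => s.
by rewrite mem_words => /eqP; apply: h.
Qed.

End Sums.

End Words.

(** Used to compare the place of the last move of a derivation with the place where a new operation
    acts. *)
Lemma cat_cons_eqP (T : Type) (u u' v v' : seq T) a b :
  u ++ a :: v = u' ++ b :: v' ->
  [\/ [/\ u = u', a = b & v = v'],
      exists m, u' = u ++ a :: m /\ v = m ++ b :: v'
    | exists m, u = u' ++ b :: m /\ v' = m ++ a :: v].
Proof.
elim: u u' => [|c u IH] [|c' u'] //=.
- by move=> [-> ->]; constructor 1.
- by move=> [-> ->]; constructor 2; exists u'.
- by move=> [<- <-]; constructor 3; exists u.
move=> [-> /IH [[-> -> ->]|[m [-> ->]]|[m [-> ->]]]].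
- by constructor 1.
- by constructor 2; exists m.
- by constructor 3; exists m.
Qed.

Lemma size_catP (T S : Type) (s : seq T) (u v : seq S) :
  size s = size (u ++ v) ->
  exists s1 s2, [/\ s = s1 ++ s2, size s1 = size u & size s2 = size v].
Proof.
rewrite size_cat => hs; exists (take (size u) s), (drop (size u) s).
by rewrite cat_take_drop size_take size_drop hs addKn ltnNge;
  split=> //; case: ltngtP (leq_addr (size v) (size u)) => //= <-.
Qed.

Lemma size_consP (T : Type) (s : seq T) n :
  size s = n.+1 -> exists x s', s = x :: s' /\ size s' = n.
Proof. by case: s => // x s [h]; exists x, s. Qed.

(** * Partition vectors generated by insertion and splitting *)

Section NoncrossingVectors.
Variables (G : groupType) (I : finType).
Implicit Types (w u v : seq G) (s t : seq I) (f : seq I -> bool).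

(* Indicator functions of the noncrossing partitions of the letters of w whose
   blocks have product 1: such a partition has a singleton block or two adjacent
   letters in the same block. *)
Inductive ncgen : seq G -> (seq I -> bool) -> Prop :=
| NcNil f : f [::] -> ncgen [::] f
| NcInsert w1 w2 f f' : ncgen (w1 ++ w2) f ->
    (forall s1 x s2, size s1 = size w1 -> size s2 = size w2 ->
       f' (s1 ++ x :: s2) = f (s1 ++ s2)) ->
    ncgen (w1 ++ 1%g :: w2) f'
| NcSplit w1 g h w2 f f' : ncgen (w1 ++ (g * h)%g :: w2) f ->
    (forall s1 x y s2, size s1 = size w1 -> size s2 = size w2 ->
       f' (s1 ++ x :: y :: s2) = (x == y) && f (s1 ++ x :: s2)) ->
    ncgen (w1 ++ g :: h :: w2) f'.

(** Total functions realizing insertion, merging and splitting at place n; only their values on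
    words of the right length matter. *)
Definition insf n f s := f (take n s ++ drop n.+1 s).
Definition dupf n f s := f (take n s ++ take 1 (drop n s) ++ drop n s).
Definition spf n f s :=
  if drop n s is x :: y :: s2 then (x == y) && f (take n s ++ x :: s2)
  else false.

Lemma insfE n f s1 x s2 : size s1 = n -> insf n f (s1 ++ x :: s2) = f (s1 ++ s2).
Proof.
by move=> <-; rewrite /insf take_size_cat // -cat_rcons drop_size_cat ?size_rcons.
Qed.

Lemma dupfE n f s1 x s2 :
  size s1 = n -> dupf n f (s1 ++ x :: s2) = f (s1 ++ x :: x :: s2).
Proof. by move=> <-; rewrite /dupf take_size_cat // drop_size_cat //= take0. Qed.

Lemma spfE n f s1 x y s2 : size s1 = n ->
  spf n f (s1 ++ x :: y :: s2) = (x == y) && f (s1 ++ x :: s2).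
Proof. by move=> <-; rewrite /spf take_size_cat // drop_size_cat. Qed.

Lemma ncgen_ext w f f' : ncgen w f ->
  (forall s, size s = size w -> f s = f' s) -> ncgen w f'.
Proof.
case=> {w f} [f hf|w1 w2 f f0 hf hf0|w1 g h w2 f f0 hf hf0] E.
- by apply: NcNil; rewrite -E.
- apply: (NcInsert hf) => s1 x s2 h1 h2; rewrite -E ?hf0 //.
  by rewrite !size_cat /= h1 h2.
- apply: (NcSplit hf) => s1 x y s2 h1 h2; rewrite -E ?hf0 //.
  by rewrite !size_cat /= h1 h2.
Qed.

Lemma ncgen_ins w1 w2 f :
  ncgen (w1 ++ w2) f -> ncgen (w1 ++ 1%g :: w2) (insf (size w1) f).
Proof. by move=> hf; apply: (NcInsert hf) => *; rewrite insfE. Qed.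

Lemma ncgen_split w1 g h w2 f : ncgen (w1 ++ (g * h)%g :: w2) f ->
  ncgen (w1 ++ g :: h :: w2) (spf (size w1) f).
Proof. by move=> hf; apply: (NcSplit hf) => *; rewrite spfE. Qed.

(** Induction on the derivation, comparing the last move with the merged pair. Moves at a distance
    commute with the merge. A last move that inserted g or h, or split exactly this pair, is undone
    by it. A split that shares one letter with the pair is handled by associativity in G. *)
Lemma ncgen_merge w1 g h w2 f : ncgen (w1 ++ g :: h :: w2) f ->
  ncgen (w1 ++ (g * h)%g :: w2) (dupf (size w1) f).
Proof.
move: {1 3}(w1 ++ _ :: _ :: _) (erefl (w1 ++ g :: h :: w2)) => w Ew hf.
elim: hf w1 g h w2 Ew => {w f} [f _|u1 u2 f0 f hf0 IH hf|u1 a b u2 f0 f hf0 IH hf] w1 g h w2.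
- by case: w1.
- move=> Ew; case: (cat_cons_eqP Ew) => [[Eu <- E2]|[m [-> E2]]|[m [Eu Ew2]]].
  + rewrite mul1g; subst u1 u2; apply: (ncgen_ext hf0) => s.
    case/size_catP => s1 [s2 [-> h1 /size_consP[x [s3 [-> h2]]]]].
    by rewrite dupfE // hf //= h2.
  + rewrite E2 in hf0 IH hf; rewrite -catA cat_cons.
    rewrite catA in IH; have := IH _ _ _ _ (erefl _); rewrite -catA => K.
    apply: (NcInsert K) => s1 x s2 h1.
    case/size_catP => s3 [s4 [-> h3 /size_consP[y [s5 [-> h4]]]]].
    rewrite [s1 ++ x :: _](catA s1 (x :: s3)) [s1 ++ s3 ++ _]catA.
    rewrite !dupfE ?size_cat /= ?h1 ?h3 //.
    by rewrite -!catA hf // !size_cat /= h3 h4.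
  + case: m Eu Ew2 => [|b m] /= Eu [Eh Ew2].
    * subst h u2 u1; rewrite mulg1.
      rewrite -catA /= in hf0; apply: (ncgen_ext hf0) => s.
      case/size_catP => s1 [s2 [-> h1 /size_consP[x [s3 [-> h2]]]]].
      rewrite dupfE // [s1 ++ _ :: _ :: _](catA s1 [:: x]).
      by rewrite hf ?size_cat /= ?h1 // -catA.
    * subst; rewrite -!catA /= in hf0 hf.
      have := IH w1 g b (m ++ u2); rewrite -!catA /= => /(_ erefl) K.
      have {K}: ncgen ((w1 ++ (g * b)%g :: m) ++ u2) (dupf (size w1) f0) by rewrite -catA.
      move/NcInsert; rewrite -catA; apply => s1 x s2.
      case/size_catP => s3 [s4 [-> h3 /size_consP[y [s5 [-> h4]]]]] h2.
      rewrite -!catA !cat_cons !dupfE //.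
      rewrite [X in f X = _](catA s3 [:: y, y & s5]).
      by rewrite hf -?catA ?size_cat /= ?h3 ?h4.
- move=> Ew; case: (cat_cons_eqP Ew) => [[Eu Ea [Eb Eu2]]|[m [-> E2]]|[m [Eu Ew2]]].
  + subst; apply: (ncgen_ext hf0) => s.
    case/size_catP => s1 [s2 [-> h1 /size_consP[x [s3 [-> h2]]]]].
    by rewrite dupfE // hf // eqxx.
  + case: m E2 => [|b' m] /= [Eb Eu2]; subst.
    * have := IH (u1) (a * g)%g h w2 erefl; rewrite -mulgA => K.
      rewrite -catA /=; apply: (NcSplit K) => s1 x y s2 h1 h2.
      rewrite [s1 ++ _ :: _ :: _](catA s1 [:: x]) !dupfE ?size_cat /= ?h1 //.
      rewrite -catA hf //=; last by rewrite h2.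
      by case: (x =P y) => //= ->.
    * have := IH (u1 ++ (a * b')%g :: m) g h w2; rewrite -!catA /= => /(_ erefl) K.
      apply: (NcSplit K) => s1 x y s2 h1.
      case/size_catP => s3 [s4 [-> h3 /size_consP[z [s5 [-> h4]]]]].
      rewrite [s1 ++ [:: x, y & _]](catA s1 [:: x, y & s3]).
      rewrite [X in _ && dupf _ _ X](catA s1 (x :: s3)).
      rewrite !dupfE ?size_cat /= ?h1 ?h3 //.
      by rewrite -!catA /= hf //= !size_cat /= h3 h4.
  + case: m Eu Ew2 => [|b' m] /= Eu [Eb Ew2]; subst.
    * have := IH w1 g (a * b)%g u2; rewrite -catA /= => /(_ erefl); rewrite mulgA => K.
      apply: (NcSplit K) => s1 x y s2 h1 h2.
      rewrite !dupfE // [s1 ++ [:: x, x & _]](catA s1 [:: x]).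
      by rewrite hf ?size_cat /= ?h1 // -catA.
    * have := IH w1 g b' (m ++ (a * b)%g :: u2); rewrite -!catA /= => /(_ erefl) K.
      have {K}: ncgen ((w1 ++ (g * b')%g :: m) ++ (a * b)%g :: u2) (dupf (size w1) f0).
        by rewrite -catA.
      move/NcSplit; rewrite -catA; apply => s1 x y s2.
      case/size_catP => s3 [s4 [-> h3 /size_consP[z [s5 [-> h4]]]]] h2.
      rewrite -!catA !cat_cons !dupfE //.
      rewrite [X in f X = _](catA s3 [:: z, z & s5]).
      by rewrite hf -?catA ?size_cat /= ?h3 ?h4.
Qed.

End NoncrossingVectors.

(** * Erasing, juxtaposing and reversing partition vectors *)

Section NoncrossingOperations.
Variables (G : groupType) (I : finType).
Implicit Types (w u v : seq G) (s t : seq I) (f : seq I -> bool).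

Lemma sum_eq_andb (y : I) (F : I -> bool) :
  (\sum_(x : I) ((x == y) && F x) = F y)%N.
Proof.
rewrite (bigD1 y) //= eqxx big1 ?addn0 // => x /negPf -> //.
Qed.

(** The factor c records a closed block: it is #|I| if the erased letter was inserted, hence a
    singleton block, and 1 if the letter is one half of a split pair, where the sum over x is cut
    down by the equality with its neighbour. In all other cases the last move commutes with erasing
    and c is inherited. *)
Lemma ncgen_erase w1 w2 f : ncgen (w1 ++ 1%g :: w2) f ->
  exists (c : nat) f', ncgen (w1 ++ w2) f' /\
    forall s1 s2, size s1 = size w1 -> size s2 = size w2 ->
      (\sum_(x : I) f (s1 ++ x :: s2) = c * f' (s1 ++ s2))%N.
Proof.
move: {1 3}(w1 ++ _ :: _) (erefl (w1 ++ 1%g :: w2)) => w Ew hf.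
elim: hf w1 w2 Ew => {w f} [f _|u1 u2 f0 f hf0 IH hf|u1 a b u2 f0 f hf0 IH hf] w1 w2.
- by case: w1.
- move=> Ew; case: (cat_cons_eqP Ew) => [[Eu _ E2]|[m [Eu E2]]|[m [Eu E2]]]; subst.
  + exists #|I|, f0; split=> // s1 s2 h1 h2.
    rewrite (eq_bigr (fun=> f0 (s1 ++ s2) : nat)); last by move=> x _; rewrite hf.
    by rewrite sum_nat_const.
  + have [|c [f' [hf' E]]] := IH (u1 ++ m) w2; first by rewrite catA.
    exists c, (insf (size u1) f'); split.
      by rewrite -catA cat_cons; apply: ncgen_ins; rewrite catA.
    move=> s1 s2 /size_catP [s3 [s4 [-> h3 /size_consP[y [s5 [-> h5]]]]]] h2.
    rewrite -!catA !cat_cons insfE // catA -E ?size_cat ?h3 ?h5 //.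
    by apply: eq_bigr => x _; rewrite -!catA !cat_cons hf // !size_cat /= h5 h2.
  + have [|c [f' [hf' E]]] := IH w1 (m ++ u2); first by rewrite -catA.
    exists c, (insf (size (w1 ++ m)) f'); split.
      by rewrite catA; apply: ncgen_ins; rewrite -catA.
    move=> s1 s2 h1 /size_catP [s3 [s4 [-> h3 /size_consP[y [s5 [-> h5]]]]]].
    rewrite catA insfE ?size_cat ?h1 ?h3 // -catA -E ?size_cat ?h3 ?h5 //.
    apply: eq_bigr => x _; congr nat_of_bool; rewrite [X in f X = _](catA s1 (x :: s3)).
    by rewrite hf ?size_cat /= ?h1 ?h3 // -catA.
- move=> Ew; case: (cat_cons_eqP Ew) => [[Eu Ea E2]|[m [Eu E2]]|[m [Eu E2]]]; subst.
  + exists 1%N, f0; split=> [|s1 s2 h1]; first by rewrite mul1g in hf0.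
    case/size_consP => y [s3 [-> h3]]; rewrite mul1n.
    rewrite -(sum_eq_andb y (fun x => f0 (s1 ++ x :: s3))).
    by apply: eq_bigr => x _; rewrite hf.
  + case: m Ew E2 => [|b' m] /= _ [Eb E2]; subst.
      exists 1%N, f0; split=> [|s1 s2]; first by rewrite mulg1 in hf0; rewrite -catA.
      case/size_catP => s3 [s4 [-> h3 /size_consP[y [s5 [-> h5]]]]] h2.
      case: s5 h5 => // _; rewrite mul1n -catA /=.
      rewrite -(sum_eq_andb y (fun x => f0 (s3 ++ x :: s2))).
      apply: eq_bigr => x _; rewrite -catA /= hf // eq_sym.
      by case: (x =P y) => //= ->.
    have [|c [f' [hf' E]]] := IH (u1 ++ (a * b')%g :: m) w2; first by rewrite -catA.
    exists c, (spf (size u1) f'); split.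
      by rewrite -catA; apply: ncgen_split; rewrite -catA in hf'.
    move=> s1 s2 /size_catP [s3 [s4 [-> h3]]].
    case/size_consP => y [s5 [-> /size_consP[z [s6 [-> h6]]]]] h2.
    rewrite -!catA !cat_cons spfE //.
    have := E (s3 ++ y :: s6) s2; rewrite !size_cat /= h3 h6 -catA => /(_ erefl h2).
    case: (y =P z) => [->|yz] /= K.
      rewrite -K; apply: eq_bigr => x _; rewrite -!catA !cat_cons hf ?eqxx //.
      by rewrite !size_cat /= h6 h2.
    rewrite muln0 big1 // => x _; rewrite -!catA !cat_cons hf //.
      by move/eqP/negPf: yz => ->.
    by rewrite !size_cat /= h6 h2.
  + have [|c [f' [hf' E]]] := IH w1 (m ++ (a * b)%g :: u2); first by rewrite -catA.
    exists c, (spf (size (w1 ++ m)) f'); split.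
      by rewrite catA; apply: ncgen_split; rewrite -catA.
    move=> s1 s2 h1 /size_catP [s3 [s4 [-> h3]]].
    case/size_consP => y [s5 [-> /size_consP[z [s6 [-> h6]]]]].
    rewrite catA spfE ?size_cat ?h1 ?h3 //.
    have := E s1 (s3 ++ y :: s6) h1; rewrite !size_cat /= h3 h6 catA => /(_ erefl).
    have hf1 x : f (s1 ++ x :: s3 ++ y :: z :: s6) =
       (y == z) && f0 (s1 ++ x :: s3 ++ y :: s6).
      rewrite [X in f X = _](catA s1 (x :: s3)) hf ?size_cat /= ?h1 ?h3 //.
      by rewrite -catA.
    case: (y =P z) hf1 => [->|yz] /= hf1 K.
      by rewrite -K; apply: eq_bigr => x _; rewrite hf1.
    by rewrite muln0 big1 // => x _; rewrite hf1.
Qed.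

Lemma ncgen_cat u v f f' : ncgen u f -> ncgen v f' ->
  ncgen (u ++ v) (fun s => f (take (size u) s) && f' (drop (size u) s)).
Proof.
move=> hf hf'; elim: hf => {u f} [f hf|u1 u2 f0 f hf0 IH hf|u1 a b u2 f0 f hf0 IH hf].
- apply: (ncgen_ext hf') => s _ /=.
  by rewrite take0 drop0 hf.
- rewrite -catA cat_cons; rewrite -catA in IH.
  apply: (NcInsert IH) => s1 x s2 h1 /size_catP [s3 [s4 [-> h3 h4]]].
  rewrite -cat_cons !catA !take_size_cat ?drop_size_cat ?size_cat /= ?h1 ?h3 //.
  by rewrite hf.
- rewrite -catA !cat_cons; rewrite -catA cat_cons in IH.
  apply: (NcSplit IH) => s1 x y s2 h1 /size_catP [s3 [s4 [-> h3 h4]]].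
  rewrite -!cat_cons !catA !take_size_cat ?drop_size_cat ?size_cat /= ?h1 ?h3 //.
  by rewrite hf // andbA.
Qed.

(** The word of the conjugate corepresentation: the adjoint reverses products and sends a_ij(g) to
    a_ij(g^-1). *)
Definition winv w : seq G := rev (map (fun g => g^-1)%g w).

Lemma size_winv w : size (winv w) = size w.
Proof. by rewrite size_rev size_map. Qed.

Lemma winv_cat u v : winv (u ++ v) = winv v ++ winv u.
Proof. by rewrite /winv map_cat rev_cat. Qed.

Lemma winv_cons g w : winv (g :: w) = winv w ++ [:: g^-1%g].
Proof. exact: (winv_cat [:: g]). Qed.

Lemma winvK : involutive winv.
Proof.
by move=> w; rewrite /winv map_rev revK -map_comp map_id_in // => g _ /=; rewrite invgK.
Qed.

Lemma ncgen_rev w f : ncgen w f -> ncgen (winv w) (f \o rev).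
Proof.
elim=> {w f} [f hf|u1 u2 f0 f hf0 IH hf|u1 a b u2 f0 f hf0 IH hf].
- exact: NcNil.
- rewrite winv_cat winv_cons invg1 -catA /=; rewrite winv_cat in IH.
  apply: (NcInsert IH) => s1 x s2; rewrite !size_winv => h1 h2 /=.
  by rewrite !rev_cat rev_cons cat_rcons hf ?size_rev.
- rewrite winv_cat !winv_cons -!catA /=; rewrite winv_cat winv_cons -catA /= in IH.
  rewrite invgM in IH.
  apply: (NcSplit IH) => s1 x y s2; rewrite !size_winv => h1 h2 /=.
  rewrite !rev_cat !rev_cons !cat_rcons hf ?size_rev // eq_sym.
  by case: (x =P y) => //= ->.
Qed.

Lemma ncgen_id w :
  ncgen (w ++ winv w) (fun s => take (size w) s == rev (drop (size w) s)).
Proof.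
elim/last_ind: w => [|w g IH]; first exact: NcNil.
rewrite -cats1 winv_cat -catA /=.
(* The partition consists of nested pairs. The innermost pair is created last: insert 1 in the
   middle, then split it as g g^-1. *)
have /ncgen_ins K := IH; rewrite -(mulgV g) in K.
apply: (NcSplit K) => s1 x y s2 h1 h2.
rewrite insfE // (take_size_cat _ h1) (drop_size_cat _ h1) size_cat /= addn1.
rewrite -(cat_rcons x) take_size_cat ?drop_size_cat ?size_rcons ?h1 //.
by rewrite rev_cons -!cats1 eqseq_cat ?size_rev ?h1 ?h2 ?size_winv // andbC eqseq_cons andbT.
Qed.

End NoncrossingOperations.

(** * Spans of noncrossing partition vectors *)

Section NoncrossingSpan.
Variables (R : realFieldType) (G : groupType) (I : finType).
Implicit Types (w u v : seq G) (s t : seq I) (f : seq I -> R).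

(** The span V(w) of the overview. The equations are imposed on words of length [size w] only, so
    values elsewhere are junk. *)
Inductive ncspan w : (seq I -> R) -> Prop :=
| NcSpan0 f : (forall s, size s = size w -> f s = 0) -> ncspan w f
| NcSpanD c phi f' f : ncgen w phi -> ncspan w f' ->
    (forall s, size s = size w -> f s = c * (phi s)%:R + f' s) -> ncspan w f.

Lemma ncspan_ext w f f' : ncspan w f ->
  (forall s, size s = size w -> f s = f' s) -> ncspan w f'.
Proof.
case=> {f} [f hf|c phi f0 f hphi hf0 hf] E.
  by apply: NcSpan0 => s hs; rewrite -E ?hf.
by apply: (NcSpanD (c := c) hphi hf0) => s hs; rewrite -E ?hf.
Qed.

Lemma ncspan_gen w phi : ncgen w phi -> ncspan w (fun s => (phi s)%:R).
Proof.
move=> h; apply: (NcSpanD (c := 1) (f' := fun=> 0) h); first exact: NcSpan0.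
by move=> s _; rewrite mul1r addr0.
Qed.

Lemma ncspanD w f f' : ncspan w f -> ncspan w f' ->
  ncspan w (fun s => f s + f' s).
Proof.
move=> hf hf'; elim: hf => {f} [f hf|c phi f0 f hphi _ IH hf].
  by apply: (ncspan_ext hf') => s hs; rewrite hf ?add0r.
by apply: (NcSpanD (c := c) hphi IH) => s hs; rewrite hf // addrA.
Qed.

Lemma ncspanZ w c f : ncspan w f -> ncspan w (fun s => c * f s).
Proof.
elim=> {f} [f hf|c' phi f0 f hphi _ IH hf].
  by apply: NcSpan0 => s hs; rewrite hf ?mulr0.
by apply: (NcSpanD (c := c * c') hphi IH) => s hs; rewrite hf // mulrDr mulrA.
Qed.

Lemma ncspan_sum (J : Type) (r : seq J) (P : pred J) w (F : J -> seq I -> R) :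
  (forall j, P j -> ncspan w (F j)) -> ncspan w (fun s => \sum_(j <- r | P j) F j s).
Proof.
move=> h; elim: r => [|j r IH]; first by apply: NcSpan0 => s _; rewrite big_nil.
case: (boolP (P j)) => Pj.
  apply: (ncspan_ext (ncspanD (h j Pj) IH)) => s _; by rewrite big_cons Pj.
by apply: (ncspan_ext IH) => s _; rewrite big_cons (negPf Pj).
Qed.

(** Merging, splitting, inserting and erasing all have the form f |-> (s |-> sum of f over a list T
    s), which is linear in f, so each has to be checked on generators only. *)
Lemma ncspan_subst (T : seq I -> seq (seq I)) w w' f :
  (forall s, size s = size w' -> forall t, t \in T s -> size t = size w) ->
  (forall phi, ncgen w phi -> ncspan w' (fun s => \sum_(t <- T s) (phi t)%:R)) ->
  ncspan w f -> ncspan w' (fun s => \sum_(t <- T s) f t).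
Proof.
move=> hT hg; elim=> {f} [f hf|c phi f0 f hphi _ IH hf].
  by apply: NcSpan0 => s hs; rewrite big_seq big1 // => t /hT => /(_ hs)/hf.
apply: (ncspan_ext (ncspanD (ncspanZ c (hg _ hphi)) IH)) => s hs.
rewrite mulr_sumr -big_split /= !big_seq; apply: eq_bigr => t ht.
by rewrite hf // (hT _ hs).
Qed.

Lemma ncspan_merge w1 g h w2 f f' : ncspan (w1 ++ g :: h :: w2) f ->
  (forall s1 x s2, size s1 = size w1 -> size s2 = size w2 ->
     f' (s1 ++ x :: s2) = f (s1 ++ x :: x :: s2)) ->
  ncspan (w1 ++ (g * h)%g :: w2) f'.
Proof.
pose n := size w1.
pose T s : seq (seq I) := [:: take n s ++ take 1 (drop n s) ++ drop n s].
have TE s1 x s2 : size s1 = size w1 -> T (s1 ++ x :: s2) = [:: s1 ++ x :: x :: s2].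
  by rewrite /T => h1; rewrite take_size_cat ?drop_size_cat //= take0.
move=> hf hf'.
apply: (@ncspan_ext _ (fun s => \sum_(t <- T s) f t)).
  apply: ncspan_subst hf => [s|phi hphi].
    move/size_catP => [s1 [s2 [-> h1 /size_consP[x [s3 [-> h2]]]]]].
    by rewrite TE // => t; rewrite inE => /eqP ->; rewrite !size_cat /= h1 h2.
  apply: (ncspan_ext (ncspan_gen (ncgen_merge hphi))) => s.
  move/size_catP => [s1 [s2 [-> h1 /size_consP[x [s3 [-> h2]]]]]].
  by rewrite TE // big_seq1 dupfE.
move=> s /size_catP [s1 [s2 [-> h1 /size_consP[x [s3 [-> h2]]]]]].
by rewrite TE // big_seq1 hf'.
Qed.

Lemma ncspan_split w1 g h w2 f f' : ncspan (w1 ++ (g * h)%g :: w2) f ->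
  (forall s1 x y s2, size s1 = size w1 -> size s2 = size w2 ->
     f' (s1 ++ x :: y :: s2) = (x == y)%:R * f (s1 ++ x :: s2)) ->
  ncspan (w1 ++ g :: h :: w2) f'.
Proof.
pose n := size w1.
(* The empty list encodes the coefficient 0 of two distinct neighbours. *)
pose T s : seq (seq I) := if drop n s is x :: y :: s2 then
  (if x == y then [:: take n s ++ x :: s2] else [::]) else [::].
have TE s1 x y s2 : size s1 = size w1 -> T (s1 ++ x :: y :: s2) =
    if x == y then [:: s1 ++ x :: s2] else [::].
  by rewrite /T => h1; rewrite take_size_cat ?drop_size_cat.
move=> hf hf'.
apply: (@ncspan_ext _ (fun s => \sum_(t <- T s) f t)).
  apply: ncspan_subst hf => [s|phi hphi].
    move/size_catP => [s1 [s2 [-> h1 /size_consP[x [s3 [-> /size_consP[y [s4 [-> h2]]]]]]]]].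
    rewrite TE // => t; case: eqP => // _.
    by rewrite inE => /eqP ->; rewrite !size_cat /= h1 h2.
  apply: (ncspan_ext (ncspan_gen (ncgen_split hphi))) => s.
  move/size_catP => [s1 [s2 [-> h1 /size_consP[x [s3 [-> /size_consP[y [s4 [-> h2]]]]]]]]].
  by rewrite TE // spfE //; case: eqP => _; rewrite ?big_seq1 ?big_nil.
move=> s /size_catP [s1 [s2 [-> h1 /size_consP[x [s3 [-> /size_consP[y [s4 [-> h2]]]]]]]]].
by rewrite TE // hf' //; case: eqP => _; rewrite ?big_seq1 ?big_nil ?mul1r ?mul0r.
Qed.

Lemma ncspan_insert w1 w2 f f' : ncspan (w1 ++ w2) f ->
  (forall s1 x s2, size s1 = size w1 -> size s2 = size w2 ->
     f' (s1 ++ x :: s2) = f (s1 ++ s2)) ->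
  ncspan (w1 ++ 1%g :: w2) f'.
Proof.
pose n := size w1.
pose T s : seq (seq I) := [:: take n s ++ drop n.+1 s].
have TE s1 x s2 : size s1 = size w1 -> T (s1 ++ x :: s2) = [:: s1 ++ s2].
  move=> h1; rewrite /T take_size_cat // -cat_rcons drop_size_cat ?size_rcons //.
  by rewrite h1.
move=> hf hf'.
apply: (@ncspan_ext _ (fun s => \sum_(t <- T s) f t)).
  apply: ncspan_subst hf => [s|phi hphi].
    move/size_catP => [s1 [s2 [-> h1 /size_consP[x [s3 [-> h2]]]]]].
    by rewrite TE // => t; rewrite inE => /eqP ->; rewrite !size_cat /= h1 h2.
  apply: (ncspan_ext (ncspan_gen (ncgen_ins hphi))) => s.
  move/size_catP => [s1 [s2 [-> h1 /size_consP[x [s3 [-> h2]]]]]].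
  by rewrite TE // big_seq1 insfE.
move=> s /size_catP [s1 [s2 [-> h1 /size_consP[x [s3 [-> h2]]]]]].
by rewrite TE // big_seq1 hf'.
Qed.

Lemma ncspan_erase w1 w2 f f' : ncspan (w1 ++ 1%g :: w2) f ->
  (forall s1 s2, size s1 = size w1 -> size s2 = size w2 ->
     f' (s1 ++ s2) = \sum_(x : I) f (s1 ++ x :: s2)) ->
  ncspan (w1 ++ w2) f'.
Proof.
pose n := size w1.
pose T s : seq (seq I) := [seq take n s ++ x :: drop n s | x <- enum I].
have TE (F : seq I -> R) s1 s2 : size s1 = size w1 ->
    \sum_(t <- T (s1 ++ s2)) F t = \sum_x F (s1 ++ x :: s2).
  move=> h1; rewrite /T big_map big_enum; apply: eq_bigr => x _.
  by rewrite take_size_cat ?drop_size_cat.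
move=> hf hf'.
apply: (@ncspan_ext _ (fun s => \sum_(t <- T s) f t)).
  apply: ncspan_subst hf => [s|phi hphi].
    move/size_catP => [s1 [s2 [-> h1 h2]]] t /mapP [x _ ->].
    by rewrite take_size_cat ?drop_size_cat // !size_cat /= h1 h2.
  have [c [f0 [hf0 E]]] := ncgen_erase hphi.
  apply: (ncspan_ext (ncspanZ c%:R (ncspan_gen hf0))) => s.
  move/size_catP => [s1 [s2 [-> h1 h2]]].
  by rewrite TE // -natr_sum E // natrM.
move=> s /size_catP [s1 [s2 [-> h1 h2]]].
by rewrite TE // hf'.
Qed.

Lemma ncspan_nil : ncspan [::] (fun=> 1).
Proof.
have h : ncgen (I := I) ([::] : seq G) (fun=> true) by exact: NcNil.
exact: (ncspan_ext (ncspan_gen h)).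
Qed.

Lemma ncspan_cat u v f f' : ncspan u f -> ncspan v f' ->
  ncspan (u ++ v) (fun s => f (take (size u) s) * f' (drop (size u) s)).
Proof.
have hsz s : size s = size (u ++ v) ->
    size (take (size u) s) = size u /\ size (drop (size u) s) = size v.
  move/size_catP => [s1 [s2 [-> h1 h2]]].
  by rewrite take_size_cat ?drop_size_cat.
move=> hf hf'; elim: hf => {f} [f hf|c phi f0 f hphi _ IH hf].
  by apply: NcSpan0 => s /hsz [h1 _]; rewrite hf ?mul0r.
apply: (@ncspan_ext _ (fun s => c * ((phi (take (size u) s))%:R * f' (drop (size u) s))
  + f0 (take (size u) s) * f' (drop (size u) s))); last first.
  by move=> s /hsz [h1 h2]; rewrite hf // mulrDl mulrA.
apply: ncspanD IH; apply: ncspanZ.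
elim: hf' => {f'} [f' hf'|c' phi' f1 f' hphi' _ IH hf'].
  by apply: NcSpan0 => s /hsz [_ h2]; rewrite hf' ?mulr0.
apply: (NcSpanD (c := c') (ncgen_cat hphi hphi') IH) => s /hsz [h1 h2].
by rewrite hf' // mulrDr mulrCA -natrM mulnb.
Qed.

Lemma ncspan_rev w f : ncspan w f -> ncspan (winv w) (fun s => f (rev s)).
Proof.
elim=> {f} [f hf|c phi f0 f hphi _ IH hf].
  by apply: NcSpan0 => s; rewrite size_winv => hs; rewrite hf ?size_rev.
apply: (NcSpanD (c := c) (ncgen_rev hphi) IH) => s; rewrite size_winv => hs.
by rewrite hf ?size_rev.
Qed.

Lemma ncspan_id w :
  ncspan (w ++ winv w) (fun s => (take (size w) s == rev (drop (size w) s))%:R).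
Proof. exact: (ncspan_gen (ncgen_id I w)). Qed.

(** This is composition of intertwiners after Frobenius reciprocity. The inner letters are
    contracted by induction; the remaining pair g, g^-1 merges into 1, which makes its two indices
    equal, and erasing this 1 sums over them. *)
Lemma ncspan_contract u w v f f' : ncspan (u ++ w ++ winv w ++ v) f ->
  (forall s1 s2, size s1 = size u -> size s2 = size v ->
     f' (s1 ++ s2) = \sum_(t <- words I (size w)) f (s1 ++ t ++ rev t ++ s2)) ->
  ncspan (u ++ v) f'.
Proof.
elim: w u v f f' => [|g w IH] u v f f' hf hf'.
  apply: (ncspan_ext hf) => s /size_catP [s1 [s2 [-> h1 h2]]].
  by rewrite hf' // big_seq1.
rewrite winv_cons -!catA /= in hf.
pose f1 s := \sum_(t <- words I (size w))
   f (take (size u).+1 s ++ t ++ rev t ++ drop (size u).+1 s).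
have h1 : ncspan (u ++ g :: g^-1%g :: v) f1.
  rewrite -cat_rcons; apply: (IH _ _ f); first by rewrite cat_rcons.
  move=> s1 s2; rewrite size_rcons => h1 _.
  by rewrite /f1 take_size_cat // drop_size_cat.
pose n := size u.
pose f2 s := f1 (take n s ++ take 1 (drop n s) ++ drop n s).
have f2E s1 x s2 : size s1 = n -> f2 (s1 ++ x :: s2) = f1 (s1 ++ x :: x :: s2).
  by move=> hs; rewrite /f2 take_size_cat // drop_size_cat //= take0.
have {}h1 : ncspan (u ++ 1%g :: v) f2.
  by rewrite -(mulgV g); apply: (ncspan_merge h1) => s1 x s2 hs _; rewrite f2E.
apply: (ncspan_erase h1) => s1 s2 hs1 hs2; rewrite hf' // sum_wordsS.
apply: eq_bigr => x _; rewrite f2E // /f1 -(cat_rcons x).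
rewrite take_size_cat ?drop_size_cat ?size_rcons ?hs1 //.
by apply: eq_bigr => t _; rewrite rev_cons cat_rcons cat_rcons.
Qed.

(** P is the orthogonal projector B^T (B B^T)^-1 B onto the row space, for a row basis B. The Gram
    matrix is invertible because over an ordered field x B B^T = 0 makes the sum of squares of the
    entries of x B vanish. *)
Lemma row_projector_exists m k (A : 'M[R]_(k, m)) :
  exists P : 'M[R]_m, [/\ P^T = P, A *m P = A & (exists D, P = D *m A)].
Proof.
have : row_free (row_base A) by exact: row_base_free.
have : (row_base A :=: A)%MS by exact: eq_row_base.
move: (row_base A); move: (\rank A) => r B eqB hB.
have BBu : B *m B^T \in unitmx.
  rewrite -row_free_unit -kermx_eq0; apply/rowV0P => x /sub_kermxP hx.
  have h0 : x *m B = 0.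
    apply/rowP => j; rewrite mxE.
    have h : (x *m B) *m (x *m B)^T = 0.
      by rewrite trmx_mul mulmxA -(mulmxA x) hx mul0mx.
    move/matrixP/(_ 0 0): h; rewrite !mxE => /eqP.
    rewrite psumr_eq0 => [|i _]; last by rewrite !mxE -expr2 sqr_ge0.
    move/allP/(_ j); rewrite mem_index_enum => /(_ isT); rewrite !mxE -expr2 sqrf_eq0.
    by move/eqP.
  by apply: (row_free_inj hB); rewrite h0 mul0mx.
exists (B^T *m invmx (B *m B^T) *m B); split.
- by rewrite trmx_mul trmx_mul trmxK trmx_inv trmx_mul trmxK mulmxA.
- have /submxP [D ->] : (A <= B)%MS by rewrite eqB.
  by rewrite -!mulmxA (mulmxA B) (mulmxA (B *m _)) mulmxV // mul1mx.
- have /submxP [D ->] : (B <= A)%MS by rewrite eqB.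
  by eexists; rewrite mulmxA; reflexivity.
Qed.

(** The three clauses characterize the orthogonal projection onto V(w): symmetric, with columns in
    V(w), and the identity on V(w). *)
Lemma ncproj_exists w : exists P : seq I -> seq I -> R,
  [/\ forall s t, P s t = P t s,
      forall t, ncspan w (P^~ t)
    & forall f, ncspan w f -> forall s, size s = size w ->
        \sum_(t <- words I (size w)) P s t * f t = f s].
Proof.
pose W := words I (size w); pose m := size W.
pose lab (c : 'I_m) := nth [::] W c.
pose phi (e : {ffun 'I_m -> bool}) s := [exists c, (lab c == s) && e c].
(* One row for every Boolean function on the words, replaced by zero unless it belongs to [ncgen]:
   the row space is V(w), without any enumeration of the generators. *)
pose A : 'M[R]_(_, m) := \matrix_(r < #|{: {ffun 'I_m -> bool}}|, c < m)
  (`[< ncgen w (phi (enum_val r)) >] && enum_val r c)%:R.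
have lab_inj : injective lab.
  move=> c d /eqP; rewrite nth_uniq ?words_uniq // => /eqP; exact: val_inj.
have labP s : size s = size w -> exists c, s = lab c.
  move=> hs; have sW : s \in W by rewrite mem_words hs.
  have hi : (index s W < m)%N by rewrite index_mem.
  by exists (Ordinal hi); rewrite /lab /= nth_index.
have sum_lab F : \sum_(t <- W) F t = \sum_c F (lab c) :> R.
  by rewrite (big_nth [::]) big_mkord.
have phiE e c : phi e (lab c) = e c.
  apply/existsP/idP => [[d /andP [/eqP /lab_inj -> //]]|he].
  by exists c; rewrite eqxx.
have [P [Psym AP [D PD]]] := row_projector_exists A.
pose Pf s t := \sum_c \sum_d ((lab c == s) && (lab d == t))%:R * P c d.
have PfE c d : Pf (lab c) (lab d) = P c d.
  rewrite /Pf (bigD1 c) //= [X in _ + X]big1 ?addr0 => [|i ic].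
    rewrite (bigD1 d) //= !eqxx mul1r big1 ?addr0 // => i id.
    by rewrite (inj_eq lab_inj) (negPf id) mul0r.
  by rewrite big1 // => j _; rewrite (inj_eq lab_inj) (negPf ic) mul0r.
exists Pf; split.
- move=> s t; rewrite /Pf exchange_big /=; apply: eq_bigr => c _.
  by apply: eq_bigr => d _; rewrite andbC -{1}Psym mxE.
- move=> t; apply: (@ncspan_ext _ (fun s => \sum_d \sum_r
     ((lab d == t)%:R * D d r) *
       (`[< ncgen w (phi (enum_val r)) >] && phi (enum_val r) s)%:R)).
    apply: ncspan_sum => d _; apply: ncspan_sum => r _; apply: ncspanZ.
    by case: asboolP => h /=; [exact: ncspan_gen | exact: NcSpan0].
  move=> s /labP [c ->]; rewrite /Pf [RHS](bigD1 c) //= [X in _ = _ + X]big1 ?addr0.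
    apply: eq_bigr => d _; rewrite eqxx /= -Psym mxE PD mxE mulr_sumr.
    by apply: eq_bigr => r _; rewrite mxE phiE mulrA.
  by move=> i ic; rewrite big1 // => d _; rewrite (inj_eq lab_inj) (negPf ic) mul0r.
- move=> f; elim=> {f} [f hf|c e f0 f he _ IH hf] s hs.
    by rewrite hf // big_seq big1 // => t; rewrite mem_words => /eqP/hf ->; rewrite mulr0.
  have -> : \sum_(t <- words I (size w)) Pf s t * f t =
     c * (\sum_(t <- W) Pf s t * (e t)%:R) + \sum_(t <- W) Pf s t * f0 t.
    rewrite mulr_sumr -big_split /=; apply: eq_words => t ht.
    by rewrite hf // mulrDr mulrCA.
  rewrite IH // hf //; congr (c * _ + _).
  have [c0 ->] := labP s hs.
  pose e0 := [ffun d => e (lab d)].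
  have ge0 : ncgen w (phi e0).
    by apply: (ncgen_ext he) => t /labP [d ->]; rewrite phiE ffunE.
  rewrite sum_lab.
  have := congr1 (fun M : 'M[R]_(_, _) => M (enum_rank e0) c0) AP.
  rewrite !mxE enum_rankK (asboolT ge0) /= ffunE => <-.
  apply: eq_bigr => d _; rewrite PfE !mxE enum_rankK (asboolT ge0) /= ffunE.
  by rewrite mulrC -{1}Psym mxE.
Qed.

End NoncrossingSpan.

(** * Positivity of the Casimir map *)

Section CasimirPositivity.
Variables (R : realFieldType) (n : nat) (J : finType) (T : J -> 'M[R]_n).
Variable inM : 'M[R]_n -> Prop.

Definition mxdot (A B : 'M[R]_n) : R := \tr (A^T *m B).

Lemma mxdotC A B : mxdot A B = mxdot B A.
Proof. by rewrite /mxdot -mxtrace_tr trmx_mul trmxK. Qed.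

Lemma mxdot_ge0 A : 0 <= mxdot A A.
Proof.
rewrite /mxdot /mxtrace sumr_ge0 // => i _; rewrite mxE sumr_ge0 // => j _.
by rewrite mxE -expr2 sqr_ge0.
Qed.

Hypothesis inM_T : forall a, inM (T a).
Hypothesis inM_1 : inM 1%:M.
Hypothesis inM_mul : forall A B, inM A -> inM B -> inM (A *m B).
Hypothesis inM_tr : forall A, inM A -> inM A^T.
Hypothesis parseval : forall A, inM A -> A = \sum_a mxdot A (T a) *: T a.

(** Here T is a Parseval frame of the matrix algebra [inM]. On matrix units, the bilinear form X, Y
    |-> [mxdot X (casimir Y)] is the Choi matrix of the orthogonal projection onto that algebra, so
    its positivity is complete positivity of the conditional expectation. *)
Definition casimir X := \sum_a T a *m X *m (T a)^T.

(** Expand A T_a in the frame, move A to the other factor by <A T_a, T_b> = <T_a, A^T T_b>, and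
    resum over a. *)
Lemma casimir_comm A X : inM A -> A *m casimir X = casimir X *m A.
Proof.
move=> hA; rewrite /casimir mulmx_sumr mulmx_suml.
under eq_bigr => a _.
  rewrite !mulmxA (parseval (inM_mul hA (inM_T a))) !mulmx_suml.
  under eq_bigr do rewrite -!scalemxAl.
  over.
rewrite exchange_big /=; apply: eq_bigr => b _.
have -> : T b *m X *m (T b)^T *m A = T b *m X *m (A^T *m T b)^T.
  by rewrite trmx_mul trmxK !mulmxA.
rewrite (parseval (inM_mul (inM_tr hA) (inM_T b))) raddf_sum mulmx_sumr /=.
apply: eq_bigr => a _; rewrite linearZ /= -scalemxAr; congr (_ *: _).
by rewrite mxdotC /mxdot !trmx_mul trmxK mulmxA.
Qed.

(** The transposes form another Parseval frame of the same algebra, and the sum does not depend on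
    the frame. *)
Lemma casimir_tr X : \sum_a (T a)^T *m X *m T a = casimir X.
Proof.
under eq_bigr => a _.
  rewrite (parseval (inM_tr (inM_T a))) !mulmx_suml.
  under eq_bigr do rewrite -!scalemxAl.
  over.
rewrite exchange_big /=; apply: eq_bigr => b _.
rewrite [X in _ = _ *m X](parseval (inM_tr (inM_T b))) mulmx_sumr.
apply: eq_bigr => a _; rewrite -scalemxAr; congr (_ *: _).
by rewrite /mxdot !trmxK mxtrace_mulC.
Qed.

Lemma casimir_sym X Y : mxdot X (casimir Y) = mxdot (casimir X) Y.
Proof.
have -> : (casimir X) = (casimir X^T)^T.
  rewrite /casimir raddf_sum /=; apply: eq_bigr => a _.
  by rewrite !trmx_mul !trmxK mulmxA.
rewrite /mxdot trmxK -casimir_tr /casimir mulmx_sumr mulmx_suml !raddf_sum /=.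
apply: eq_bigr => a _.
by rewrite mulmxA mxtrace_mulC !mulmxA.
Qed.

(** If x [casimir 1] = 0, the sum of the squared norms of the x T_a vanishes, so every x T_a is 0;
    but 1 is a combination of the T_a. *)
Lemma casimir1_unit : casimir 1%:M \in unitmx.
Proof.
rewrite -row_free_unit -kermx_eq0; apply/rowV0P => x /sub_kermxP hx.
have h0 a : x *m T a = 0.
  have : \sum_a (x *m T a) *m (x *m T a)^T = 0.
    rewrite -[RHS](mul0mx _ x^T) -hx /casimir mulmx_sumr mulmx_suml.
    by apply: eq_bigr => b _; rewrite mulmx1 trmx_mul !mulmxA.
  move/matrixP/(_ 0 0); rewrite summxE mxE => /eqP.
  have pos b : 0 <= ((x *m T b) *m (x *m T b)^T) 0 0.
    by rewrite mxE sumr_ge0 // => i _; rewrite [_^T _ _]mxE -expr2 sqr_ge0.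
  rewrite psumr_eq0 => [|b _ //]; move/allP/(_ a); rewrite mem_index_enum => /(_ isT) /=.
  rewrite mxE psumr_eq0 => [|i _]; last by rewrite [_^T _ _]mxE -expr2 sqr_ge0.
  move/allP => h; apply/rowP => j; have := h j; rewrite mem_index_enum => /(_ isT) /=.
  by rewrite [_^T _ _]mxE -expr2 sqrf_eq0 => /eqP ->; rewrite mxE.
rewrite -[x]mulmx1 (parseval inM_1) mulmx_sumr big1 // => a _.
by rewrite -scalemxAr h0 scaler0.
Qed.

(* With z := casimir 1, which is central, positive and invertible, one has
   casimir (casimir X) = z * casimir X, so that Y := z^-1 * casimir X satisfies
   casimir Y = casimir X = z * Y. *)
Lemma casimir_ge0 X : 0 <= mxdot X (casimir X).
Proof.
pose z := casimir 1%:M; have uz : z \in unitmx := casimir1_unit.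
have zE : z = \sum_a T a *m (T a)^T.
  by apply: eq_bigr => a _; rewrite mulmx1.
have zX : z *m casimir X = casimir X *m z.
  rewrite zE mulmx_suml mulmx_sumr; apply: eq_bigr => a _.
  by rewrite -mulmxA (casimir_comm _ (inM_tr (inM_T a))) mulmxA casimir_comm // mulmxA.
pose Y := invmx z *m casimir X.
have zY : z *m Y = casimir X by rewrite mulmxA mulmxV // mul1mx.
have ziT a : T a *m invmx z = invmx z *m T a.
  rewrite -[RHS]mulmx1 -(mulmxV uz) !mulmxA -(mulmxA _ (T a)).
  by rewrite casimir_comm // -/z mulmxA mulVmx // mul1mx.
have YX : casimir Y = casimir X.
  have -> : casimir Y = invmx z *m (casimir X *m z).
    rewrite [Z in _ *m (_ *m Z)]zE !mulmx_sumr; apply: eq_bigr => a _.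
    by rewrite /Y !mulmxA ziT -(mulmxA _ (T a)) casimir_comm // !mulmxA.
  by rewrite -zX mulmxA mulVmx // mul1mx.
rewrite -YX casimir_sym -zY mxdotC /mxdot zE mulmx_suml mulmx_sumr raddf_sum /=.
rewrite sumr_ge0 // => a _.
by have := mxdot_ge0 ((T a)^T *m Y); rewrite /mxdot trmx_mul trmxK !mulmxA.
Qed.

End CasimirPositivity.

(** * The Haar functional *)

Section MatrixDot.
Variables (R : realFieldType) (n : nat).
Implicit Types A B : 'M[R]_n.

Lemma mxdotE A B : mxdot A B = \sum_(p : 'I_n * 'I_n) A p.1 p.2 * B p.1 p.2.
Proof.
rewrite -(pair_bigA _ (fun i j => A i j * B i j)) exchange_big /=.
by apply: eq_bigr => j _; rewrite mxE; apply: eq_bigr => i _; rewrite mxE.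
Qed.

Lemma mxdot_sumZl (J : Type) (r : seq J) (c : J -> R) (F : J -> 'M[R]_n) B :
  mxdot (\sum_(j <- r) c j *: F j) B = \sum_(j <- r) c j * mxdot (F j) B.
Proof.
rewrite /mxdot raddf_sum mulmx_suml raddf_sum /=; apply: eq_bigr => j _.
by rewrite linearZ /= -scalemxAl mxtraceZ.
Qed.

Lemma mxdot_delta a b B : mxdot (delta_mx a b) B = B a b.
Proof.
rewrite mxdotE (bigD1 (a, b)) //= mxE !eqxx mul1r big1 ?addr0 // => -[i j] /=.
by rewrite mxE xpair_eqE => /negPf ->; rewrite mul0r.
Qed.

Lemma mulmx_delta A B a b c d :
  (A *m delta_mx c d *m B) a b = A a c * B d b.
Proof.
rewrite mxE (bigD1 d) //= mxE (bigD1 c) //= mxE !eqxx mulr1.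
rewrite [X in A a c + X]big1 ?addr0 => [|i ic].
  rewrite big1 ?addr0 // => j /negPf jd; rewrite mxE big1 ?mul0r // => i _.
  by rewrite mxE jd andbF mulr0.
by rewrite mxE (negPf ic) mulr0.
Qed.

End MatrixDot.

Section HaarFunctional.
Variables (R : realFieldType) (G : groupType) (I : finType).
Implicit Types (w u v : seq G) (s t : seq I).

Definition ncproj w : seq I -> seq I -> R := projT1 (cid (ncproj_exists R I w)).

Lemma ncproj_sym w s t : ncproj w s t = ncproj w t s.
Proof. by rewrite /ncproj; case: cid => P []. Qed.

Lemma ncproj_span w t : ncspan w (ncproj w ^~ t).
Proof. by rewrite /ncproj; case: cid => P []. Qed.

Lemma ncproj_span_r w s : ncspan w (ncproj w s).
Proof. by apply: (ncspan_ext (ncproj_span w s)) => t _; rewrite ncproj_sym. Qed.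

Lemma ncproj_fix w f s : ncspan w f -> size s = size w ->
  \sum_(t <- words I (size w)) ncproj w s t * f t = f s.
Proof. by rewrite /ncproj; case: cid => P [] /= _ _ h /h; apply. Qed.

Lemma sum_words_cat_cons (V : nmodType) m n (F : seq I -> V) :
  \sum_(s <- words I (m + n.+1)) F s =
  \sum_(s1 <- words I m) \sum_x \sum_(s2 <- words I n) F (s1 ++ x :: s2).
Proof. by rewrite sum_words_cat; apply: eq_bigr => s1 _; rewrite sum_wordsS. Qed.

(** Let S be the splitting map from words over w' to words over w. Both S and its adjoint preserve
    the spaces V, hence P_w S = P_w S P_w' = S P_w'. The two sides are expanded by the fixed-vector
    property of P_w' and of P_w, and the two expansions are the same sum. *)
Lemma ncproj_merge w1 g h w2 i1 i i2 j1 j k j2 :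
  size i1 = size w1 -> size j1 = size w1 -> size i2 = size w2 -> size j2 = size w2 ->
  ncproj (w1 ++ g :: h :: w2) (i1 ++ i :: i :: i2) (j1 ++ j :: k :: j2) =
  (j == k)%:R * ncproj (w1 ++ (g * h)%g :: w2) (i1 ++ i :: i2) (j1 ++ j :: j2).
Proof.
move=> hi1 hj1 hi2 hj2.
pose w := w1 ++ g :: h :: w2; pose w' := w1 ++ (g * h)%g :: w2.
pose dup (s : seq I) := take (size w1) s ++ take 1 (drop (size w1) s) ++ drop (size w1) s.
have dupE s1 x s2 : size s1 = size w1 -> dup (s1 ++ x :: s2) = s1 ++ x :: x :: s2.
  by move=> hs; rewrite /dup take_size_cat // drop_size_cat //= take0.
pose H t := if drop (size w1) t is x :: y :: s2 then
  (x == y)%:R * ncproj w' (i1 ++ i :: i2) (take (size w1) t ++ x :: s2) else 0.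
have HE s1 x y s2 : size s1 = size w1 -> H (s1 ++ x :: y :: s2) =
    (x == y)%:R * ncproj w' (i1 ++ i :: i2) (s1 ++ x :: s2).
  by move=> hs; rewrite /H take_size_cat // drop_size_cat.
have hF : ncspan w' (fun s => ncproj w (dup s) (j1 ++ j :: k :: j2)).
  apply: (ncspan_merge (ncproj_span _ _)) => s1 x s2 hs1 hs2.
  by rewrite dupE.
have hH : ncspan w H.
  apply: (ncspan_split (ncproj_span_r _ _)) => s1 x y s2 hs1 hs2.
  by rewrite HE.
have szi : size (i1 ++ i :: i2) = size w' by rewrite !size_cat /= hi1 hi2.
have szj : size (j1 ++ j :: k :: j2) = size w by rewrite !size_cat /= hj1 hj2.
have := ncproj_fix hF szi; rewrite dupE // => <-.
have := ncproj_fix hH szj; rewrite HE // => <-.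
have -> : size w' = (size w1 + (size w2).+1)%N by rewrite size_cat.
have -> : size w = (size w1 + (size w2).+2)%N by rewrite size_cat.
rewrite !sum_words_cat_cons; apply: eq_words => s1 hs1; apply: eq_bigr => x _.
rewrite sum_wordsS (bigD1 x) //= [X in _ + X]big1 ?addr0.
  apply: eq_words => s2 hs2.
  by rewrite dupE // HE // eqxx mul1r mulrC ncproj_sym.
move=> y yx; rewrite big1_seq // => s2 _.
by rewrite HE // eq_sym (negPf yx) mul0r mulr0.
Qed.

(** The argument of [ncproj_merge], with insertion and its adjoint, erasing. *)
Lemma ncproj_erase w1 w2 i1 i i2 j1 j2 :
  size i1 = size w1 -> size j1 = size w1 -> size i2 = size w2 -> size j2 = size w2 ->
  \sum_l ncproj (w1 ++ 1%g :: w2) (i1 ++ i :: i2) (j1 ++ l :: j2) =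
  ncproj (w1 ++ w2) (i1 ++ i2) (j1 ++ j2).
Proof.
move=> hi1 hj1 hi2 hj2.
pose w := w1 ++ 1%g :: w2; pose w' := w1 ++ w2; pose n := size w1.
pose del (s : seq I) := take n s ++ drop n.+1 s.
have delE s1 x s2 : size s1 = n -> del (s1 ++ x :: s2) = s1 ++ s2.
  by move=> hs; rewrite /del take_size_cat // -cat_rcons drop_size_cat ?size_rcons ?hs.
pose F t := \sum_l ncproj w (i1 ++ i :: i2) (take n t ++ l :: drop n t).
have FE s1 s2 : size s1 = n -> F (s1 ++ s2) = \sum_l ncproj w (i1 ++ i :: i2) (s1 ++ l :: s2).
  by move=> hs; rewrite /F take_size_cat // drop_size_cat.
have hF : ncspan w' F.
  apply: (ncspan_erase (ncproj_span_r w (i1 ++ i :: i2))) => s1 s2 hs1 hs2.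
  by rewrite FE.
have hH : ncspan w (fun s => ncproj w' (del s) (j1 ++ j2)).
  apply: (ncspan_insert (ncproj_span w' (j1 ++ j2))) => s1 x s2 hs1 hs2.
  by rewrite delE.
have szi : size (i1 ++ i :: i2) = size w by rewrite !size_cat /= hi1 hi2.
have szj : size (j1 ++ j2) = size w' by rewrite !size_cat /= hj1 hj2.
have := ncproj_fix hF szj; rewrite FE // => <-.
have := ncproj_fix hH szi; rewrite delE // => <-.
have -> : size w = (n + (size w2).+1)%N by rewrite size_cat.
have -> : size w' = (n + (size w2))%N by rewrite size_cat.
rewrite sum_words_cat sum_words_cat_cons; apply: eq_words => s1 hs1.
rewrite [RHS]exchange_big /=; apply: eq_words => s2 hs2.
rewrite FE // mulr_sumr; apply: eq_bigr => x _.
by rewrite delE // mulrC (ncproj_sym w').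
Qed.

Lemma ncproj_rev w s t : size s = size w -> size t = size w ->
  ncproj (winv w) (rev s) (rev t) = ncproj w s t.
Proof.
move=> hs ht.
have h1 : ncspan w (fun s => ncproj (winv w) (rev s) (rev t)).
  by rewrite -{1}(winvK w); apply: ncspan_rev (ncproj_span _ _).
have h2 : ncspan (winv w) (fun t => ncproj w s (rev t)).
  exact: ncspan_rev (ncproj_span_r _ _).
rewrite -(ncproj_fix h1 hs).
have ht' : size (rev t) = size (winv w) by rewrite size_winv size_rev.
have := ncproj_fix h2 ht'; rewrite revK => <-.
rewrite size_winv -[in RHS]sum_words_rev; apply: eq_bigr => u _.
by rewrite revK mulrC ncproj_sym.
Qed.

(** The letter (g, i, j) stands for the generator x_ij(g) and a list for the product of its letters.
    In [madj] the indices i and j stay in place, as in the relation for [star]. *)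
Definition monomial := seq (G * I * I).
Implicit Types x y z : monomial.

Definition mword x : seq G := [seq p.1.1 | p <- x].
Definition mrow x : seq I := [seq p.1.2 | p <- x].
Definition mcol x : seq I := [seq p.2 | p <- x].
Definition madj x : monomial := rev [seq (p.1.1^-1%g, p.1.2, p.2) | p <- x].
Definition haar x : R := ncproj (mword x) (mrow x) (mcol x).
Definition mkern x y : R := haar (madj x ++ y).

Lemma madj_cat x y : madj (x ++ y) = madj y ++ madj x.
Proof. by rewrite /madj map_cat rev_cat. Qed.

Lemma madjK : involutive madj.
Proof.
move=> x; rewrite /madj map_rev revK -map_comp map_id_in // => -[[g i] j] _ /=.
by rewrite invgK.
Qed.

Lemma mword_adj x : mword (madj x) = winv (mword x).
Proof. by rewrite /mword /madj /winv map_rev -!map_comp. Qed.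
Lemma mrow_adj x : mrow (madj x) = rev (mrow x).
Proof. by rewrite /mrow /madj map_rev -!map_comp. Qed.
Lemma mcol_adj x : mcol (madj x) = rev (mcol x).
Proof. by rewrite /mcol /madj map_rev -!map_comp. Qed.

Lemma haar_adj x : haar (madj x) = haar x.
Proof.
by rewrite /haar mword_adj mrow_adj mcol_adj ncproj_rev // /mword !size_map.
Qed.

Lemma mkernC x y : mkern x y = mkern y x.
Proof. by rewrite /mkern -haar_adj madj_cat madjK. Qed.

Lemma mkern_catl x y z : mkern (x ++ y) z = mkern y (madj x ++ z).
Proof. by rewrite /mkern madj_cat catA. Qed.

Lemma haar_nil : haar [::] = 1.
Proof.
have := @ncproj_fix [::] (fun=> 1) [::] (ncspan_nil R G I) erefl.
by rewrite sum_words0 mulr1.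
Qed.

Lemma haar_row x g h i j k y :
  haar (x ++ (g, i, j) :: (h, i, k) :: y) =
  (j == k)%:R * haar (x ++ ((g * h)%g, i, j) :: y).
Proof. by rewrite /haar /mword /mrow /mcol !map_cat /= ncproj_merge ?size_map. Qed.

(** The column relation is the row relation for the symmetric matrix P_w, read with rows and columns
    exchanged. *)
Lemma haar_col x g h i j k y :
  haar (x ++ (g, j, i) :: (h, k, i) :: y) =
  (j == k)%:R * haar (x ++ ((g * h)%g, j, i) :: y).
Proof.
rewrite /haar /mword /mrow /mcol !map_cat /=.
by rewrite ncproj_sym ncproj_merge ?size_map // ncproj_sym.
Qed.

Lemma haar_row_sum x i y :
  \sum_l haar (x ++ (1%g, i, l) :: y) = haar (x ++ y).
Proof.
rewrite /haar /mword /mrow /mcol !map_cat /= -(@ncproj_erase _ _ _ i) ?size_map //.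
by apply: eq_bigr => l _; rewrite !map_cat.
Qed.

Lemma haar_col_sum x i y :
  \sum_l haar (x ++ (1%g, l, i) :: y) = haar (x ++ y).
Proof.
rewrite /haar /mword /mrow /mcol !map_cat /= ncproj_sym.
rewrite -(@ncproj_erase _ _ _ i) ?size_map //.
by apply: eq_bigr => l _; rewrite !map_cat ncproj_sym.
Qed.

(* The matrices T c below form a Parseval frame of the *-algebra of block matrices
   with blocks in Hom(w, w'), and mkern is the kernel of its Casimir map. *)
Lemma mkern_psd (l : seq (R * monomial)) :
  0 <= \sum_(p <- l) \sum_(q <- l) p.1 * q.1 * mkern p.2 q.2.
Proof.
(* The matrices act on the direct sum, over the words w that occur, of the tensor powers of length
   [size w]; the pairs (w, s) in S are its basis. *)
pose W := undup [seq mword p.2 | p <- l].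
pose S := [seq (w, s) | w <- W, s <- words I (size w)].
pose n := size S; pose lab (c : 'I_n) : seq G * seq I := nth ([::], [::]) S c.
have uS : uniq S.
  apply: allpairs_uniq_dep; first exact: undup_uniq.
    by move=> w _; exact: words_uniq.
  by move=> [w s] [w' s'] _ _ /= [-> ->].
have SP w s : ((w, s) \in S) = (w \in W) && (size s == size w).
  apply/allpairsPdep/andP => [[w' [s' [hw hs [-> ->]]]]|[hw hs]].
    by rewrite -mem_words.
  by exists w, s; rewrite mem_words.
have lab_inj : injective lab.
  by move=> c d /eqP; rewrite nth_uniq // => /eqP; exact: val_inj.
have labS c : lab c \in S by rewrite mem_nth.
have labW c : (lab c).1 \in W.
  by have := labS c; rewrite (surjective_pairing (lab c)) SP => /andP [].
have labsz c : size (lab c).2 = size (lab c).1.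
  by have := labS c; rewrite (surjective_pairing (lab c)) SP => /andP [_ /eqP].
have labP w s : w \in W -> size s = size w -> exists c, lab c = (w, s).
  move=> hw hs; have h : (w, s) \in S by rewrite SP hw hs eqxx.
  have hi : (index (w, s) S < n)%N by rewrite index_mem.
  by exists (Ordinal hi); rewrite /lab /= nth_index.
have sum_lab w (F : seq I -> R) : w \in W ->
    \sum_(c | (lab c).1 == w) F (lab c).2 = \sum_(s <- words I (size w)) F s.
  move=> hw.
  have -> : \sum_(c | (lab c).1 == w) F (lab c).2 =
      \sum_(p <- S | p.1 == w) F p.2 by rewrite (big_nth ([::], [::])) big_mkord.
  rewrite big_mkcond big_allpairs_dep (bigD1_seq w) ?undup_uniq //=.
  rewrite [X in _ + X]big1 ?addr0 => [|v /negPf vw]; last first.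
    by rewrite big1 // => s _; rewrite vw.
  by apply: eq_bigr => s _; rewrite eqxx.
have sum_lab2 w w' (F : seq I -> R) : w \in W -> w' \in W ->
    \sum_(c | ((lab c.1).1 == w') && ((lab c.2).1 == w)) F (rev (lab c.2).2 ++ (lab c.1).2) =
    \sum_(s <- words I (size (winv w ++ w'))) F s.
  move=> hw hw'; rewrite -(pair_big (fun c => (lab c).1 == w') (fun c => (lab c).1 == w)
      (fun c d => F (rev (lab d).2 ++ (lab c).2))) /=.
  under eq_bigr do rewrite (sum_lab w (fun s => F (rev s ++ _))) //.
  rewrite (sum_lab w' (fun s' => \sum_(s <- _) F (rev s ++ s'))) //.
  by rewrite size_cat size_winv sum_words_cat exchange_big /= -[RHS]sum_words_rev.
pose q (a' a b' b : seq G * seq I) : R :=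
  ncproj (winv a.1 ++ a'.1) (rev a.2 ++ a'.2) (rev b.2 ++ b'.2).
(* T c is the orthogonal projection onto the algebra of the matrix unit at c. Pairing with T c
   therefore reads off the entry at c of an element of the algebra ([dotT]), which yields the
   Parseval identity. *)
pose T (c : 'I_n * 'I_n) : 'M[R]_n := \matrix_(r', r)
  ((((lab r').1 == (lab c.1).1) && ((lab r).1 == (lab c.2).1))%:R *
    q (lab r') (lab r) (lab c.1) (lab c.2)).
(* Blockwise membership: the block from w to w' comes from a vector of V(w^-1 w'). *)
pose inM (A : 'M[R]_n) := forall w w', w \in W -> w' \in W ->
  exists2 f, ncspan (winv w ++ w') f &
  forall r' r, (lab r').1 = w' -> (lab r).1 = w ->
    A r' r = f (rev (lab r).2 ++ (lab r').2).
have inM_T c : inM (T c).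
  move=> w w' hw hw'.
  have [/andP [/eqP h1 /eqP h2]|h] :=
      boolP ((w' == (lab c.1).1) && (w == (lab c.2).1)); last first.
    exists (fun=> 0); first exact: NcSpan0.
    by move=> r' r hr' hr; rewrite mxE hr hr' (negPf h) mul0r.
  exists (fun s => ncproj (winv w ++ w') s (rev (lab c.2).2 ++ (lab c.1).2)).
    exact: ncproj_span.
  by move=> r' r hr' hr; rewrite mxE hr hr' h1 h2 !eqxx mul1r /q hr hr' h1 h2.
have inM_1 : inM 1%:M.
  move=> w w' hw hw'; have [<-|neq] := eqVneq w w'.
    exists (fun s => (take (size (winv w)) s == rev (drop (size (winv w)) s))%:R).
      by have := ncspan_id R I (winv w); rewrite winvK.
    move=> r' r hr' hr; rewrite mxE.
    have szr : size (rev (lab r).2) = size (winv w).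
      by rewrite size_rev labsz hr size_winv.
    rewrite take_size_cat // drop_size_cat // (inj_eq (inv_inj (@revK _))).
    congr ((nat_of_bool _)%:R); apply/eqP/eqP => [-> //|h].
    apply: lab_inj; rewrite (surjective_pairing (lab r)) (surjective_pairing (lab r')).
    by rewrite hr hr' h.
  exists (fun=> 0); first exact: NcSpan0.
  move=> r' r hr' hr; rewrite mxE; case: eqP => // rr'.
  by move: neq; rewrite -hr -hr' rr' eqxx.
have inM_tr A : inM A -> inM A^T.
  move=> hA w w' hw hw'; have [f hf E] := hA w' w hw' hw.
  exists (fun s => f (rev s)).
    by have := ncspan_rev hf; rewrite winv_cat winvK.
  by move=> r' r hr' hr; rewrite mxE E // rev_cat revK.
(* A block of the product is a sum over intermediate words v, and each summand is a contraction over
   v. Outside W the chosen functions default to 0. *)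
have inM_mul A B : inM A -> inM B -> inM (A *m B).
  move=> hA hB w w' hw hw'.
  have /choice [fA hfA] : forall v, exists f, v \in W -> ncspan (winv v ++ w') f /\
    forall r' r, (lab r').1 = w' -> (lab r).1 = v ->
    A r' r = f (rev (lab r).2 ++ (lab r').2).
    move=> v; case: (boolP (v \in W)) => hv; last by exists (fun=> 0).
    by have [f h1 h2] := hA v w' hv hw'; exists f.
  have /choice [fB hfB] : forall v, exists f, v \in W -> ncspan (winv w ++ v) f /\
    forall r' r, (lab r').1 = v -> (lab r).1 = w ->
    B r' r = f (rev (lab r).2 ++ (lab r').2).
    move=> v; case: (boolP (v \in W)) => hv; last by exists (fun=> 0).
    by have [f h1 h2] := hB w v hw hv; exists f.
  pose F v s := \sum_(t <- words I (size v))
     fB v (take (size w) s ++ t) * fA v (rev t ++ drop (size w) s).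
  exists (fun s => \sum_(v <- W | v \in W) F v s).
    apply: ncspan_sum => v hv; have [[hA1 _] [hB1 _]] := (hfA v hv, hfB v hv).
    have := ncspan_cat hB1 hA1; rewrite -catA => h.
    apply: (ncspan_contract h) => s1 s2; rewrite size_winv => h1 h2.
    rewrite /F take_size_cat // drop_size_cat //; apply: eq_words => t ht.
    have szt : size (s1 ++ t) = size (winv w ++ v) by rewrite !size_cat size_winv h1 ht.
    by rewrite catA take_size_cat // drop_size_cat.
  move=> r' r hr' hr; rewrite mxE -big_seq.
  have -> : \sum_j A r' j * B j r =
      \sum_(v <- W) \sum_(j | (lab j).1 == v) A r' j * B j r.
    rewrite (exchange_big_dep xpredT) //=; apply: eq_bigr => j _.
    rewrite -big_filter (_ : seq.filter _ _ = [:: (lab j).1]) ?big_seq1 //.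
    have := filter_pred1_uniq (undup_uniq [seq mword p.2 | p <- l]) (labW j).
    by move=> <-; apply: eq_filter => v /=; rewrite eq_sym.
  apply: eq_big_seq => v hv; rewrite /F -(sum_lab v (fun t => _ * _)) //.
  have [[_ hA1] [_ hB1]] := (hfA v hv, hfB v hv).
  apply: eq_bigr => j /eqP hj; rewrite (hA1 _ _ hr' hj) (hB1 _ _ hj hr) mulrC.
  have szr : size (rev (lab r).2) = size w by rewrite size_rev labsz hr.
  by rewrite take_size_cat // drop_size_cat.
have labszr (c : 'I_n * 'I_n) :
    size (rev (lab c.2).2 ++ (lab c.1).2) = size (winv (lab c.2).1 ++ (lab c.1).1).
  by rewrite !size_cat size_rev size_winv !labsz.
have dotT A c : inM A -> mxdot A (T c) = A c.1 c.2.
  move=> hA; have [f hf E] := hA _ _ (labW c.2) (labW c.1).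
  rewrite (E c.1 c.2) // -(ncproj_fix hf (labszr c)).
  rewrite -(sum_lab2 _ _ (fun s => ncproj _ _ s * f s)) // mxdotE big_mkcond /=.
  rewrite [RHS]big_mkcond /=; apply: eq_bigr => -[r' r] _ /=.
  rewrite mxE; case: eqP => h1 /=; last by rewrite mul0r mulr0.
  case: eqP => h2 /=; last by rewrite mul0r mulr0.
  by rewrite mul1r (E r' r) // mulrC /q h1 h2 ncproj_sym.
have parseval A : inM A -> A = \sum_c mxdot A (T c) *: T c.
  move=> hA; apply/matrixP => r' r; rewrite summxE.
  have [f hf E] := hA _ _ (labW r) (labW r').
  rewrite (E r' r) // -(ncproj_fix hf (labszr (r', r))) /=.
  rewrite -(sum_lab2 _ _ (fun s => ncproj _ _ s * f s)) // big_mkcond /=.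
  apply: eq_bigr => c _; rewrite mxE dotT // mxE (eq_sym (lab r').1) (eq_sym (lab r).1).
  case: eqP => h1 /=; last by rewrite mul0r mulr0.
  case: eqP => h2 /=; last by rewrite mul0r mulr0.
  by rewrite mul1r (E c.1 c.2) // mulrC.
have TT r' r d' d : (lab r').1 = (lab d').1 -> (lab r).1 = (lab d).1 ->
    \sum_c T c r' r * T c d' d = q (lab r') (lab r) (lab d') (lab d).
  move=> h1 h2; rewrite /q -(ncproj_fix (ncproj_span _ _) (labszr (r', r))) /=.
  rewrite -(sum_lab2 _ _ (fun s => ncproj _ _ s * ncproj _ s _)) // big_mkcond /=.
  rewrite [RHS]big_mkcond /=; apply: eq_bigr => c _; rewrite !mxE -h1 -h2.
  rewrite (eq_sym (lab r').1) (eq_sym (lab r).1).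
  case: eqP => h3 /=; last by rewrite !mul0r.
  case: eqP => h4 /=; last by rewrite !mul0r.
  by rewrite !mul1r /q h1 h2 (ncproj_sym _ (rev (lab d).2 ++ _)).
(* The empty list is set aside because a basis index c0 is needed below as a default value of
   [idx]. *)
case: l @W @S @n @lab uS SP lab_inj labS labW labsz labP sum_lab sum_lab2
  @q @T @inM inM_T inM_1 inM_tr inM_mul labszr dotT parseval TT.
  by move=> *; rewrite big_nil.
move=> p0 l0; set l := p0 :: l0 => W S n lab uS SP lab_inj labS labW labsz labP
  sum_lab sum_lab2 q T inM inM_T inM_1 inM_tr inM_mul labszr dotT parseval TT.
have [c0 _] : exists c, lab c = (mword p0.2, mrow p0.2).
  by apply: labP; rewrite ?mem_undup ?mem_head // !size_map.
have /choice [idx idxP] : forall p : R * monomial, exists c : 'I_n * 'I_n, p \in l ->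
    lab c.1 = (mword p.2, mrow p.2) /\ lab c.2 = (mword p.2, mcol p.2).
  move=> p; case: (boolP (p \in l)) => hp; last by exists (c0, c0).
  have hw : mword p.2 \in W by rewrite mem_undup; apply/mapP; exists p.
  have [c hc] := labP (mword p.2) (mrow p.2) hw (etrans (size_map _ _) (esym (size_map _ _))).
  have [d hd] := labP (mword p.2) (mcol p.2) hw (etrans (size_map _ _) (esym (size_map _ _))).
  by exists (c, d).
(* Each monomial becomes the matrix unit given by its row and column indices; the entries of
   [casimir] between such units are the values of [mkern]. *)
pose X : 'M[R]_n := \sum_(p <- l) p.1 *: delta_mx (idx p).1 (idx p).2.
have := casimir_ge0 inM_T inM_1 inM_mul inM_tr parseval X.
suff -> : mxdot X (casimir T X) =
  \sum_(p <- l) \sum_(q0 <- l) p.1 * q0.1 * mkern p.2 q0.2 by [].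
rewrite {1}/X mxdot_sumZl; apply: eq_big_seq => p hp.
rewrite mxdot_delta /casimir summxE.
under eq_bigr => c _.
  rewrite /X mulmx_sumr mulmx_suml summxE.
  under eq_bigr do rewrite -scalemxAr -scalemxAl mxE mulmx_delta [_^T _ _]mxE.
  over.
rewrite exchange_big /= mulr_sumr; apply: eq_big_seq => q0 hq.
have [[h1 h2] [h3 h4]] := (idxP p hp, idxP q0 hq).
rewrite -mulr_sumr TT ?h1 ?h2 ?h3 ?h4 //.
rewrite mulrA; congr (_ * _); rewrite mkernC /mkern /haar /q.
by rewrite /mword /mrow /mcol !map_cat -!/(mword _) -!/(mrow _) -!/(mcol _)
  mword_adj mrow_adj mcol_adj.
Qed.

End HaarFunctional.

(** * Noncrossing labellings *)

Local Open Scope nat_scope.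

Section Labellings.
Variables (G : groupType) (I : finType) (L : eqType).
Implicit Types (w : seq G) (c : seq L) (s : seq I).

(** A partition of the letters is recorded by one label per letter, so that a crossing becomes a
    forbidden subsequence. *)
Definition nclabel c := forall x y, x != y -> ~~ subseq [:: x; y; x; y] c.

Definition label_prod w c (t : L) : G := (\prod_(p <- zip w c | p.2 == t) p.1)%g.

Definition graph_fun (z : seq (L * I)) : bool :=
  all (fun p => all (fun q => (p.1 == q.1) ==> (p.2 == q.2)) z) z.

Definition label_delta c s : bool := graph_fun (zip c s).

Definition nclabelling w c :=
  [/\ size c = size w, nclabel c & forall t, label_prod w c t = 1%g].

Lemma graph_funP z : reflect
  (forall t x y, (t, x) \in z -> (t, y) \in z -> x = y) (graph_fun z).
Proof.
apply: (iffP allP) => [h t x y tx ty|h [t x] tx].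
  by have /allP/(_ _ ty) := h _ tx; rewrite /= eqxx => /eqP.
apply/allP => -[u y] uy; apply/implyP => /= /eqP tu; rewrite -tu in uy.
by apply/eqP; apply: h tx uy.
Qed.

Lemma graph_fun_eqi z z' : z =i z' -> graph_fun z = graph_fun z'.
Proof.
move=> e; apply/graph_funP/graph_funP => h t x y hx hy; apply: (h t);
  by rewrite ?e // -?e.
Qed.

Lemma label_delta_insert c1 t c2 s1 x s2 : size s1 = size c1 -> size s2 = size c2 ->
  t \notin c1 ++ c2 ->
  label_delta (c1 ++ t :: c2) (s1 ++ x :: s2) = label_delta (c1 ++ c2) (s1 ++ s2).
Proof.
move=> h1 h2 tc; rewrite /label_delta !zip_cat //=.
rewrite (@graph_fun_eqi _ ((t, x) :: zip c1 s1 ++ zip c2 s2)); last first.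
  by move=> p; rewrite !(mem_cat, inE) orbCA.
have tz y : (t, y) \notin zip c1 s1 ++ zip c2 s2.
  apply: contra tc => h; rewrite -zip_cat // in h.
  have := map_f fst h; rewrite -/(unzip1 _) unzip1_zip //.
  by rewrite !size_cat h1 h2.
apply/graph_funP/graph_funP => h u y z uy uz.
  by apply: (h u); rewrite inE ?uy ?uz orbT.
move: uy uz; rewrite !inE => /orP [/eqP [-> ->]|uy] /orP [/eqP e|uz].
- by case: e.
- by move: (tz z); rewrite uz.
- by move: (tz y); case: e => <- _; rewrite uy.
- exact: h uy uz.
Qed.

Lemma label_delta_split c1 t c2 s1 x y s2 : size s1 = size c1 -> size s2 = size c2 ->
  label_delta (c1 ++ t :: t :: c2) (s1 ++ x :: y :: s2) =
  (x == y) && label_delta (c1 ++ t :: c2) (s1 ++ x :: s2).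
Proof.
move=> h1 h2; rewrite /label_delta !zip_cat //=.
case: (x =P y) => [<-|xy] /=.
  apply: graph_fun_eqi => p; rewrite !(mem_cat, inE).
  by case: (p \in zip c1 s1); case: (p == _).
apply/negbTE/negP => /graph_funP h; apply: xy; apply: (h t);
  by rewrite !(mem_cat, inE) eqxx ?orbT.
Qed.

Lemma label_prod_cons w1 g w2 c1 t c2 u : size c1 = size w1 ->
  label_prod (w1 ++ g :: w2) (c1 ++ t :: c2) u =
  (label_prod w1 c1 u * ((if t == u then g else 1) * label_prod w2 c2 u))%g.
Proof.
move=> h; rewrite /label_prod zip_cat // big_cat /= big_cons /=.
by case: eqP => _; rewrite ?mul1g.
Qed.

Lemma label_prod_cons0 g w t c u :
  label_prod (g :: w) (t :: c) u = ((if t == u then g else 1) * label_prod w c u)%g.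
Proof. by rewrite /label_prod /= big_cons /=; case: eqP => _; rewrite ?mul1g. Qed.

Lemma label_prod_cat w1 w2 c1 c2 u : size c1 = size w1 ->
  label_prod (w1 ++ w2) (c1 ++ c2) u = (label_prod w1 c1 u * label_prod w2 c2 u)%g.
Proof. by move=> h; rewrite /label_prod zip_cat // big_cat. Qed.

Lemma label_prod_notin w c t : t \notin c -> label_prod w c t = 1%g.
Proof.
elim: c w => [|u c IH] [|g w] //=; rewrite /label_prod ?big_nil //.
rewrite inE negb_or big_cons /= eq_sym => /andP [/negPf -> /IH]; exact.
Qed.

(** The fresh label t occurs once, whereas both letters of a pattern x y x y occur twice; so t can
    be filtered out. *)
Lemma nclabel_insert c1 t c2 :
  t \notin c1 ++ c2 -> nclabel (c1 ++ c2) -> nclabel (c1 ++ t :: c2).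
Proof.
move=> tc h x y xy; apply/negP => hs.
have cnt : count_mem t (c1 ++ t :: c2) = 1.
  move: tc; rewrite -!has_pred1 has_cat negb_or => /andP [h1 h2].
  move: h1 h2; rewrite !has_count -!leqNgt !leqn0 => /eqP h1 /eqP h2.
  by rewrite count_cat /= h1 h2 eqxx.
have := leq_count_subseq (pred1 t) hs; rewrite cnt /= => ht.
have tx : x != t by apply: contraTneq ht => ->; rewrite eqxx; case: eqP.
have ty : y != t by apply: contraTneq ht => ->; rewrite eqxx; case: eqP.
have := h x y xy; apply/negP; rewrite negbK.
have hs' : subseq [:: x; y; x; y] (seq.filter (predC1 t) (c1 ++ t :: c2)).
  by rewrite subseq_filter hs andbT /= tx ty.
apply: subseq_trans hs' _; rewrite filter_cat /= eqxx /= -filter_cat.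
exact: filter_subseq.
Qed.

Lemma nclabel_sub c c' : subseq c c' -> nclabel c' -> nclabel c.
Proof. by move=> hc h x y xy; apply: contra (h x y xy) => hs; apply: subseq_trans hs hc. Qed.

(** A sequence without equal neighbours can use only one of two adjacent copies of t; this is
    applied to the pattern x y x y. *)
Lemma subseq_dup (s : seq L) c1 t c2 : sorted (fun x y : L => x != y) s ->
  subseq s (c1 ++ t :: t :: c2) -> subseq s (c1 ++ t :: c2).
Proof.
elim: c1 s => [|u c1 IH] [|x s] //.
  rewrite /= => hp; case: (x =P t) => [xt|/eqP/negPf xt]; last by rewrite ?xt.
  rewrite xt in hp *.
  case: s hp => [|y s] /=; first by rewrite sub0seq.
  by move=> /andP [ty _]; rewrite eq_sym (negPf ty).
move=> hp; rewrite !cat_cons /=; case: eqP => _; last by apply: IH.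
by apply: IH; exact: path_sorted hp.
Qed.

Lemma nclabel_split c1 t c2 : nclabel (c1 ++ t :: c2) -> nclabel (c1 ++ t :: t :: c2).
Proof.
move=> h x y xy; apply: contra (h x y xy); apply: subseq_dup => /=.
by rewrite xy eq_sym xy.
Qed.

Lemma subseq4 (a1 a2 a3 a4 a5 : seq L) x y z u :
  subseq [:: x; y; z; u] (a1 ++ x :: a2 ++ y :: a3 ++ z :: a4 ++ u :: a5).
Proof.
have key (a b s : seq L) v : subseq s b -> subseq (v :: s) (a ++ v :: b).
  by move=> h; apply: subseq_trans (suffix_subseq a _); rewrite /= eqxx.
by apply: (key); apply: (key); apply: (key); apply: (key); rewrite sub0seq.
Qed.

(** Look at the label u that follows the first t. Either u = t, an adjacent pair; or u recurs inside
    the gap, which gives a shorter gap; or u is unique, since another occurrence outside the gap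
    would cross t. The number n bounds the gap for the induction. *)
Lemma nclabel_reducible_gap n a t m b : size m < n -> nclabel (a ++ t :: m ++ t :: b) ->
  (exists c1 u c2, a ++ t :: m ++ t :: b = c1 ++ u :: u :: c2) \/
  (exists c1 u c2, a ++ t :: m ++ t :: b = c1 ++ u :: c2 /\ u \notin c1 ++ c2).
Proof.
elim: n a t m b => // n IH a t [|u m] b hm hc.
  by left; exists a, t, b.
have [ut|ut] := eqVneq u t.
  by left; exists a, t, (m ++ t :: b); rewrite ut.
have [um|um] := boolP (u \in m).
  case/splitPr: um hm hc => m1 m2 hm hc.
  have := IH (rcons a t) u m1 (m2 ++ t :: b).
  rewrite cat_rcons /= -!catA /=; apply.
    by rewrite -ltnS; apply: leq_ltn_trans hm; rewrite /= size_cat leq_addr.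
  by rewrite /= -!catA /= in hc *.
right; exists (rcons a t), u, (m ++ t :: b); split; first by rewrite cat_rcons.
rewrite mem_cat mem_rcons inE (negPf ut) /= mem_cat inE (negPf um) (negPf ut) /=.
rewrite negb_or; apply/andP; split; apply/negP => hu.
  case/splitPr: hu hc => a1 a2 hc; have := hc u t ut.
  rewrite -catA /=; have := subseq4 a1 a2 [::] m b u t u t.
  by rewrite /= => ->.
case/splitPr: hu hc => b1 b2 hc; have := hc t u; rewrite eq_sym => /(_ ut).
by have := subseq4 a [::] m b1 b2 t u t u; rewrite /= => ->.
Qed.

Lemma nclabel_reducible c : c != [::] -> nclabel c ->
  (exists c1 u c2, c = c1 ++ u :: u :: c2) \/
  (exists c1 u c2, c = c1 ++ u :: c2 /\ u \notin c1 ++ c2).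
Proof.
case: c => // t c _ hc; have [tc|tc] := boolP (t \in c); last first.
  by right; exists [::], t, c.
case/splitPr: tc hc => m b hc.
exact: (@nclabel_reducible_gap (size m).+1 [::] t m b).
Qed.

(** Induction on the length. An adjacent equal pair of labels is removed as a split; otherwise some
    label is unique, its letter must be 1 since it is the whole block product, and it is removed as
    an insertion. *)
Lemma ncgen_of_labelling w c : nclabelling w c -> ncgen w (label_delta c).
Proof.
have [n] := ubnP (size w); elim: n w c => // n IH w c hn [hsz hc hp].
have [c0|c0] := eqVneq c [::].
  rewrite c0 in hsz *; case: w hsz {hn hp} => // _; exact: NcNil.
case: (nclabel_reducible c0 hc) => [[c1 [t [c2 E]]]|[c1 [t [c2 [E tc]]]]]; subst c.
  move: (esym hsz) => /size_catP [w1 [w2 [E h1 /size_consP [g [w3 [E2]]]]]].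
  move=> /size_consP [h [w4 [E3 h4]]]; subst w w2 w3.
  apply: (@NcSplit _ _ _ _ _ _ (label_delta (c1 ++ t :: c2))); last first.
    by move=> s1 x y s2 hs1 hs2; rewrite label_delta_split ?hs1 ?hs2.
  apply: IH.
    by rewrite -ltnS; apply: leq_trans hn; rewrite !size_cat /= !addnS.
  split.
  - by rewrite !size_cat /= h1 h4.
  - by apply: nclabel_sub hc; apply: cat_subseq => //; exact: subseq_cons.
  - move=> u; rewrite -[RHS](hp u) !label_prod_cons // ?label_prod_cons0.
    by case: eqP => _; rewrite ?mul1g // !mulgA.
move: (esym hsz) => /size_catP [w1 [w2 [E h1 /size_consP [g [w3 [E2 h3]]]]]]; subst w w2.
have g1 : g = 1%g.
  move: tc; rewrite mem_cat negb_or => /andP [t1 t2].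
  by have := hp t; rewrite label_prod_cons // !label_prod_notin // eqxx mul1g mulg1.
subst g; apply: (@NcInsert _ _ _ _ (label_delta (c1 ++ c2))); last first.
  by move=> s1 x s2 hs1 hs2; rewrite label_delta_insert ?hs1 ?hs2.
apply: IH.
  by rewrite -ltnS; apply: leq_trans hn; rewrite !size_cat /= addnS.
split.
- by rewrite !size_cat h1 h3.
- by apply: nclabel_sub hc; apply: cat_subseq => //; exact: subseq_cons.
- move=> u; have := hp u; rewrite label_prod_cons // label_prod_cat //.
  by case: eqP; rewrite mul1g.
Qed.

End Labellings.

Lemma labelling_of_ncgen (G : groupType) (I : finType) (w : seq G) (f : seq I -> bool) :
  ncgen w f -> exists2 c : seq nat, nclabelling w c &
    forall s, size s = size w -> f s = label_delta c s.
Proof.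
elim=> {w f} [f hf|w1 w2 f f' _ [c [hsz hc hp] E] hf'|w1 g h w2 f f' _ [c [hsz hc hp] E] hf'].
- exists [::]; first by split=> // t; rewrite /label_prod big_nil.
  by case.
- have [c1 [c2 [Ec h1 h2]]] := size_catP hsz; subst c.
  (* Labels are natural numbers so that a fresh one is always available. *)
  pose t := (\max_(x <- c1 ++ c2) x).+1.
  have tc : t \notin c1 ++ c2.
    apply/negP => h; have := @leq_bigmax_seq _ (c1 ++ c2) xpredT id t h isT.
    by rewrite ltnn.
  exists (c1 ++ t :: c2); first split.
  + by rewrite !size_cat /= h1 h2.
  + exact: nclabel_insert.
  + move=> u; rewrite label_prod_cons //; have := hp u; rewrite label_prod_cat //.
    by case: eqP; rewrite mul1g.
  move=> s /size_catP [s1 [s2 [-> hs1 /size_consP [x [s3 [-> hs3]]]]]].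
  rewrite hf' // E ?label_delta_insert ?hs1 ?hs3 //.
  by rewrite !size_cat hs1 hs3.
- have [c1 [c2 [Ec h1 /size_consP [t [c3 [Ec2 h3]]]]]] := size_catP hsz; subst c c2.
  exists (c1 ++ t :: t :: c3); first split.
  + by rewrite !size_cat /= h1 h3.
  + exact: nclabel_split.
  + move=> u; rewrite -[RHS](hp u) !label_prod_cons // ?label_prod_cons0.
    by case: eqP => _; rewrite ?mul1g // !mulgA.
  move=> s /size_catP [s1 [s2 [-> hs1 /size_consP [x [s3 [-> /size_consP [y [s4 [-> hs4]]]]]]]]].
  rewrite hf' // E ?label_delta_split ?hs1 ?hs4 //.
  by rewrite !size_cat /= hs1 hs4.
Qed.

(** * Partitions of the boundary of the strip *)

Section BoundaryWords.
Variables (k l : nat).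
Local Notation P := ('I_k + 'I_l)%type.

(* The boundary of the strip, read against [boundary_pos]: lower points from left
   to right, then upper points from right to left. *)
Definition bpoints : seq P :=
  [seq inr s | s <- enum 'I_l] ++ rev [seq inl r | r <- enum 'I_k].

(** Frobenius reciprocity: the upper letters are bent down to the right of the lower ones, hence
    reversed and inverted. *)
Definition bword (G : groupType) (g : 'I_k -> G) (h : 'I_l -> G) : seq G :=
  [seq h s | s <- enum 'I_l] ++ winv [seq g r | r <- enum 'I_k].

Definition bindex (I : Type) (i : 'I_k -> I) (j : 'I_l -> I) : seq I :=
  [seq j s | s <- enum 'I_l] ++ rev [seq i r | r <- enum 'I_k].

Definition point_index (I : Type) (i : 'I_k -> I) (j : 'I_l -> I) (x : P) : I :=
  match x with inl r => i r | inr s => j s end.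

Lemma map_bpoints (T : Type) (f : P -> T) : map f bpoints =
  [seq f (inr s) | s <- enum 'I_l] ++ rev [seq f (inl r) | r <- enum 'I_k].
Proof. by rewrite map_cat map_rev -!map_comp. Qed.

Lemma bindexE (I : Type) (i : 'I_k -> I) (j : 'I_l -> I) :
  bindex i j = map (point_index i j) bpoints.
Proof. by rewrite map_bpoints. Qed.

Lemma size_map_ord (T : Type) n (f : 'I_n -> T) : size [seq f r | r <- enum 'I_n] = n.
Proof. by rewrite -[RHS](size_enum_ord n); exact: size_map. Qed.

Lemma size_bpoints : size bpoints = (l + k).
Proof. by rewrite size_cat size_rev !size_map_ord. Qed.

Lemma size_bword (G : groupType) (g : 'I_k -> G) (h : 'I_l -> G) :
  size (bword g h) = (l + k).
Proof. by rewrite size_cat size_winv !size_map_ord. Qed.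

Lemma boundary_pos_bpoints :
  map (@boundary_pos k l) bpoints = rev (iota 0 (k + l)).
Proof.
rewrite map_bpoints iotaD rev_cat; congr (_ ++ _); last first.
  by congr rev; rewrite -[RHS]val_enum_ord.
apply: (@eq_from_nth _ 0); first by rewrite size_map_ord size_rev size_iota.
move=> i; rewrite size_map_ord => hi.
rewrite (nth_map (Ordinal hi)) ?size_enum_ord // nth_rev ?size_iota // nth_iota.
  by rewrite /= nth_enum_ord.
by rewrite ltn_subrL /= (leq_ltn_trans _ hi).
Qed.

Lemma bpoints_uniq : uniq bpoints.
Proof.
by apply: (@map_uniq _ _ (@boundary_pos k l)); rewrite boundary_pos_bpoints rev_uniq iota_uniq.
Qed.

Lemma mem_bpoints x : x \in bpoints.
Proof.
rewrite mem_cat mem_rev; case: x => x; apply/orP; [right | left];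
  by apply: map_f; rewrite mem_enum.
Qed.

Local Notation before := (fun x y : P => boundary_pos y < boundary_pos x).

Lemma bpoints_sorted : sorted before bpoints.
Proof.
have : sorted (fun m n => n < m) (map (@boundary_pos k l) bpoints).
  by rewrite boundary_pos_bpoints rev_sorted; exact: iota_ltn_sorted.
by rewrite sorted_map.
Qed.

Lemma before_trans : transitive before.
Proof. by move=> y x z h1 h2; apply: ltn_trans h2 h1. Qed.

(** This turns the quantified inequalities between positions in [noncrossing] into statements about
    subsequences of [bpoints]. *)
Lemma subseq_bpoints u : subseq u bpoints = sorted before u.
Proof.
apply/idP/idP => [h|hu]; first exact: subseq_sorted before_trans _ _ h bpoints_sorted.
have -> : u = [seq x <- bpoints | x \in u]; last exact: filter_subseq.
apply: (@irr_sorted_eq _ before) => //.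
- exact: before_trans.
- by move=> x; rewrite /= ltnn.
- by apply: sorted_filter bpoints_sorted; exact: before_trans.
- by move=> x; rewrite mem_filter mem_bpoints andbT.
Qed.

Section LabelledPartition.
Variables (L : eqType) (lab : P -> L) (p : {set {set P}}).
Hypothesis p_part : finset.partition p [set: P].
Hypothesis p_lab : forall x y, (y \in finset.pblock p x) = (lab x == lab y).

Lemma block_lab B x y : B \in p -> x \in B -> (y \in B) = (lab x == lab y).
Proof.
case/and3P: p_part => _ tI _ Bp xB.
by rewrite -p_lab (def_pblock tI Bp xB).
Qed.

Lemma pblock_in x : finset.pblock p x \in p.
Proof. by apply: pblock_mem; case/and3P: p_part => /eqP -> _ _; rewrite inE. Qed.

(** [bpoints] runs against [boundary_pos], which is harmless: the pattern x y x y read backwards is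
    y x y x, again a crossing. *)
Lemma noncrossing_label : noncrossing p <-> nclabel (map lab bpoints).
Proof.
split.
  move=> hp t u tu; apply/negP => /subseqP [m _ hm].
  move: hm; rewrite -map_mask => hm.
  have hs : subseq (mask m bpoints) bpoints by exact: mask_subseq.
  case: (mask m bpoints) hm hs => [|x1 [|x2 [|x3 [|x4 []]]]] //= [e1 e2 e3 e4].
  rewrite subseq_bpoints /= => /and4P [h12 h23 h34 _].
  move/forallP/(_ (finset.pblock p x4))/implyP/(_ (pblock_in _)): hp.
  move/forallP/(_ (finset.pblock p x3))/implyP/(_ (pblock_in _))/implyP.
  have h43 : finset.pblock p x4 != finset.pblock p x3.
    apply/eqP => h; have : x3 \in finset.pblock p x4 by rewrite h p_lab.
    by rewrite p_lab -e3 -e4 eq_sym (negPf tu).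
  move=> /(_ h43) /negP; apply.
  apply/existsP; exists x4; rewrite p_lab eqxx /=.
  apply/existsP; exists x3; rewrite p_lab eqxx /=.
  apply/existsP; exists x2; rewrite p_lab -e4 -e2 eqxx /=.
  apply/existsP; exists x1; rewrite p_lab -e3 -e1 eqxx /=.
  by rewrite h34 h23 h12.
move=> hc; apply/forallP => B1; apply/implyP => B1p; apply/forallP => B2; apply/implyP => B2p.
apply/implyP => B12; apply/negP.
case/existsP => x1 /andP [x1B] /existsP [y1 /andP [y1B]] /existsP [x2 /andP [x2B]].
case/existsP => y2 /andP [y2B] /and3P [h1 h2 h3].
have ex : lab x2 = lab x1 by apply/eqP; rewrite -(block_lab _ B1p).
have ey : lab y2 = lab y1 by apply/eqP; rewrite -(block_lab _ B2p).
have xy : lab y1 != lab x1.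
  rewrite -(block_lab _ B2p) //; apply: contra B12 => x1B2; apply/eqP.
  by case/and3P: p_part => _ tI _; rewrite -(def_pblock tI B1p x1B) (def_pblock tI B2p x1B2).
have := hc _ _ xy; apply/negP; rewrite negbK.
have : subseq [:: y2; x2; y1; x1] bpoints by rewrite subseq_bpoints /= h1 h2 h3.
by move/(map_subseq lab); rewrite /= ex ey.
Qed.

Lemma delta_partition_label N (i : multi_index N k) (j : multi_index N l) :
  delta_partition p i j = label_delta (map lab bpoints) (bindex i j).
Proof.
rewrite /label_delta bindexE zip_map.
apply/idP/graph_funP => [/forallP hd t x y /mapP [a _ [-> ->]] /mapP [b _ [e ->]]|h].
  have := hd (finset.pblock p a); rewrite pblock_in /= => /forallP/(_ a).
  rewrite p_lab eqxx /= => /forallP/(_ b).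
  by rewrite p_lab e eqxx /= => /eqP.
apply/forallP => B; apply/implyP => Bp; apply/forallP => x; apply/implyP => xB.
apply/forallP => y; apply/implyP => yB; apply/eqP.
have e : lab x = lab y by apply/eqP; rewrite -(block_lab _ Bp).
apply: (h (lab x)).
  by apply/mapP; exists x => //; rewrite mem_bpoints.
by rewrite e; apply/mapP; exists y => //; rewrite mem_bpoints.
Qed.

Lemma prod_enum_ord (G : groupType) n (Q : pred 'I_n) (F : 'I_n -> G) :
  (\prod_(s <- enum 'I_n | Q s) F s = \prod_(s < n | Q s) F s)%g.
Proof. by rewrite enumT [index_enum _]unlock. Qed.

Lemma prod_rev_inv (G : groupType) (T : Type) (s : seq T) (Q : pred T) (F : T -> G) :
  (\prod_(x <- rev s | Q x) (F x)^-1 = (\prod_(x <- s | Q x) F x)^-1)%g.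
Proof.
elim: s => [|x s IH]; first by rewrite !big_nil invg1.
rewrite rev_cons -cats1 big_cat /= IH !big_cons big_nil.
by case: (Q x); rewrite ?mulg1 // invgM.
Qed.

Lemma label_prod_bword (G : groupType) (g : 'I_k -> G) (h : 'I_l -> G) t :
  label_prod (bword g h) (map lab bpoints) t =
  ((\prod_(s < l | lab (inr s) == t) h s) *
   (\prod_(r < k | lab (inl r) == t) g r)^-1)%g.
Proof.
rewrite map_bpoints /bword label_prod_cat ?size_map // /label_prod zip_map big_map /=.
rewrite prod_enum_ord; congr (_ * _)%g.
rewrite -[in RHS]prod_enum_ord -prod_rev_inv /winv -map_comp.
by rewrite -!map_rev zip_map big_map.
Qed.

(** Along [bword], the product over a block is its lower product times the inverse of its upper
    product, so it is 1 exactly when the two agree. A label that does not occur has an empty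
    product. *)
Lemma NC_group_label (G : groupType) (g : 'I_k -> G) (h : 'I_l -> G) :
  p \in NC_group g h <-> nclabelling (bword g h) (map lab bpoints).
Proof.
rewrite !inE p_part /=.
have prodE B x : B \in p -> x \in B ->
    (label_prod (bword g h) (map lab bpoints) (lab x) == 1)%g =
    (\prod_(r < k | inl r \in B) g r == \prod_(s < l | inr s \in B) h s)%g.
  move=> Bp xB; rewrite label_prod_bword.
  under [X in _ = (X == _)]eq_bigl do rewrite (block_lab _ Bp xB) eq_sym.
  under [X in _ = (_ == X)]eq_bigl do rewrite (block_lab _ Bp xB) eq_sym.
  move: (bigop.body _ _ _) (bigop.body _ _ _) => a b.
  apply/eqP/eqP => [e|->]; last by rewrite mulgV.
  by rewrite -[LHS]mul1g -e mulgVK.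
split=> [/andP [nc /forallP hp]|[hsz hnc hp]].
  split; first by rewrite size_map size_bpoints size_bword.
    exact/noncrossing_label.
  move=> t; have [/mapP [x _ ->]|] := boolP (t \in map lab bpoints); last first.
    exact: label_prod_notin.
  apply/eqP; rewrite (prodE (finset.pblock p x)) ?pblock_in ?p_lab //.
  by have := hp (finset.pblock p x); rewrite pblock_in.
apply/andP; split; first exact/noncrossing_label.
apply/forallP => B; apply/implyP => Bp.
have [x xB] : exists x, x \in B.
  apply/set0Pn; apply: contraTneq Bp => ->; by case/and3P: p_part.
by rewrite -(prodE B x) // hp.
Qed.

End LabelledPartition.
End BoundaryWords.

Local Close Scope nat_scope.

(** * Limits of squares *)

Local Open Scope classical_set_scope.

Section SquareLimits.
Variable R : realType.
Implicit Types (u : nat -> R) (l : R).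

(** The estimates below are quadratic, of Cauchy-Schwarz type; limits are therefore tested on
    squares. *)
Lemma sq_cvg u l :
  (forall e, 0 < e -> exists n0, forall n, (n0 <= n)%N -> (u n - l) ^+ 2 <= e) ->
  u @ \oo --> l.
Proof.
move=> h; apply/cvgrPdist_le => e e0.
have [n0 hn0] := h (e ^+ 2) (exprn_gt0 2 e0).
exists n0 => // n /= hn; rewrite distrC -(@ler_pXn2r _ 2) ?nnegrE ?normr_ge0 ?(ltW e0) //.
by rewrite real_normK ?num_real // hn0.
Qed.

Lemma cvg_sq u l : u @ \oo --> l ->
  forall e, 0 < e -> exists n0, forall n, (n0 <= n)%N -> (u n - l) ^+ 2 <= e.
Proof.
move=> /cvgrPdist_le h e e0.
have s0 : 0 < Num.sqrt e by rewrite sqrtr_gt0.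
have [n0 _ hn0] := h _ s0; exists n0 => n hn; have := hn0 n hn => /= {}h.
rewrite -(sqr_sqrtr (ltW e0)) -[leLHS]real_normK ?num_real //.
by rewrite ler_pXn2r ?nnegrE ?normr_ge0 ?(ltW s0) // distrC.
Qed.

Lemma sq_cauchy_cvg u :
  (forall e, 0 < e -> exists n0, forall m n, (n0 <= m)%N -> (n0 <= n)%N ->
     (u m - u n) ^+ 2 <= e) ->
  exists l, u @ \oo --> l.
Proof.
move=> h; suff /cauchy_cvgP hc : cauchy (u @ \oo) by exists (lim (u @ \oo)).
apply/cauchy_ballP => e e0.
have e1 : 0 < (e / 2) ^+ 2 by rewrite exprn_gt0 // divr_gt0.
have [n0 hn0] := h _ e1.
exists ([set x | exists2 m, (n0 <= m)%N & x = u m],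
        [set x | exists2 m, (n0 <= m)%N & x = u m]).
  by split; exists n0 => // n /= hn; exists n.
move=> [x y] /= [[m hm ->] [n hn ->]].
rewrite /ball /= (@le_lt_trans _ _ (e / 2)) //; last by rewrite ltr_pdivrMr // ltr_pMr // ltr1n.
rewrite -(@ler_pXn2r _ 2) ?nnegrE ?normr_ge0 ?divr_ge0 ?(ltW e0) //.
by rewrite real_normK ?num_real // hn0.
Qed.

Lemma cvg_uniq u l l' : u @ \oo --> l -> u @ \oo --> l' -> l = l'.
Proof. by move=> h h'; apply: (cvg_unique _ h h'). Qed.

Lemma cvg_le_const u l c : u @ \oo --> l -> (forall n, u n <= c) -> l <= c.
Proof.
move=> h hu; rewrite -(cvg_lim _ h) //; apply: limr_le; first by apply/cvg_ex; exists l.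
by apply: nearW.
Qed.

Lemma cvg_le2 u v l l' : u @ \oo --> l -> v @ \oo --> l' ->
  (forall n, u n <= v n) -> l <= l'.
Proof.
move=> h h' hu; rewrite -(cvg_lim _ h) // -(cvg_lim _ h') //; apply: ler_lim.
- by apply/cvg_ex; exists l.
- by apply/cvg_ex; exists l'.
- by apply: nearW.
Qed.

End SquareLimits.

(** * Reproducing kernel Hilbert spaces *)

Record pskernel (R : realType) (X : Type) := PSKernel {
  pskern :> X -> X -> R;
  pskernC : forall x y, pskern x y = pskern y x;
  pskern_psd : forall l : seq (R * X),
    0 <= \sum_(p <- l) \sum_(q <- l) p.1 * q.1 * pskern p.2 q.2
}.

Section FormalCombinations.
Variables (R : realType) (X : Type).
Implicit Types (f g : X -> R) (a b c l : seq (R * X)).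

(** Formal combinations are unreduced lists of pairs (coefficient, point); they are only ever
    evaluated, so no quotient is formed. *)
Definition fcev f l : R := \sum_(p <- l) p.1 * f p.2.
Definition fcscale (r : R) l := [seq (r * p.1, p.2) | p <- l].

Lemma fcev_cat f a b : fcev f (a ++ b) = fcev f a + fcev f b.
Proof. exact: big_cat. Qed.

Lemma fcev_scale f r l : fcev f (fcscale r l) = r * fcev f l.
Proof.
by rewrite /fcev big_map mulr_sumr; apply: eq_bigr => p _; rewrite mulrA.
Qed.

Lemma fcevD f g l : fcev (f + g) l = fcev f l + fcev g l.
Proof. by rewrite /fcev -big_split; apply: eq_bigr => p _; rewrite /= -mulrDr. Qed.

Lemma fcevZ r f l : fcev (r *: f) l = r * fcev f l.
Proof. by rewrite /fcev mulr_sumr; apply: eq_bigr => p _; rewrite mulrCA. Qed.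

Lemma fcevN f l : fcev (- f) l = - fcev f l.
Proof. by rewrite -scaleN1r fcevZ mulN1r. Qed.

Lemma fcev0 l : fcev 0 l = 0.
Proof. by rewrite /fcev big1 // => p _; rewrite mulr0. Qed.

Lemma fcev1 f x : fcev f [:: (1, x)] = f x.
Proof. by rewrite /fcev big_seq1 mul1r. Qed.

Variable K : pskernel R X.

Definition fcker a b : R := fcev (fun x => fcev (K x) b) a.

Lemma fcker_catl a b c : fcker (a ++ b) c = fcker a c + fcker b c.
Proof. exact: fcev_cat. Qed.

Lemma fcker_scalel r a b : fcker (fcscale r a) b = r * fcker a b.
Proof. exact: fcev_scale. Qed.

Lemma fckerC a b : fcker a b = fcker b a.
Proof.
rewrite /fcker /fcev; under eq_bigr do rewrite mulr_sumr.
rewrite exchange_big /=; apply: eq_bigr => q _; rewrite mulr_sumr.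
by apply: eq_bigr => p _; rewrite mulrCA pskernC.
Qed.

Lemma fcker_catr a b c : fcker c (a ++ b) = fcker c a + fcker c b.
Proof. by rewrite fckerC fcker_catl !(fckerC c). Qed.

Lemma fcker_scaler r a b : fcker b (fcscale r a) = r * fcker b a.
Proof. by rewrite fckerC fcker_scalel fckerC. Qed.

Definition fckerE := (fcker_catl, fcker_catr, fcker_scalel, fcker_scaler).

Lemma fcker_ge0 a : 0 <= fcker a a.
Proof.
suff -> : fcker a a = \sum_(p <- a) \sum_(q <- a) p.1 * q.1 * K p.2 q.2.
  exact: pskern_psd.
by apply: eq_bigr => p _; rewrite mulr_sumr; apply: eq_bigr => q _; rewrite mulrA.
Qed.

Lemma fcker_CS a b : fcker a b ^+ 2 <= fcker a a * fcker b b.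
Proof.
have quad s t : 0 <= s ^+ 2 * fcker a a + 2 * s * t * fcker a b + t ^+ 2 * fcker b b.
  have := fcker_ge0 (fcscale s a ++ fcscale t b); rewrite !fckerE (fckerC b a).
  by move=> h; apply: le_trans h _; rewrite le_eqVlt; apply/orP; left; apply/eqP; ring.
have := fcker_ge0 b; rewrite le_eqVlt => /orP [/eqP b0|b0].
  (* The form is only semidefinite. With A = [fcker a a] and B = [fcker a b], these values of s and
     t turn the quadratic form into -B^2 (A + 2), which forces B = 0. *)
  have := quad (fcker a b) (- (fcker a a + 1)); rewrite -b0 !mulr0 addr0.
  have := fcker_ge0 a; move: (fcker a a) (fcker a b) => A B A0 h.
  have : 0 <= - (B ^+ 2 * (A + 2)).
    by apply: le_trans h _; rewrite le_eqVlt; apply/orP; left; apply/eqP; ring.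
  rewrite oppr_ge0 pmulr_lle0 //; last by lra.
have := quad (fcker b b) (- fcker a b).
move: (fcker a a) (fcker a b) (fcker b b) b0 => A B C C0 h.
have : 0 <= C * (A * C - B ^+ 2).
  by apply: le_trans h _; rewrite le_eqVlt; apply/orP; left; apply/eqP; ring.
by rewrite pmulr_rge0 // subr_ge0.
Qed.

Lemma sqrD_le (x y : R) : (x + y) ^+ 2 <= 2 * x ^+ 2 + 2 * y ^+ 2.
Proof. by have := sqr_ge0 (x - y); nra. Qed.

(** The number e bounds the square of the dual norm of f minus the functional of b. *)
Definition fcapprox f b (e : R) :=
  forall l, (fcev f l - fcker b l) ^+ 2 <= e * fcker l l.

Lemma fcapprox_weak f b e e' : e <= e' -> fcapprox f b e -> fcapprox f b e'.
Proof. by move=> ee h l; apply: le_trans (h l) _; rewrite ler_wpM2r ?fcker_ge0. Qed.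

Lemma fcapproxD f b e f' b' e' : fcapprox f b e -> fcapprox f' b' e' ->
  fcapprox (f + f') (b ++ b') (2 * e + 2 * e').
Proof.
move=> h h' l; rewrite fcevD fcker_catl.
have := sqrD_le (fcev f l - fcker b l) (fcev f' l - fcker b' l).
have := h l; have := h' l.
move: (fcev f l) (fcev f' l) (fcker b l) (fcker b' l) (fcker l l) => p q r s t *.
have -> : p + q - (r + s) = p - r + (q - s) by ring.
nra.
Qed.

Lemma fcapproxZ r f b e : fcapprox f b e -> fcapprox (r *: f) (fcscale r b) (r ^+ 2 * e).
Proof.
move=> h l; rewrite fcevZ fcker_scalel -mulrBr exprMn -(mulrA _ e).
by rewrite ler_wpM2l ?sqr_ge0.
Qed.

Lemma fcapprox_ker b : fcapprox (fun x => fcker [:: (1, x)] b) b 0.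
Proof.
move=> l; rewrite mul0r.
suff -> : fcev (fun x => fcker [:: (1, x)] b) l = fcker b l by rewrite subrr expr0n.
by rewrite fckerC; apply: eq_bigr => p _; rewrite /fcker fcev1.
Qed.

(* The completion of the formal combinations, realized by functions on X: the
   limits of the b |-> fcker b in the norm of bounded functionals. *)
Definition rkhs_pred f := `[< forall e, 0 < e -> exists b, fcapprox f b e >].

Lemma rkhsP f : reflect (forall e, 0 < e -> exists b, fcapprox f b e) (rkhs_pred f).
Proof. exact: asboolP. Qed.

Lemma rkhs_closed : submod_closed rkhs_pred.
Proof.
split.
  apply/rkhsP => e e0; exists [::] => l; rewrite fcev0 /fcker /fcev big_nil subrr.
  by rewrite expr0n mulr_ge0 ?fcker_ge0 ?ltW.
move=> r f g /rkhsP hf /rkhsP hg; apply/rkhsP => e e0.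
(* [fcapproxD] doubles both errors and [fcapproxZ] multiplies by r^2; the added 1 keeps the
   denominator positive when r = 0. *)
have [|b hb] := hf (e / 4 / (r ^+ 2 + 1)).
  by rewrite divr_gt0 ?divr_gt0 // ltr_wpDl ?sqr_ge0.
have [|c hc] := hg (e / 4); first by rewrite divr_gt0.
exists (fcscale r b ++ c); apply: fcapprox_weak (fcapproxD (fcapproxZ r hb) hc).
have h : r ^+ 2 * (e / 4 / (r ^+ 2 + 1)) <= e / 4.
  rewrite mulrCA ler_piMr ?divr_ge0 ?ltW //.
  by rewrite ltr_pdivrMr ?mul1r ?ltrDl // ltr_wpDl ?sqr_ge0.
lra.
Qed.

HB.instance Definition _ := GRing.isSubmodClosed.Build R (X -> R) rkhs_pred rkhs_closed.

Record rkhs := RKHS { rkhs_fun :> X -> R; _ : rkhs_pred rkhs_fun }.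
HB.instance Definition _ := [isSub for rkhs_fun].
HB.instance Definition _ := [Choice of rkhs by <:].
HB.instance Definition _ := [SubChoice_isSubLmodule of rkhs by <:].

End FormalCombinations.

Section RKHS.
Variables (R : realType) (X : Type) (K : pskernel R X).
Implicit Types (f g : rkhs K) (a b c l : seq (R * X)) (u v : nat -> seq (R * X)).

Local Notation fcker := (fcker K).

Definition fccvg (f : X -> R) u := forall e, 0 < e ->
  exists n0, forall n, (n0 <= n)%N -> fcapprox K f (u n) e.

(** Test both approximations on d = a - b itself: the square of [fcker d d] is at most 4 e
    [fcker d d], and one factor cancels. *)
Lemma fccvg_diff (f : X -> R) a b e : 0 <= e -> fcapprox K f a e -> fcapprox K f b e ->
  fcker (a ++ fcscale (-1) b) (a ++ fcscale (-1) b) <= 4 * e.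
Proof.
set d := a ++ _ => e0 /(_ d) ha /(_ d) hb.
have dE : fcker d d = fcker a d - fcker b d.
  by rewrite {1}/d fcker_catl fcker_scalel mulN1r.
have := fcker_ge0 K d; rewrite le_eqVlt => /orP [/eqP <-|d0].
  by rewrite mulr_ge0.
rewrite -(ler_pM2r d0) {1 2}dE.
apply: le_trans (_ : _ <= 2 * (e * fcker d d) + 2 * (e * fcker d d)) _; last by lra.
move: ha hb; move: (fcev f d) (fcker a d) (fcker b d) (fcker d d) => p A B D ha hb.
by have := sqrD_le (A - p) (p - B); nra.
Qed.

Lemma fcev_bound (f : X -> R) b e l : fcapprox K f b e ->
  fcev f l ^+ 2 <= (2 * e + 2 * fcker b b) * fcker l l.
Proof.
move=> /(_ l) h; have := fcker_CS K b l; have := sqrD_le (fcev f l - fcker b l) (fcker b l).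
by rewrite subrK; move: h; nra.
Qed.

Lemma rkhs_bound f : exists2 C, 0 <= C & forall l, fcev f l ^+ 2 <= C * fcker l l.
Proof.
have /rkhsP/(_ 1 ltr01) [b hb] : rkhs_pred K f by case: (f).
exists (2 * 1 + 2 * fcker b b) => [|l]; last exact: fcev_bound.
by have := fcker_ge0 K b; lra.
Qed.

Lemma fccvg_bound (f : X -> R) u : fccvg f u ->
  exists2 C, 0 < C & exists n0, forall n, (n0 <= n)%N -> fcker (u n) (u n) <= C.
Proof.
move=> /(_ 1 ltr01) [n0 h]; exists (8 + 2 * fcker (u n0) (u n0)).
  by have := fcker_ge0 K (u n0); lra.
exists n0 => n hn; have := fccvg_diff ler01 (h n hn) (h n0 (leqnn _)).
set d := _ ++ _ => hd.
(* From |x - 2y|^2 >= 0 follows |x|^2 <= 2 |x - y|^2 + 2 |y|^2, whence the constant 8. *)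
have := fcker_ge0 K (u n ++ fcscale (-2) (u n0)).
by move: hd; rewrite /d !fckerE (fckerC K (u n0)); lra.
Qed.

Lemma rkhs_seq_exists f : exists u, fccvg f u.
Proof.
have /rkhsP hf : rkhs_pred K f by case: (f).
have /choice [u hu] : forall n : nat, exists b, fcapprox K f b (n.+1%:R^-1).
  by move=> n; apply: hf; rewrite invr_gt0.
exists u => e e0; exists (Num.truncn e^-1) => n hn.
apply: fcapprox_weak (hu n).
rewrite -[leRHS]invrK lef_pV2 ?posrE ?invr_gt0 //.
apply: le_trans (ltW (truncnS_gt _)) _; by rewrite ler_nat.
Qed.

Definition rkhs_seq f := projT1 (cid (rkhs_seq_exists f)).
Lemma rkhs_seqP f : fccvg f (rkhs_seq f).
Proof. exact: projT2 (cid _). Qed.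

Lemma fcev_cvg f g u : fccvg g u -> exists s : R, fcev f (u n) @[n --> \oo] --> s.
Proof.
move=> hu; apply: sq_cauchy_cvg => e e0.
have [C C0 hC] := rkhs_bound f.
have e1 : 0 < e / 4 / (C + 1) by rewrite divr_gt0 ?divr_gt0 // ltr_wpDl.
have [n0 hn0] := hu _ e1; exists n0 => m n hm hn.
have := fccvg_diff (ltW e1) (hn0 _ hm) (hn0 _ hn); have := hC (u m ++ fcscale (-1) (u n)).
rewrite fcev_cat fcev_scale mulN1r => h1 h2; apply: le_trans h1 _.
apply: le_trans (ler_wpM2l C0 h2) _.
rewrite (_ : C * _ = e * (C / (C + 1))); last by field; lra.
by rewrite ler_piMr ?ltW // ltr_pdivrMr ?mul1r ?ltrDl // ltr_wpDl.
Qed.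

(** Evaluating f along approximations of g makes linearity in f immediate. Independence of the
    approximation is [rkhs_ip_cvg]; symmetry comes from approximating both sides in
    [rkhs_ip_cvg2]. *)
Definition rkhs_ip f g : R := lim (fcev f (rkhs_seq g n) @[n --> \oo]).

Lemma rkhs_ip_cvg0 f g : fcev f (rkhs_seq g n) @[n --> \oo] --> rkhs_ip f g.
Proof.
have [s hs] := fcev_cvg f (rkhs_seqP g).
by rewrite /rkhs_ip (cvg_lim _ hs).
Qed.

Lemma cvg_ext (s t : nat -> R) (r : R) : (forall n, s n = t n) ->
  t @ \oo --> r -> s @ \oo --> r.
Proof. by move=> /funext ->. Qed.

Arguments rkhs_ip_cvg0 : clear implicits.

Lemma cvg_sq_trans (s t : nat -> R) (r : R) : s @ \oo --> r ->
  (forall e, 0 < e -> exists n0, forall n, (n0 <= n)%N -> (t n - s n) ^+ 2 <= e) ->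
  t @ \oo --> r.
Proof.
move=> hs h; apply: sq_cvg => e e0; have e1 : 0 < e / 4 by rewrite divr_gt0.
have [n1 h1] := cvg_sq hs e1; have [n2 h2] := h _ e1; exists (maxn n1 n2) => n.
rewrite geq_max => /andP [/h1 {}h1 /h2 {}h2].
have := sqrD_le (t n - s n) (s n - r); rewrite (_ : t n - _ + _ = t n - r); last by ring.
lra.
Qed.

Lemma rkhs_ip_cvg f g u : fccvg g u -> fcev f (u n) @[n --> \oo] --> rkhs_ip f g.
Proof.
move=> hu; apply: (cvg_sq_trans (rkhs_ip_cvg0 f g)) => e e0.
have [C C0 hC] := rkhs_bound f.
have e1 : 0 < e / 4 / (C + 1) by rewrite divr_gt0 ?divr_gt0 // ltr_wpDl.
have [n1 h1] := hu _ e1; have [n2 h2] := rkhs_seqP g e1.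
exists (maxn n1 n2) => n; rewrite geq_max => /andP [/h1 {}h1 /h2 {}h2].
have := fccvg_diff (ltW e1) h1 h2; have := hC (u n ++ fcscale (-1) (rkhs_seq g n)).
rewrite fcev_cat fcev_scale mulN1r => h3 h4; apply: le_trans h3 _.
apply: le_trans (ler_wpM2l C0 h4) _.
rewrite (_ : C * _ = e * (C / (C + 1))); last by field; lra.
by rewrite ler_piMr ?ltW // ltr_pdivrMr ?mul1r ?ltrDl // ltr_wpDl.
Qed.

Arguments rkhs_ip_cvg f {g u}.

Lemma rkhs_ip_cvg2 f g u v : fccvg f u -> fccvg g v ->
  fcker (u n) (v n) @[n --> \oo] --> rkhs_ip f g.
Proof.
move=> hu hv; apply: (cvg_sq_trans (rkhs_ip_cvg f hv)) => e e0.
have [C C0 [n1 hC]] := fccvg_bound hv.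
have [n2 h2] := hu _ (divr_gt0 e0 C0).
exists (maxn n1 n2) => n; rewrite geq_max => /andP [/hC h1 /h2 {}h2].
rewrite -sqrrN opprB; apply: le_trans (h2 (v n)) _.
apply: le_trans (ler_wpM2l (ltW (divr_gt0 e0 C0)) h1) _.
by rewrite divfK ?gt_eqF.
Qed.

Lemma rkhs_ipC f g : rkhs_ip f g = rkhs_ip g f.
Proof.
have h1 := rkhs_ip_cvg2 (rkhs_seqP f) (rkhs_seqP g).
have h2 := rkhs_ip_cvg2 (rkhs_seqP g) (rkhs_seqP f).
by apply: (cvg_uniq h1); apply: (cvg_ext _ h2) => n; rewrite fckerC.
Qed.

Lemma rkhs_ipD f f' g : rkhs_ip (f + f') g = rkhs_ip f g + rkhs_ip f' g.
Proof.
apply: (cvg_uniq (rkhs_ip_cvg0 _ g)).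
by apply: (cvg_ext _ (cvgD (rkhs_ip_cvg0 f g) (rkhs_ip_cvg0 f' g))) => n; exact: fcevD.
Qed.

Lemma rkhs_ipZ r f g : rkhs_ip (r *: f) g = r * rkhs_ip f g.
Proof.
apply: (cvg_uniq (rkhs_ip_cvg0 _ g)).
by apply: (cvg_ext _ (cvgM (cvg_cst r) (rkhs_ip_cvg0 f g))) => n; exact: fcevZ.
Qed.

Lemma rkhs_ip_ge0 f : 0 <= rkhs_ip f f.
Proof.
have h := rkhs_ip_cvg2 (rkhs_seqP f) (rkhs_seqP f).
by apply: (cvg_le2 (cvg_cst 0) h) => n; apply: fcker_ge0.
Qed.

Lemma rkhs_ip_ev f l : fcev f l ^+ 2 <= rkhs_ip f f * fcker l l.
Proof.
have h := rkhs_ip_cvg2 (rkhs_seqP f) (rkhs_seqP f).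
have h1 : fcker (rkhs_seq f n) l @[n --> \oo] --> fcev f l.
  apply: sq_cvg => e e0.
  have e1 : 0 < e / (fcker l l + 1) by rewrite divr_gt0 // ltr_wpDl ?fcker_ge0.
  have [n0 hn0] := rkhs_seqP f e1; exists n0 => n /hn0 /(_ l).
  rewrite -sqrrN opprB => h2; apply: le_trans h2 _.
  rewrite mulrAC -mulrA ler_piMr ?ltW // ltr_pdivrMr ?mul1r ?ltrDl //.
  by rewrite ltr_wpDl ?fcker_ge0.
rewrite expr2; apply: (cvg_le2 (cvgM h1 h1) (cvgM h (cvg_cst (fcker l l)))) => n.
exact: fcker_CS.
Qed.

Lemma rkhs_ip_eq0 f : rkhs_ip f f = 0 -> f = 0.
Proof.
move=> h; apply/val_inj/funext => x.
have := rkhs_ip_ev f [:: (1, x)]; rewrite h mul0r fcev1 => hx.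
by apply/eqP; rewrite -(sqrf_eq0 (f x)) eq_le hx sqr_ge0.
Qed.

(** Along approximations of f the bound becomes <f, f>^2 <= C <f, f>. With [rkhs_ip_ev] this
    identifies the norm of f with its dual norm. *)
Lemma rkhs_ip_le f C : 0 <= C -> (forall l, fcev f l ^+ 2 <= C * fcker l l) ->
  rkhs_ip f f <= C.
Proof.
move=> C0 hC; have h := rkhs_ip_cvg2 (rkhs_seqP f) (rkhs_seqP f).
have h1 := rkhs_ip_cvg0 f f.
have := cvg_le2 (cvgM h1 h1) (cvgM (cvg_cst C) h) => /=.
have /[swap]/[apply] : forall n, fcev f (rkhs_seq f n) * fcev f (rkhs_seq f n) <=
    C * fcker (rkhs_seq f n) (rkhs_seq f n) by move=> n; rewrite -expr2.
have := rkhs_ip_ge0 f; rewrite le_eqVlt => /orP [/eqP <- //|f0].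
by rewrite ler_pM2r.
Qed.

(** Values converge pointwise; the Cauchy estimate, uniform over formal combinations, survives in
    the limit, which is why the limit function is again approximable. *)
Lemma rkhs_complete (u : nat -> rkhs K) :
  (forall e, 0 < e -> exists n0, forall m n, (n0 <= m)%N -> (n0 <= n)%N ->
     rkhs_ip (u m - u n) (u m - u n) < e) ->
  exists f, forall e, 0 < e -> exists n0, forall n, (n0 <= n)%N ->
     rkhs_ip (u n - f) (u n - f) < e.
Proof.
move=> hu.
have hev e : 0 < e -> exists n0, forall m n, (n0 <= m)%N -> (n0 <= n)%N -> forall l,
    (fcev (u m) l - fcev (u n) l) ^+ 2 <= e * fcker l l.
  move=> e0; have [n0 hn0] := hu _ e0; exists n0 => m n hm hn l.
  have := rkhs_ip_ev (u m - u n) l; rewrite (fcevD (u m) (- (u n) : rkhs K)) fcevN => h.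
  by apply: le_trans h _; rewrite ler_wpM2r ?fcker_ge0 ?ltW // hn0.
have /choice [f hf] : forall x, exists s : R, (u n : X -> R) x @[n --> \oo] --> s.
  move=> x; apply: sq_cauchy_cvg => e e0.
  have K0 : 0 <= fcker [:: (1, x)] [:: (1, x)] by apply: fcker_ge0.
  have e1 : 0 < e / (fcker [:: (1, x)] [:: (1, x)] + 1) by rewrite divr_gt0 // ltr_wpDl.
  have [n0 hn0] := hev _ e1; exists n0 => m n hm hn.
  have := hn0 m n hm hn [:: (1, x)]; rewrite !fcev1 => h; apply: le_trans h _.
  rewrite mulrAC -mulrA ler_piMr ?ltW // ltr_pdivrMr ?mul1r ?ltrDl //.
  by rewrite ltr_wpDl.
have hfl l : fcev (u n) l @[n --> \oo] --> fcev f l.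
  rewrite /fcev; elim: l => [|p l IH].
    by rewrite big_nil; apply: (cvg_ext _ (cvg_cst 0)) => n; rewrite big_nil.
  rewrite big_cons; apply: (cvg_ext _ (cvgD (cvgM (cvg_cst p.1) (hf p.2)) IH)) => n.
  by rewrite big_cons.
have hlim e : 0 < e -> exists n0, forall n, (n0 <= n)%N -> forall l,
    (fcev (u n) l - fcev f l) ^+ 2 <= e * fcker l l.
  move=> e0; have [n0 hn0] := hev _ e0; exists n0 => n hn l.
  (* The shift by n0 makes the bound hold for every term, not only eventually. *)
  apply: (cvg_le_const (u := fun m => (fcev (u n) l - fcev (u (m + n0)%N) l) ^+ 2)).
    have hs : fcev (u (m + n0)%N) l @[m --> \oo] --> fcev f l.
      by have := hfl l; rewrite -(cvg_shiftn n0).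
    have hd : (fcev (u n) l - fcev (u (m + n0)%N) l) @[m --> \oo] -->
        fcev (u n) l - fcev f l by apply: (cvgB (cvg_cst _) hs).
    rewrite [X in _ --> X]expr2; apply: (cvg_ext _ (cvgM hd hd)) => m.
    exact: expr2.
  by move=> m; apply: hn0 => //; rewrite leq_addl.
have hF : rkhs_pred K f.
  apply/rkhsP => e e0; have e4 : 0 < e / 4 by rewrite divr_gt0.
  have [n0 /(_ _ (leqnn _)) h0] := hlim _ e4.
  have /rkhsP/(_ _ e4) [b hb] : rkhs_pred K (u n0) by case: (u n0).
  exists b => l; have := h0 l; have := hb l.
  have := sqrD_le (fcev f l - fcev (u n0) l) (fcev (u n0) l - fcker b l).
  rewrite -(sqrrN (fcev f l - fcev _ l)) opprB addrA subrK.
  move: (fcker l l) => k; lra.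
exists (RKHS hF) => e e0; have e2 : 0 < e / 2 by rewrite divr_gt0.
have [n0 hn0] := hlim _ e2; exists n0 => n hn.
apply: (@le_lt_trans _ _ (e / 2)); last by lra.
apply: rkhs_ip_le; first exact: ltW.
move=> l; have := hn0 n hn l.
by rewrite (fcevD (u n) (- (RKHS hF) : rkhs K)) fcevN.
Qed.

End RKHS.

(** * The C*-algebra of bounded operators on a Hilbert space *)

(* A complex Hilbert space, given by its underlying real Hilbert space and
   multiplication by i. *)
Record hilbert (R : realType) := Hilbert {
  hcar :> lmodType R;
  hip : hcar -> hcar -> R;
  hI : hcar -> hcar;
  hipC : forall u v, hip u v = hip v u;
  hipDl : forall u v w, hip (u + v) w = hip u w + hip v w;
  hipZl : forall c u v, hip (c *: u) v = c * hip u v;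
  hip_ge0 : forall u, 0 <= hip u u;
  hip_eq0 : forall u, hip u u = 0 -> u = 0;
  hI_linear : forall c u v, hI (c *: u + v) = c *: hI u + hI v;
  hII : forall u, hI (hI u) = - u;
  hip_I : forall u v, hip (hI u) (hI v) = hip u v;
  hip_complete : forall u : nat -> hcar,
    (forall e, 0 < e -> exists n0, forall m n, (n0 <= m)%N -> (n0 <= n)%N ->
      hip (u m - u n) (u m - u n) < e) ->
    exists x, forall e, 0 < e -> exists n0, forall n, (n0 <= n)%N ->
      hip (u n - x) (u n - x) < e;
  hcar_nontrivial : exists u : hcar, u != 0
}.

Section HilbertTheory.
Variables (R : realType) (H : hilbert R).
Implicit Types u v w : H.

Local Notation ip := (@hip R H).

Lemma hipDr u v w : ip u (v + w) = ip u v + ip u w.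
Proof. by rewrite hipC hipDl !(hipC u). Qed.
Lemma hipZr c u v : ip u (c *: v) = c * ip u v.
Proof. by rewrite hipC hipZl hipC. Qed.
Lemma hipNl u v : ip (- u) v = - ip u v.
Proof. by rewrite -scaleN1r hipZl mulN1r. Qed.
Lemma hipNr u v : ip u (- v) = - ip u v.
Proof. by rewrite hipC hipNl hipC. Qed.
Lemma hip0l v : ip 0 v = 0.
Proof. by rewrite -(scale0r 0) hipZl mul0r. Qed.
Lemma hipBl u v w : ip (u - v) w = ip u w - ip v w.
Proof. by rewrite hipDl hipNl. Qed.
Lemma hipBr u v w : ip w (u - v) = ip w u - ip w v.
Proof. by rewrite hipDr hipNr. Qed.

Lemma hip_inj u v : (forall w, ip w u = ip w v) -> u = v.
Proof.
move=> h; apply/eqP; rewrite -subr_eq0; apply/eqP/hip_eq0.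
by rewrite hipBr h subrr.
Qed.

Lemma hI_D u v : hI (u + v) = hI u + hI v.
Proof. by have := hI_linear 1 u v; rewrite !scale1r. Qed.
Lemma hI0 : hI 0 = 0 :> H.
Proof. by apply: (addIr (hI 0)); rewrite -hI_D addr0 add0r. Qed.
Lemma hIZ c u : hI (c *: u) = c *: hI u.
Proof. by have := hI_linear c u 0; rewrite hI0 !addr0. Qed.
Lemma hIN u : hI (- u) = - hI u.
Proof. by rewrite -scaleN1r hIZ scaleN1r. Qed.
Lemma hIB u v : hI (u - v) = hI u - hI v.
Proof. by rewrite hI_D hIN. Qed.
Lemma hipIl u v : ip (hI u) v = - ip u (hI v).
Proof. by rewrite -hip_I hII hipNl. Qed.

Lemma hip_CS u v : ip u v ^+ 2 <= ip u u * ip v v.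
Proof.
have quad s t : 0 <= s ^+ 2 * ip u u + 2 * s * t * ip u v + t ^+ 2 * ip v v.
  have := hip_ge0 (s *: u + t *: v); rewrite !(hipDl, hipDr, hipZl, hipZr) (hipC v u).
  by move=> h; apply: le_trans h _; rewrite le_eqVlt; apply/orP; left; apply/eqP; ring.
have := hip_ge0 v; rewrite le_eqVlt => /orP [/eqP v0|v0].
  by rewrite (hip_eq0 (esym v0)) hipC !hip0l mulr0 expr0n.
have := quad (ip v v) (- ip u v).
move: (ip u u) (ip u v) (ip v v) v0 => A B C C0 h.
have : 0 <= C * (A * C - B ^+ 2).
  by apply: le_trans h _; rewrite le_eqVlt; apply/orP; left; apply/eqP; ring.
by rewrite pmulr_rge0 // subr_ge0.
Qed.

Definition hnorm u : R := Num.sqrt (ip u u).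

Lemma hnorm_ge0 u : 0 <= hnorm u. Proof. exact: sqrtr_ge0. Qed.
Lemma sqr_hnorm u : hnorm u ^+ 2 = ip u u. Proof. by rewrite sqr_sqrtr ?hip_ge0. Qed.
Lemma hnorm0 : hnorm 0 = 0. Proof. by rewrite /hnorm hip0l sqrtr0. Qed.
Lemma hnorm_eq0 u : hnorm u = 0 -> u = 0.
Proof. by move=> h; apply: hip_eq0; rewrite -sqr_hnorm h expr0n. Qed.
Lemma hnormN u : hnorm (- u) = hnorm u.
Proof. by rewrite /hnorm hipNl hipNr opprK. Qed.
Lemma hnormB u v : hnorm (u - v) = hnorm (v - u).
Proof. by rewrite -hnormN opprB. Qed.
Lemma hnormI u : hnorm (hI u) = hnorm u.
Proof. by rewrite /hnorm hip_I. Qed.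

Lemma hip_le u v : ip u v <= hnorm u * hnorm v.
Proof.
apply: le_trans (ler_norm _) _; rewrite -sqrtr_sqr -sqrtrM ?hip_ge0 //.
by rewrite ler_wsqrtr // hip_CS.
Qed.

Lemma hnormD u v : hnorm (u + v) <= hnorm u + hnorm v.
Proof.
rewrite -(@ler_pXn2r _ 2) ?nnegrE ?addr_ge0 ?hnorm_ge0 //.
rewrite sqr_hnorm !(hipDl, hipDr) (hipC v u) sqrrD !sqr_hnorm.
by have := hip_le u v; lra.
Qed.

Lemma hnorm_tri u v w : hnorm (u - w) <= hnorm (u - v) + hnorm (v - w).
Proof. by have := hnormD (u - v) (v - w); rewrite addrA subrK. Qed.

Lemma hnorm_complete (u : nat -> H) :
  (forall e, 0 < e -> exists n0, forall m n, (n0 <= m)%N -> (n0 <= n)%N ->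
    hnorm (u m - u n) < e) ->
  exists x, forall e, 0 < e -> exists n0, forall n, (n0 <= n)%N -> hnorm (u n - x) < e.
Proof.
have sq e v : 0 < e -> (hnorm v < e) = (ip v v < e ^+ 2).
  by move=> e0; rewrite -sqr_hnorm ltr_pXn2r ?nnegrE ?hnorm_ge0 ?ltW.
move=> hu; have [e e0|x hx] := @hip_complete _ H u.
  have e1 : 0 < Num.sqrt e by rewrite sqrtr_gt0.
  have [n0 h] := hu _ e1; exists n0 => m n hm hn; have := h m n hm hn.
  by rewrite sq // sqr_sqrtr ?ltW.
exists x => e e0; have [n0 h] := hx _ (exprn_gt0 2 e0).
by exists n0 => n /h; rewrite sq.
Qed.

(** Linearity is not listed because it follows from the adjoint ([bopD], [bopZ]). Demanding an
    adjoint as part of the definition takes the place of the Riesz theorem. *)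
Definition bop_pred (T : H -> H) :=
  `[< [/\ exists2 C, 0 <= C & forall u, hnorm (T u) <= C * hnorm u,
   forall u, T (hI u) = hI (T u) & exists S : H -> H, forall u v, ip (T u) v = ip u (S v)] >].

Lemma bop_zmod_closed : zmod_closed bop_pred.
Proof.
split.
  apply/asboolP; split.
  - by exists 0 => // u; rewrite hnorm0 mul0r.
  - by move=> u; rewrite hI0.
  - by exists (fun=> 0) => u v; rewrite hip0l hipC hip0l.
move=> T1 T2 /asboolP [[C1 C10 b1] i1 [S1 s1]] /asboolP [[C2 C20 b2] i2 [S2 s2]].
apply/asboolP; split.
- exists (C1 + C2) => [|u]; first exact: addr_ge0.
  rewrite mulrDl; apply: le_trans (hnormD _ _) _.
  by rewrite lerD // hnormN.
- by move=> u; rewrite -[LHS]/(T1 (hI u) - T2 (hI u)) i1 i2 -hIB.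
- exists (fun v => S1 v - S2 v) => u v.
  by rewrite -[X in ip X v]/(T1 u - T2 u) hipBl hipBr s1 s2.
Qed.

HB.instance Definition _ := GRing.isZmodClosed.Build (H -> H) bop_pred bop_zmod_closed.

Record bop := Bop { bop_fun :> H -> H; _ : bop_pred bop_fun }.
HB.instance Definition _ := [isSub for bop_fun].
HB.instance Definition _ := [Choice of bop by <:].
HB.instance Definition _ := [SubChoice_isSubZmodule of bop by <:].
Implicit Types S T : bop.

Lemma bopP T1 T2 : (forall u, T1 u = T2 u) -> T1 = T2.
Proof. by move=> h; apply/val_inj/funext. Qed.

Lemma bopI T u : T (hI u) = hI (T u).
Proof. by case: T => T /= /asboolP [_ h _]. Qed.
Lemma bop_bounded T : exists2 C, 0 <= C & forall u, hnorm (T u) <= C * hnorm u.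
Proof. by case: T => T /= /asboolP [h _ _]. Qed.
Lemma bop_adj_ex T : exists S : H -> H, forall u v, ip (T u) v = ip u (S v).
Proof. by case: T => T /= /asboolP [_ _ h]. Qed.

Lemma bop_addE S T u : (S + T) u = S u + T u. Proof. by []. Qed.
Lemma bop_subE S T u : (S - T) u = S u - T u. Proof. by []. Qed.
Lemma bop_0E u : (0 : bop) u = 0. Proof. by []. Qed.

Lemma bopD T u v : T (u + v) = T u + T v.
Proof.
have [S s] := bop_adj_ex T.
by apply: hip_inj => w; rewrite !(hipC w) hipDl !s hipDl.
Qed.
Lemma bopZ T c u : T (c *: u) = c *: T u.
Proof.
have [S s] := bop_adj_ex T.
by apply: hip_inj => w; rewrite !(hipC w) hipZl !s hipZl.
Qed.
Lemma bop_mul_subproof S T : bop_pred (fun u => S (T u)).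
Proof.
apply/asboolP; split.
- have [C C0 c] := bop_bounded S; have [D D0 d] := bop_bounded T.
  exists (C * D) => [|u]; first exact: mulr_ge0.
  by apply: le_trans (c _) _; rewrite -mulrA ler_wpM2l.
- by move=> u; rewrite !bopI.
- have [S' s] := bop_adj_ex S; have [T' t] := bop_adj_ex T.
  by exists (fun v => T' (S' v)) => u v; rewrite s t.
Qed.
Definition bop_mul S T := Bop (bop_mul_subproof S T).

Lemma bop_one_subproof : bop_pred id.
Proof.
apply/asboolP; split => //; first by exists 1 => // u; rewrite mul1r.
by exists id.
Qed.
Definition bop_one := Bop bop_one_subproof.

Fact bop_mulA : associative bop_mul. Proof. by move=> *; apply: bopP. Qed.
Fact bop_mul1r : left_id bop_one bop_mul. Proof. by move=> *; apply: bopP. Qed.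
Fact bop_mulr1 : right_id bop_one bop_mul. Proof. by move=> *; apply: bopP. Qed.
Fact bop_mulDl : left_distributive bop_mul +%R. Proof. by move=> *; apply: bopP. Qed.
Fact bop_mulDr : right_distributive bop_mul +%R.
Proof. by move=> S T1 T2; apply: bopP => u; exact: bopD. Qed.
Fact bop_one_neq0 : bop_one != 0.
Proof.
have [u u0] := hcar_nontrivial H; apply/eqP => /(congr1 (fun T : bop => T u)) /= h.
by move: u0; rewrite h eqxx.
Qed.
HB.instance Definition _ := GRing.Zmodule_isNzRing.Build bop
  bop_mulA bop_mul1r bop_mulr1 bop_mulDl bop_mulDr bop_one_neq0.

Lemma bop_mulE S T u : (S * T) u = S (T u). Proof. by []. Qed.
Lemma hnormZ c u : hnorm (c *: u) = `|c| * hnorm u.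
Proof. by rewrite /hnorm hipZl hipZr mulrA -expr2 sqrtrM ?sqr_ge0 // sqrtr_sqr. Qed.

Lemma bop_scale_subproof (c : R[i]) T :
  bop_pred (fun u => complex.Re c *: T u + complex.Im c *: hI (T u)).
Proof.
apply/asboolP; split.
- have [C C0 b] := bop_bounded T.
  exists ((`|complex.Re c| + `|complex.Im c|) * C) => [|u].
    by rewrite mulr_ge0 // addr_ge0.
  apply: le_trans (hnormD _ _) _; rewrite !hnormZ hnormI -mulrDl -mulrA.
  by rewrite ler_wpM2l // addr_ge0.
- by move=> u; rewrite !bopI hI_D !hIZ.
- have [S s] := bop_adj_ex T.
  exists (fun v => complex.Re c *: S v - complex.Im c *: S (hI v)) => u v.
  by rewrite hipDl hipBr !hipZl !hipZr hipIl !s mulrN.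
Qed.
Definition bop_scale c T := Bop (bop_scale_subproof c T).

Fact bop_scaleA a b T : bop_scale a (bop_scale b T) = bop_scale (a * b) T.
Proof.
apply: bopP => u /=; case: a b => a1 a2 [b1 b2] /=.
rewrite hI_D !hIZ hII !scalerDr !scalerDl !scalerA !scalerN scaleNr.
by rewrite -!addrA; congr (_ + _); rewrite addrA addrC.
Qed.
Fact bop_scale1 : left_id 1 bop_scale.
Proof. by move=> T; apply: bopP => u /=; rewrite scale1r scale0r addr0. Qed.
Fact bop_scaleDr : right_distributive bop_scale +%R.
Proof.
move=> c S T; apply: bopP => u.
rewrite -[LHS]/(complex.Re c *: (S u + T u) + complex.Im c *: hI (S u + T u)).
by rewrite hI_D !scalerDr addrACA.
Qed.
Fact bop_scaleDl T : {morph bop_scale^~ T : a b / a + b}.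
Proof.
by move=> [a1 a2] [b1 b2]; apply: bopP => u; rewrite bop_addE /= !scalerDl addrACA.
Qed.
HB.instance Definition _ := GRing.Zmodule_isLmodule.Build R[i] bop
  bop_scaleA bop_scale1 bop_scaleDr bop_scaleDl.

Lemma bop_scaleE (c : R[i]) T u :
  (c *: T) u = complex.Re c *: T u + complex.Im c *: hI (T u).
Proof. by []. Qed.

Fact bop_scaleAl (c : R[i]) S T : c *: (S * T) = (c *: S) * T.
Proof. by apply: bopP. Qed.
HB.instance Definition _ := GRing.Lmodule_isLalgebra.Build R[i] bop bop_scaleAl.
Fact bop_scaleAr (c : R[i]) S T : c *: (S * T) = S * (c *: T).
Proof. by apply: bopP => u; rewrite !bop_mulE !bop_scaleE bopD !bopZ bopI. Qed.
HB.instance Definition _ := GRing.Lalgebra_isAlgebra.Build R[i] bop bop_scaleAr.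

Lemma bop_star_subproof T : bop_pred (projT1 (cid (bop_adj_ex T))).
Proof.
case: (cid _) => S /= s; have [C C0 c] := bop_bounded T; apply/asboolP; split.
- exists C => // v; have [->|v0] := eqVneq (hnorm (S v)) 0.
    by rewrite mulr_ge0 ?hnorm_ge0.
  have v1 : 0 < hnorm (S v) by rewrite lt_def v0 hnorm_ge0.
  rewrite -(ler_pM2l v1) -expr2 sqr_hnorm -s; apply: le_trans (hip_le _ _) _.
  by rewrite mulrA (mulrC _ C) ler_wpM2r ?hnorm_ge0.
- move=> u; apply: hip_inj => w.
  rewrite -s -[LHS]opprK -hipIl -bopI s hipIl.
  by rewrite opprK.
- by exists T => u v; rewrite hipC -s hipC.
Qed.
Definition bop_star T := Bop (bop_star_subproof T).

Lemma bop_starE T u v : ip (T u) v = ip u (bop_star T v).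
Proof. by rewrite /=; case: (cid _). Qed.
Lemma bop_star_uniq T S : (forall u v, ip (T u) v = ip u (S v)) -> bop_star T = S.
Proof. by move=> h; apply: bopP => v; apply: hip_inj => u; rewrite -bop_starE h. Qed.

Fact bop_starK T : bop_star (bop_star T) = T.
Proof. by apply: bop_star_uniq => u v; rewrite hipC -bop_starE hipC. Qed.
Fact bop_starD S T : bop_star (S + T) = bop_star S + bop_star T.
Proof. by apply: bop_star_uniq => u v; rewrite !bop_addE hipDl hipDr !bop_starE. Qed.
Fact bop_starZ (c : R[i]) T : bop_star (c *: T) = (c^*)%C *: bop_star T.
Proof.
apply: bop_star_uniq => u v; rewrite !bop_scaleE hipDl hipDr !hipZl !hipZr hipIl !bop_starE.
by rewrite bopI; case: c => a b /=; rewrite mulrN mulNr.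
Qed.
Fact bop_starM S T : bop_star (S * T) = bop_star T * bop_star S.
Proof. by apply: bop_star_uniq => u v; rewrite !bop_mulE !bop_starE. Qed.

Definition bop_norm T : R :=
  inf [set C | 0 <= C /\ forall u, hnorm (T u) <= C * hnorm u].

Lemma bop_normP T u : hnorm (T u) <= bop_norm T * hnorm u.
Proof.
have [->|u0] := eqVneq u 0.
  by rewrite hnorm0 mulr0 -(scale0r 0) bopZ scale0r hnorm0.
have u1 : 0 < hnorm u.
  rewrite lt_def hnorm_ge0 andbT; apply: contra u0 => /eqP h; exact/eqP/hnorm_eq0.
rewrite -ler_pdivrMr //; apply: lb_le_inf.
  by have [C C0 c] := bop_bounded T; exists C.
by move=> C [_ /(_ u) c]; rewrite ler_pdivrMr.
Qed.

Lemma bop_norm_le T C : 0 <= C -> (forall u, hnorm (T u) <= C * hnorm u) -> bop_norm T <= C.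
Proof. by move=> C0 c; apply: ge_inf => //; exists 0 => D []. Qed.

Fact bop_norm_ge0 T : 0 <= bop_norm T.
Proof.
apply: lb_le_inf; first by have [C C0 c] := bop_bounded T; exists C.
by move=> C [].
Qed.

Fact bop_norm_eq0 T : bop_norm T = 0 -> T = 0.
Proof.
move=> h; apply: bopP => u; apply: hnorm_eq0; apply/eqP.
by rewrite eq_le hnorm_ge0 andbT; have := bop_normP T u; rewrite h mul0r.
Qed.

Fact bop_normD S T : bop_norm (S + T) <= bop_norm S + bop_norm T.
Proof.
apply: bop_norm_le => [|u]; first by rewrite addr_ge0 ?bop_norm_ge0.
by rewrite mulrDl; apply: le_trans (hnormD _ _) _; rewrite lerD ?bop_normP.
Qed.

Fact bop_normM S T : bop_norm (S * T) <= bop_norm S * bop_norm T.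
Proof.
apply: bop_norm_le => [|u]; first by rewrite mulr_ge0 ?bop_norm_ge0.
apply: le_trans (bop_normP S _) _; rewrite -mulrA ler_wpM2l ?bop_norm_ge0 //.
exact: bop_normP.
Qed.

Lemma hnorm_scalec (c : R[i]) u :
  hnorm (complex.Re c *: u + complex.Im c *: hI u) = Normc.normc c * hnorm u.
Proof.
case: c => a b /=; rewrite /hnorm -sqrtrM ?addr_ge0 ?sqr_ge0 //; congr Num.sqrt.
rewrite !(hipDl, hipDr, hipZl, hipZr) hip_I hipIl.
(* Multiplication by i is skew-adjoint, so u and i u are orthogonal for the real inner product. *)
rewrite (_ : ip u (hI u) = 0); first by ring.
have := hipIl u u; rewrite hipC => h; lra.
Qed.

Lemma bop_normZ_le (c : R[i]) T : bop_norm (c *: T) <= Normc.normc c * bop_norm T.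
Proof.
have c0 : 0 <= Normc.normc c by case: c => a b; exact: sqrtr_ge0.
apply: bop_norm_le => [|u]; first by rewrite mulr_ge0 ?bop_norm_ge0.
by rewrite bop_scaleE hnorm_scalec -mulrA ler_wpM2l ?bop_normP.
Qed.

Fact bop_normZ (c : R[i]) T : bop_norm (c *: T) = Normc.normc c * bop_norm T.
Proof.
have [->|c0] := eqVneq c 0.
  rewrite scale0r Normc.normc0 mul0r; apply/eqP; rewrite eq_le bop_norm_ge0 andbT.
  by apply: bop_norm_le => // u; rewrite bop_0E hnorm0 mul0r.
apply/eqP; rewrite eq_le bop_normZ_le /=.
have nc0 : 0 < Normc.normc c.
  rewrite lt_def; apply/andP; split; last by case: (c) => a b; exact: sqrtr_ge0.
  by apply: contra c0 => /eqP/Normc.eq0_normc ->.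
rewrite -{1}[T]scale1r -(mulVf c0) -scalerA.
apply: le_trans (ler_wpM2l (ltW nc0) (bop_normZ_le _ _)) _.
by rewrite mulrA -Normc.normcM mulfV // Normc.normc1 mul1r.
Qed.

Lemma bop_norm_star_le T : bop_norm (bop_star T) <= bop_norm T.
Proof.
apply: bop_norm_le => [|v]; first exact: bop_norm_ge0.
have [->|v0] := eqVneq (hnorm (bop_star T v)) 0.
  by rewrite mulr_ge0 ?hnorm_ge0 ?bop_norm_ge0.
have v1 : 0 < hnorm (bop_star T v) by rewrite lt_def v0 hnorm_ge0.
rewrite -(ler_pM2l v1) -expr2 sqr_hnorm -bop_starE; apply: le_trans (hip_le _ _) _.
by rewrite mulrA (mulrC _ (bop_norm T)) ler_wpM2r ?hnorm_ge0 ?bop_normP.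
Qed.

Fact bop_norm_starM T : bop_norm (bop_star T * T) = bop_norm T ^+ 2.
Proof.
apply/eqP; rewrite eq_le; apply/andP; split.
  by apply: le_trans (bop_normM _ _) _; rewrite expr2 ler_wpM2r ?bop_norm_ge0 ?bop_norm_star_le.
set n := bop_norm (_ * _); have n0 : 0 <= n by exact: bop_norm_ge0.
suff h : bop_norm T <= Num.sqrt n.
  by rewrite -(sqr_sqrtr n0) ler_pXn2r ?nnegrE ?bop_norm_ge0 ?sqrtr_ge0.
apply: bop_norm_le => [|u]; first exact: sqrtr_ge0.
rewrite -(@ler_pXn2r _ 2) ?nnegrE ?mulr_ge0 ?hnorm_ge0 ?sqrtr_ge0 //.
rewrite sqr_hnorm exprMn (sqr_sqrtr n0) bop_starE; apply: le_trans (hip_le _ _) _.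
rewrite expr2 mulrA mulrC ler_wpM2r ?hnorm_ge0 //.
exact: (bop_normP (bop_star T * T)).
Qed.

(** The limit is taken pointwise. The adjoints form a Cauchy sequence as well, and their pointwise
    limit is the adjoint required by [bop_pred]. *)
Fact bop_complete (u : nat -> bop) :
  (forall e : R, 0 < e -> exists n0 : nat, forall m n : nat,
     (n0 <= m)%N -> (n0 <= n)%N -> bop_norm (u m - u n) < e) ->
  exists x : bop, forall e : R, 0 < e -> exists n0 : nat, forall n : nat,
    (n0 <= n)%N -> bop_norm (u n - x) < e.
Proof.
move=> hu.
have hlim (t : nat -> bop) v : (forall e : R, 0 < e -> exists n0 : nat, forall m n : nat,
     (n0 <= m)%N -> (n0 <= n)%N -> bop_norm (t m - t n) < e) ->
     exists x, forall e, 0 < e -> exists n0, forall n, (n0 <= n)%N -> hnorm (t n v - x) < e.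
  move=> ht; apply: hnorm_complete => e e0.
  have e1 : 0 < e / (hnorm v + 1) by rewrite divr_gt0 // ltr_wpDl ?hnorm_ge0.
  have [n0 h] := ht _ e1; exists n0 => m n hm hn.
  have := bop_normP (t m - t n) v; rewrite bop_subE => h1; apply: le_lt_trans h1 _.
  apply: (@le_lt_trans _ _ (e / (hnorm v + 1) * hnorm v)).
    by rewrite ler_wpM2r ?hnorm_ge0 // ltW // h.
  rewrite mulrAC -mulrA gtr_pMr // ltr_pdivrMr ?mul1r ?ltrDl //.
  by rewrite ltr_wpDl ?hnorm_ge0.
have /choice [T hT] := fun v => hlim u v hu.
have hus e : 0 < e -> exists n0 : nat, forall m n : nat,
     (n0 <= m)%N -> (n0 <= n)%N -> bop_norm (bop_star (u m) - bop_star (u n)) < e.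
  move=> e0; have [n0 h] := hu e e0; exists n0 => m n hm hn.
  have -> : bop_star (u m) - bop_star (u n) = bop_star (u m - u n).
    apply/esym/bop_star_uniq => v w.
    by rewrite !bop_subE hipBl hipBr !bop_starE.
  exact: le_lt_trans (bop_norm_star_le _) (h m n hm hn).
have /choice [S hS] := fun v => hlim (fun n => bop_star (u n)) v hus.
have hdist e : 0 < e -> exists n0, forall n v, (n0 <= n)%N ->
    hnorm (u n v - T v) <= e * hnorm v.
  move=> e0; have [n0 h] := hu e e0; exists n0 => n v hn.
  (* The rank n1 depends on v; the arbitrary slack d absorbs it and keeps n0 uniform in v. *)
  apply/ler_addgt0Pr => d d0; have [n1 h1] := hT v d d0.
  apply: le_trans (hnorm_tri _ (u (maxn n0 n1) v) _) _.
  apply: lerD; last by rewrite ltW // h1 // leq_maxr.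
  apply: le_trans (bop_normP (u n - u (maxn n0 n1)) v) _.
  by rewrite ler_wpM2r ?hnorm_ge0 // ltW // h // leq_maxl.
have predT : bop_pred T.
  apply/asboolP; split.
  - have [n0 h] := hdist 1 ltr01; exists (1 + bop_norm (u n0)) => [|v].
      by rewrite addr_ge0 ?bop_norm_ge0.
    have := hnormD (T v - u n0 v) (u n0 v); rewrite subrK => h1.
    apply: le_trans h1 _; rewrite mulrDl lerD ?bop_normP //.
    by rewrite hnormB h.
  - move=> v; apply/eqP; rewrite -subr_eq0; apply/eqP/hnorm_eq0/eqP.
    rewrite eq_le hnorm_ge0 andbT; apply/ler_addgt0Pr => e e0; rewrite add0r.
    have e2 : 0 < e / 2 by rewrite divr_gt0.
    have [n1 h1] := hT v _ e2; have [n2 h2] := hT (hI v) _ e2.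
    have [g1 g2] := (h1 _ (leq_maxl n1 n2), h2 _ (leq_maxr n1 n2)).
    apply: le_trans (hnorm_tri _ (u (maxn n1 n2) (hI v)) _) _.
    rewrite bopI -hIB hnormI (hnormB (T _)) -bopI.
    by move: g1 g2; lra.
  - exists S => v w; apply/eqP; rewrite -subr_eq0 -normr_eq0 eq_le normr_ge0 andbT.
    apply/ler_addgt0Pr => e e0; rewrite add0r.
    pose C := hnorm v + hnorm w + 1.
    have C0 : 0 < C by have := hnorm_ge0 v; have := hnorm_ge0 w; rewrite /C; lra.
    have [n1 h1] := hT v _ (divr_gt0 e0 C0); have [n2 h2] := hS w _ (divr_gt0 e0 C0).
    have [] := (h1 _ (leq_maxl n1 n2), h2 _ (leq_maxr n1 n2)); set n := maxn n1 n2 => g1 g2.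
    have -> : ip (T v) w - ip v (S w) = ip (T v - u n v) w + ip v (bop_star (u n) w - S w).
      by rewrite hipBl hipBr bop_starE; ring.
    have hip_abs (a b : H) : `|ip a b| <= hnorm a * hnorm b.
      by rewrite ler_norml hip_le andbT -lerNl -hipNl -(hnormN a) hip_le.
    apply: le_trans (ler_normD _ _) _.
    apply: le_trans (lerD (hip_abs _ _) (hip_abs _ _)) _.
    rewrite (hnormB (T v)).
    apply: (@le_trans _ _ (e / C * hnorm w + hnorm v * (e / C))).
      apply: lerD; first exact: (ler_wpM2r (hnorm_ge0 _) (ltW g1)).
      exact: (ler_wpM2l (hnorm_ge0 _) (ltW g2)).
    rewrite mulrC -mulrDl -(mulrC (e / C)) mulrAC -mulrA ler_piMr ?ltW //.
    by rewrite ltr_pdivrMr // mul1r /C; lra.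
exists (Bop predT) => e e0; have e2 : 0 < e / 2 by rewrite divr_gt0.
have [n0 h] := hdist _ e2; exists n0 => n hn.
apply: (@le_lt_trans _ _ (e / 2)); last by lra.
apply: bop_norm_le; first exact: ltW.
by move=> v; rewrite bop_subE h.
Qed.

HB.instance Definition _ := Algebra_isCStarAlgebra.Build R bop bop_starK bop_starD
  bop_starZ bop_starM bop_norm_ge0 bop_norm_eq0 bop_normD bop_normZ bop_normM
  bop_norm_starM bop_complete.

End HilbertTheory.

(** * The regular representation *)

Section Complexification.
Variables (R : realType) (X : Type) (K : pskernel R X).
Hypothesis K_neq0 : exists x, K x x != 0.

Local Notation H2 := (rkhs K * rkhs K)%type.

(** The pair (f, g) stands for f + i g, and this is the real part of the hermitian product. *)
Definition rkhs2_ip (u v : H2) := rkhs_ip u.1 v.1 + rkhs_ip u.2 v.2.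
Definition rkhs2_I (u : H2) : H2 := (- u.2, u.1).

Lemma rkhs_ipNl (f g : rkhs K) : rkhs_ip (- f) g = - rkhs_ip f g.
Proof. by rewrite -scaleN1r rkhs_ipZ mulN1r. Qed.

Fact rkhs2_ipC u v : rkhs2_ip u v = rkhs2_ip v u.
Proof. by rewrite /rkhs2_ip !(rkhs_ipC v.1, rkhs_ipC v.2). Qed.
Fact rkhs2_ipDl u v w : rkhs2_ip (u + v) w = rkhs2_ip u w + rkhs2_ip v w.
Proof. by rewrite /rkhs2_ip /= !rkhs_ipD addrACA. Qed.
Fact rkhs2_ipZl c u v : rkhs2_ip (c *: u) v = c * rkhs2_ip u v.
Proof. by rewrite /rkhs2_ip /= !rkhs_ipZ mulrDr. Qed.
Fact rkhs2_ip_ge0 u : 0 <= rkhs2_ip u u.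
Proof. by rewrite addr_ge0 ?rkhs_ip_ge0. Qed.
Fact rkhs2_ip_eq0 u : rkhs2_ip u u = 0 -> u = 0.
Proof.
move=> /eqP; rewrite paddr_eq0 ?rkhs_ip_ge0 // => /andP [/eqP h1 /eqP h2].
by rewrite (surjective_pairing u) (rkhs_ip_eq0 h1) (rkhs_ip_eq0 h2).
Qed.
Fact rkhs2_I_linear c u v : rkhs2_I (c *: u + v) = c *: rkhs2_I u + rkhs2_I v.
Proof. by congr pair; rewrite /= opprD scalerN. Qed.
Fact rkhs2_II u : rkhs2_I (rkhs2_I u) = - u.
Proof. by []. Qed.
Fact rkhs2_ip_I u v : rkhs2_ip (rkhs2_I u) (rkhs2_I v) = rkhs2_ip u v.
Proof.
rewrite /rkhs2_ip /rkhs2_I /= rkhs_ipNl (rkhs_ipC u.2) rkhs_ipNl opprK addrC.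
by rewrite (rkhs_ipC v.2).
Qed.
Fact rkhs2_complete (u : nat -> H2) :
  (forall e, 0 < e -> exists n0, forall m n, (n0 <= m)%N -> (n0 <= n)%N ->
    rkhs2_ip (u m - u n) (u m - u n) < e) ->
  exists x, forall e, 0 < e -> exists n0, forall n, (n0 <= n)%N ->
    rkhs2_ip (u n - x) (u n - x) < e.
Proof.
move=> hu.
have [e e0|f hf] := @rkhs_complete R X K (fun n => (u n).1).
  have [n0 h] := hu e e0; exists n0 => m n hm hn.
  by apply: le_lt_trans (h m n hm hn); rewrite lerDl rkhs_ip_ge0.
have [e e0|g hg] := @rkhs_complete R X K (fun n => (u n).2).
  have [n0 h] := hu e e0; exists n0 => m n hm hn.
  by apply: le_lt_trans (h m n hm hn); rewrite lerDr rkhs_ip_ge0.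
exists (f, g) => e e0; have e2 : 0 < e / 2 by rewrite divr_gt0.
have [n1 h1] := hf _ e2; have [n2 h2] := hg _ e2.
exists (maxn n1 n2) => n; rewrite geq_max => /andP [/h1 {}h1 /h2 {}h2].
by rewrite /rkhs2_ip /=; lra.
Qed.

Lemma rkhs_ker_subproof x : rkhs_pred K (K x).
Proof.
apply/rkhsP => e e0; exists [:: (1, x)].
have h := fcapprox_ker K [:: (1, x)].
have -> : (K x : X -> R) = fun y => fcker K [:: (1, y)] [:: (1, x)].
  by apply/funext => y; rewrite /fcker !fcev1 pskernC.
by apply: fcapprox_weak h; exact: ltW.
Qed.
Definition rkhs_ker x := RKHS (rkhs_ker_subproof x).

Fact rkhs2_nontrivial : exists u : H2, u != 0.
Proof.
have [x Kx] := K_neq0; exists (rkhs_ker x, 0).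
apply/eqP => /(congr1 (fun u : H2 => u.1 x)) /= h.
by move: Kx; rewrite h eqxx.
Qed.

Definition rkhs_complexification : hilbert R :=
  @Hilbert R H2 rkhs2_ip rkhs2_I rkhs2_ipC rkhs2_ipDl rkhs2_ipZl rkhs2_ip_ge0
    rkhs2_ip_eq0 rkhs2_I_linear rkhs2_II rkhs2_ip_I rkhs2_complete rkhs2_nontrivial.

Local Notation HC := rkhs_complexification.

Lemma rkhs_complexification_fst c d (u v : HC) :
  (c *: u + d *: hI v).1 = c *: u.1 - d *: v.2.
Proof. by rewrite -scalerN. Qed.

Lemma rkhs_complexification_snd c d (u v : HC) :
  (c *: u + d *: hI v).2 = c *: u.2 + d *: v.1.
Proof. by []. Qed.

Lemma rkhsDE (f g : rkhs K) x : (f + g) x = f x + g x.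
Proof. by []. Qed.

Lemma rkhsNE (f : rkhs K) x : (- f) x = - f x.
Proof. by []. Qed.

Lemma rkhsZE c (f : rkhs K) x : (c *: f) x = c * f x.
Proof. by []. Qed.

(** Null vectors of the kernel are killed by every function of the space. This carries the relations
    satisfied by [haar] over to the operators. *)
Lemma rkhs_null (f : rkhs K) l : (forall x, fcev (K x) l = 0) -> fcev f l = 0.
Proof.
move=> h; have l0 : fcker K l l = 0.
  by rewrite /fcker /fcev big1 // => p _; have := h p.2; rewrite /fcev => ->; rewrite mulr0.
by have := rkhs_ip_ev f l; rewrite l0 mulr0 => h1; apply/eqP; rewrite -sqrf_eq0 eq_le h1 sqr_ge0.
Qed.

End Complexification.

(** * The operators of the generators on the completed space of monomials *)

Section Model.
Variables (R : realType) (G : groupType) (N : nat).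
Local Notation X := (monomial G 'I_N).
Local Notation letter := (G * 'I_N * 'I_N)%type.
Implicit Types (x y : X) (c : letter).

Definition haar_kernel : pskernel R X :=
  PSKernel (mkernC R (I:='I_N) (G:=G)) (@mkern_psd R G 'I_N).
Local Notation K := haar_kernel.

Fact haar_kernel_neq0 : exists x, K x x != 0.
Proof. by exists [::]; rewrite /= /mkern haar_nil oner_neq0. Qed.

Local Notation H := (rkhs_complexification haar_kernel_neq0).

Definition ladj c : letter := (c.1.1^-1%g, c.1.2, c.2).
Definition fcshift c (l : seq (R * X)) := [seq (p.1, c :: p.2) | p <- l].

Lemma fcev_shift (f : X -> R) c l : fcev f (fcshift c l) = fcev (fun x => f (c :: x)) l.
Proof. by rewrite /fcev big_map. Qed.

Lemma mkern_cons c x y : mkern R (c :: x) y = mkern R x (ladj c :: y).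
Proof. exact: (mkern_catl R [:: c]). Qed.

Lemma fcker_shift c a b : fcker K (fcshift c a) b = fcker K a (fcshift (ladj c) b).
Proof.
rewrite /fcker fcev_shift; apply: eq_bigr => p _; congr (_ * _).
rewrite fcev_shift; apply: eq_bigr => q _; congr (_ * _); exact: mkern_cons.
Qed.

Lemma mkern_proj x g i j y : mkern R x ((g^-1%g, i, j) :: (g, i, j) :: y) =
  mkern R x ((1%g, i, j) :: y).
Proof. by rewrite /mkern haar_row eqxx mul1r mulVg. Qed.

Lemma fcker_ext a b b' : (forall x, fcev (K x) b = fcev (K x) b') ->
  fcker K a b = fcker K a b'.
Proof. by move=> h; apply: eq_bigr => p _; congr (_ * _). Qed.

(** The relation x_ij(g)^* x_ij(g) = x_ij(1) reduces to g = 1. The x_ik(1) are projections with sum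
    1 over k, so the squared norm of l is a sum of nonnegative terms, one of which is the left
    side. *)
Lemma fcker_shift_le c l : fcker K (fcshift c l) (fcshift c l) <= fcker K l l.
Proof.
case: c => -[g i] j.
have proj h k : fcker K (fcshift (h, i, k) l) (fcshift (h, i, k) l) =
    fcker K l (fcshift (1%g, i, k) l).
  rewrite fcker_shift; apply: fcker_ext => x; rewrite !fcev_shift.
  by apply: eq_bigr => q _; congr (_ * _); exact: mkern_proj.
have -> : fcker K l l = \sum_k fcker K (fcshift (1%g, i, k) l) (fcshift (1%g, i, k) l).
  under eq_bigr do rewrite proj; rewrite /fcker /fcev exchange_big /=.
  apply: eq_bigr => p _; rewrite -mulr_sumr; congr (_ * _).
  under [in RHS]eq_bigr do rewrite big_map; rewrite exchange_big /=.
  apply: eq_bigr => q _; rewrite -mulr_sumr; congr (_ * _).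
  by rewrite /mkern haar_row_sum.
rewrite proj -(proj 1%g) (bigD1 j) //= lerDl.
by apply: sumr_ge0 => k _; apply: fcker_ge0.
Qed.

Lemma fcapprox_shift (f : X -> R) c b e : 0 <= e -> fcapprox K f b e ->
  fcapprox K (fun y => f (ladj c :: y)) (fcshift c b) e.
Proof.
move=> e0 h l; rewrite fcker_shift -fcev_shift; apply: le_trans (h _) _.
by rewrite ler_wpM2l // fcker_shift_le.
Qed.

Lemma rkhs_shift_subproof c (f : rkhs K) : rkhs_pred K (fun y => f (ladj c :: y)).
Proof.
have /rkhsP hf : rkhs_pred K f by case: (f).
apply/rkhsP => e e0; have [b hb] := hf e e0.
by exists (fcshift c b); apply: fcapprox_shift (ltW e0) hb.
Qed.
(* Left multiplication by the letter c: f stands for the functional y |-> <y, f>,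
   and <y, c f> = <c^* y, f>. *)
Definition rkhs_shift c (f : rkhs K) : rkhs K := RKHS (rkhs_shift_subproof c f).

Lemma rkhs_shiftN c f : rkhs_shift c (- f) = - rkhs_shift c f.
Proof. exact/val_inj. Qed.

Lemma rkhs_shift_le c f : rkhs_ip (rkhs_shift c f) (rkhs_shift c f) <= rkhs_ip f f.
Proof.
apply: rkhs_ip_le => [|l]; first exact: rkhs_ip_ge0.
have -> : fcev (rkhs_shift c f) l = fcev f (fcshift (ladj c) l) by rewrite fcev_shift.
apply: le_trans (rkhs_ip_ev _ _) _.
by rewrite ler_wpM2l ?rkhs_ip_ge0 ?fcker_shift_le.
Qed.

Lemma fccvg_shift c (f : rkhs K) u : fccvg K f u ->
  fccvg K (rkhs_shift c f) (fun n => fcshift c (u n)).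
Proof.
move=> h e e0; have [n0 hn0] := h e e0; exists n0 => n hn.
by apply: fcapprox_shift (ltW e0) (hn0 n hn).
Qed.

Lemma rkhs_shift_adj c (f g : rkhs K) :
  rkhs_ip (rkhs_shift c f) g = rkhs_ip f (rkhs_shift (ladj c) g).
Proof.
have h1 := rkhs_ip_cvg2 (fccvg_shift c (rkhs_seqP f)) (rkhs_seqP g).
have h2 := rkhs_ip_cvg2 (rkhs_seqP f) (fccvg_shift (ladj c) (rkhs_seqP g)).
by apply: (cvg_uniq h1); apply: (cvg_ext _ h2) => n; exact: fcker_shift.
Qed.

Definition model_fun c (u : H) : H := (rkhs_shift c u.1, rkhs_shift c u.2).

Lemma model_subproof c : bop_pred (model_fun c).
Proof.
apply/asboolP; split.
- exists 1 => // u; rewrite mul1r /hnorm ler_wsqrtr //.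
  by rewrite lerD ?rkhs_shift_le.
- by move=> u; congr pair; rewrite /= rkhs_shiftN.
- exists (model_fun (ladj c)) => u v; by congr (_ + _); exact: rkhs_shift_adj.
Qed.
Definition model_op c : bop H := Bop (model_subproof c).

Definition model (g : G) : 'M[bop H]_N := \matrix_(i, j) model_op (g, i, j).

Lemma rkhs_eqP (f g : rkhs K) : (forall x, f x = g x) -> f = g.
Proof. by move=> h; apply/val_inj/funext. Qed.

Lemma rkhs_row (f : rkhs K) g h i j k y :
  f ((g, i, j) :: (h, i, k) :: y) = (j == k)%:R * f (((g * h)%g, i, j) :: y).
Proof.
have := @rkhs_null R X K f [:: (1, (g, i, j) :: (h, i, k) :: y);
  (- (j == k)%:R, ((g * h)%g, i, j) :: y)].
rewrite /fcev !(big_cons, big_nil) /= addr0 mul1r mulNr => h0.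
apply/eqP; rewrite -subr_eq0; apply/eqP/h0 => x.
by rewrite !(big_cons, big_nil) /= addr0 mul1r mulNr /mkern haar_row subrr.
Qed.

Lemma rkhs_col (f : rkhs K) g h i j k y :
  f ((g, j, i) :: (h, k, i) :: y) = (j == k)%:R * f (((g * h)%g, j, i) :: y).
Proof.
have := @rkhs_null R X K f [:: (1, (g, j, i) :: (h, k, i) :: y);
  (- (j == k)%:R, ((g * h)%g, j, i) :: y)].
rewrite /fcev !(big_cons, big_nil) /= addr0 mul1r mulNr => h0.
apply/eqP; rewrite -subr_eq0; apply/eqP/h0 => x.
by rewrite !(big_cons, big_nil) /= addr0 mul1r mulNr /mkern haar_col subrr.
Qed.

Lemma rkhs_sum (f : rkhs K) (c : 'I_N -> letter) y :
  (forall x, \sum_k mkern R x (c k :: y) = mkern R x y) ->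
  \sum_k f (c k :: y) = f y.
Proof.
move=> h.
have := @rkhs_null R X K f ((-1, y) :: [seq (1, c k :: y) | k <- enum 'I_N]).
have E (F : X -> R) : fcev F ((-1, y) :: [seq (1, c k :: y) | k <- enum 'I_N]) =
    \sum_k F (c k :: y) - F y.
  rewrite /fcev big_cons big_map big_enum /= mulN1r addrC; congr (_ - _).
  by apply: eq_bigr => k _; rewrite mul1r.
rewrite E => h0; apply/eqP; rewrite -subr_eq0; apply/eqP/h0 => x.
by rewrite E h subrr.
Qed.

Lemma bop_sumE (J : finType) (T : J -> bop H) (u : H) :
  (\sum_j T j) u = \sum_j T j u.
Proof. by elim/big_rec2: _ => // j S v _ <-. Qed.

Lemma model_relations : quantum_reflection_relations model.
Proof.
have natE (b : bool) (f : rkhs K) y : (if b then f else 0) y = b%:R * f y.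
  by case: b; rewrite ?mul1r ?mul0r.
have fst_sum (F : 'I_N -> H) : (\sum_j F j).1 = \sum_j (F j).1
  by elim/big_rec2: _ => // j r v _ <-.
have snd_sum (F : 'I_N -> H) : (\sum_j F j).2 = \sum_j (F j).2
  by elim/big_rec2: _ => // j r v _ <-.
have sumE (F : 'I_N -> rkhs K) y : (\sum_j F j) y = \sum_j F j y.
  by elim/big_rec2: _ => // j r v _ <-.
split.
(* An operator prepends the adjoint of its letter to the argument, so a product of two prepends them
   in reverse order; hence [eq_sym] and [invgM] below. *)
- move=> i j k g h; rewrite !mxE; apply: bopP => u; rewrite bop_mulE.
  have -> : (if j == k then model_op ((g * h)%g, i, j) else 0) u =
     if j == k then model_op ((g * h)%g, i, j) u else 0 by case: eqP.
  have [jk|/negPf jk] := eqVneq j k; congr pair; apply: rkhs_eqP => y /=.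
  + by rewrite rkhs_row jk eqxx mul1r /ladj /= invgM.
  + by rewrite rkhs_row jk eqxx mul1r /ladj /= invgM.
  + by rewrite rkhs_row eq_sym jk mul0r.
  + by rewrite rkhs_row eq_sym jk mul0r.
- move=> i j k g h; rewrite !mxE; apply: bopP => u; rewrite bop_mulE.
  have -> : (if j == k then model_op ((g * h)%g, j, i) else 0) u =
     if j == k then model_op ((g * h)%g, j, i) u else 0 by case: eqP.
  have [jk|/negPf jk] := eqVneq j k; congr pair; apply: rkhs_eqP => y /=.
  + by rewrite rkhs_col jk eqxx mul1r /ladj /= invgM.
  + by rewrite rkhs_col jk eqxx mul1r /ladj /= invgM.
  + by rewrite rkhs_col eq_sym jk mul0r.
  + by rewrite rkhs_col eq_sym jk mul0r.
- move=> i; apply: bopP => u; rewrite bop_sumE.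
  rewrite (surjective_pairing (\sum_j _)) fst_sum snd_sum [RHS]surjective_pairing.
  congr pair; apply: rkhs_eqP => y; rewrite sumE;
    under eq_bigr do rewrite mxE /= /ladj /= invg1;
    by rewrite rkhs_sum // => x; exact: haar_row_sum.
- move=> i; apply: bopP => u; rewrite bop_sumE.
  rewrite (surjective_pairing (\sum_j _)) fst_sum snd_sum [RHS]surjective_pairing.
  congr pair; apply: rkhs_eqP => y; rewrite sumE;
    under eq_bigr do rewrite mxE /= /ladj /= invg1;
    by rewrite rkhs_sum // => x; exact: haar_col_sum.
- move=> i j g; rewrite !mxE; apply: bop_star_uniq => u v.
  by congr (_ + _); exact: rkhs_shift_adj.
Qed.

End Model.

Local Close Scope classical_set_scope.

(** * Intertwiners *)

Section PartitionsAsGenerators.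
Variables (k l : nat) (G : groupType) (g : 'I_k -> G) (h : 'I_l -> G) (N : nat).

(** Every point is labelled by its own block. *)
Lemma ncgen_of_NC_group p : p \in NC_group g h ->
  exists2 f, ncgen (bword g h) f &
    forall (i : multi_index N k) (j : multi_index N l),
      delta_partition p i j = f (bindex i j).
Proof.
move=> hp; have p_part : finset.partition p [set: 'I_k + 'I_l].
  by move: hp; rewrite !inE => /andP [/andP []].
have p_lab x y : (y \in finset.pblock p x) = (finset.pblock p x == finset.pblock p y).
  case/and3P: p_part => /eqP cT tI _.
  by rewrite eq_pblock // cT inE.
exists (label_delta (map (finset.pblock p) (bpoints k l))).
  by apply: ncgen_of_labelling; apply/(NC_group_label p_part p_lab).
by move=> i j; exact: delta_partition_label.
Qed.

Lemma NC_group_of_ncgen f : ncgen (I := 'I_N) (bword g h) f ->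
  exists2 p, p \in NC_group g h &
    forall (i : multi_index N k) (j : multi_index N l),
      f (bindex i j) = delta_partition p i j.
Proof.
move=> /labelling_of_ncgen [c hc E].
have szc : size c = size (bpoints k l) by case: hc => -> _ _; rewrite size_bword size_bpoints.
(* Every point occurs once in [bpoints], so the sequence c becomes a function on points; its fibres
   are the blocks. *)
pose lab x := nth 0%N c (index x (bpoints k l)).
have labE : map lab (bpoints k l) = c.
  apply: (@eq_from_nth _ 0%N); rewrite size_map // => n hn.
  have [x0 _] : exists x : 'I_k + 'I_l, true.
    by case: (bpoints k l) hn => // x s _; exists x.
  by rewrite (nth_map x0) // /lab index_uniq // bpoints_uniq.
have eqv : {in [set: 'I_k + 'I_l] & &, equivalence_rel (fun x y => lab x == lab y)}.
  by move=> x y z _ _ _; split=> // /eqP ->.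
have p_part := finset.preim_partitionP lab [set: 'I_k + 'I_l].
have p_lab x y : (y \in finset.pblock (finset.preim_partition lab [set: 'I_k + 'I_l]) x) =
    (lab x == lab y).
  by rewrite pblock_equivalence_partition ?inE.
exists (finset.preim_partition lab [set: 'I_k + 'I_l]).
  by apply/(NC_group_label p_part p_lab); rewrite labE.
move=> i j; rewrite (delta_partition_label p_part p_lab) labE E //.
by rewrite bindexE size_map size_bpoints size_bword.
Qed.

End PartitionsAsGenerators.

(** * Partition vectors are fixed by the corepresentations *)

Section FixedVectors.
Variables (A : pzRingType) (G : groupType) (I : finType) (a : G -> I -> I -> A).

Definition mprod (x : monomial G I) : A := \prod_(p <- x) a p.1.1 p.1.2 p.2.
Definition mtriple (w : seq G) (s t : seq I) : monomial G I := zip (zip w s) t.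

Lemma mtriple_cat w1 w2 s1 s2 t1 t2 : size s1 = size w1 -> size t1 = size w1 ->
  mtriple (w1 ++ w2) (s1 ++ s2) (t1 ++ t2) = mtriple w1 s1 t1 ++ mtriple w2 s2 t2.
Proof.
by move=> hs ht; rewrite /mtriple !zip_cat // size_zip hs minnn ht.
Qed.

Lemma mprod_cat x y : mprod (x ++ y) = mprod x * mprod y.
Proof. exact: big_cat. Qed.
Lemma mprod_cons p x : mprod (p :: x) = a p.1.1 p.1.2 p.2 * mprod x.
Proof. exact: big_cons. Qed.
Lemma mprod_nil : mprod [::] = 1.
Proof. exact: big_nil. Qed.

Hypothesis a_col : forall i j k g h,
  a g j i * a h k i = if j == k then a (g * h)%g j i else 0.
Hypothesis a_row_sum : forall i, \sum_l a 1%g i l = 1.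

(** An inserted letter contributes a row sum of a(1), which is 1. For a split pair, the two column
    indices agree, and the column relation both forces the row indices to agree and merges the two
    factors. *)
Lemma ncgen_fixed w f s : ncgen w f -> size s = size w ->
  \sum_(t <- words I (size w)) mprod (mtriple w s t) *+ f t = (f s)%:R.
Proof.
move=> hf; elim: hf s => {w f} [f hf|w1 w2 f f' _ IH hf'|w1 g h w2 f f' _ IH hf'] s.
- by case: s => // _; rewrite sum_words0 /= mprod_nil hf.
- move=> /size_catP [s1 [s2 [-> hs1 /size_consP [x [s3 [-> hs3]]]]]].
  rewrite hf' // -IH ?size_cat ?hs1 ?hs3 //= sum_words_cat_cons sum_words_cat.
  apply: eq_words => t1 ht1; rewrite exchange_big; apply: eq_words => t2 ht2.
  under eq_bigr do rewrite hf' // mtriple_cat // mprod_cat mprod_cons /=.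
  rewrite sumrMnl -mulr_sumr -mulr_suml a_row_sum mul1r.
  by rewrite mtriple_cat // mprod_cat.
- move=> /size_catP [s1 [s2 [-> hs1 /size_consP [x [s3 [-> /size_consP [y [s4 [-> hs4]]]]]]]]].
  rewrite hf' // (_ : ((x == y) && f (s1 ++ x :: s4))%:R =
      (x == y)%:R * (f (s1 ++ x :: s4))%:R :> A); last by case: eqP; rewrite ?mul1r ?mul0r.
  rewrite -IH ?size_cat /= ?hs1 ?hs4 // !sum_words_cat_cons mulr_sumr.
  apply: eq_words => t1 ht1; rewrite mulr_sumr; apply: eq_bigr => z _.
  rewrite sum_wordsS (bigD1 z) //= [X in _ + X]big1 ?addr0; last first.
    by move=> z' zz'; rewrite big1_seq // => t2; rewrite mem_words => /eqP ht2;
      rewrite hf' // eq_sym (negPf zz').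
  rewrite mulr_sumr; apply: eq_words => t2 ht2; rewrite hf' // eqxx /=.
  rewrite !mtriple_cat // !mprod_cat !mprod_cons /= [a g x z * (_ * _)]mulrA a_col.
  by case: eqP => _; rewrite ?mul1r // !mul0r mulr0 mul0rn.
Qed.

End FixedVectors.

Section FixedVectorsColumns.
Variables (A : pzRingType) (G : groupType) (I : finType) (a : G -> I -> I -> A).
Hypothesis a_row : forall i j k g h,
  a g i j * a h i k = if j == k then a (g * h)%g i j else 0.
Hypothesis a_col_sum : forall i, \sum_l a 1%g l i = 1.

(** The transposed family satisfies the hypotheses of [ncgen_fixed]. *)
Lemma ncgen_fixed_col w f t : ncgen w f -> size t = size w ->
  \sum_(s <- words I (size w)) mprod a (mtriple w s t) *+ f s = (f t)%:R.
Proof.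
move=> hf ht; rewrite -(ncgen_fixed (a := fun g i j => a g j i) _ _ hf ht) //.
apply: eq_words => s hs; congr (_ *+ _).
elim: w s t hs ht {hf} => [|g w IH] [|x s] [|y t] //=; first by rewrite !mprod_nil.
by move=> [hs] [ht]; rewrite !mprod_cons (IH s t).
Qed.

End FixedVectorsColumns.

Section MultiIndexSums.
Variables (N k : nat).
Definition mseq (i : multi_index N k) : seq 'I_N := [seq i r | r <- enum 'I_k].

Lemma size_mseq i : size (mseq i) = k.
Proof. exact: size_map_ord. Qed.

Lemma mseq_inj : injective mseq.
Proof.
move=> i i' E; have /eq_in_map h : [seq i r | r <- enum 'I_k] = [seq i' r | r <- enum 'I_k] := E.
apply/ffunP => r; apply: h; exact: mem_enum.
Qed.

Lemma sum_multi_index (V : nmodType) (F : seq 'I_N -> V) :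
  \sum_(s <- words 'I_N k) F s = \sum_(i : multi_index N k) F (mseq i).
Proof.
rewrite -[RHS]big_enum -(big_map mseq xpredT F); apply: perm_big; apply: uniq_perm.
- exact: words_uniq.
- by rewrite map_inj_uniq ?enum_uniq //; exact: mseq_inj.
move=> s; rewrite mem_words; apply/eqP/mapP => [hs|[i _ ->]]; last exact: size_mseq.
exists [ffun r => tnth (Tuple (introT eqP hs)) r]; first by rewrite mem_enum.
rewrite /mseq; under eq_map do rewrite ffunE.
by rewrite map_tnth_enum.
Qed.

Lemma mtriple_mseq (G : groupType) (g : 'I_k -> G) (i i' : multi_index N k) :
  mtriple [seq g r | r <- enum 'I_k] (mseq i) (mseq i') =
  [seq (g r, i r, i' r) | r <- enum 'I_k].
Proof. by rewrite /mtriple /mseq !zip_map. Qed.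

End MultiIndexSums.

(** * Unitarity and Frobenius reciprocity *)

Section Frobenius.
Variables (R : realType) (N : nat) (G : groupType) (A : cstarAlgType R) (a : G -> 'M[A]_N).
Hypothesis ha : quantum_reflection_relations a.
Local Notation aprod := (mprod (fun g i j => a g i j)).

Lemma star1 : star (1 : A) = 1.
Proof. by rewrite -[LHS]mul1r -{1}(starK 1) -starM mul1r starK. Qed.

Lemma star_mprod x : star (aprod x) = aprod (madj x).
Proof.
elim: x => [|[[g i] j] x IH]; first by rewrite /madj /= mprod_nil star1.
by rewrite mprod_cons starM IH -cat1s madj_cat mprod_cat mprod_cons mprod_nil mulr1 /=
  (qr_star ha).
Qed.

Lemma tensor_corep_mprod k (g : 'I_k -> G) (i i' : multi_index N k) :
  tensor_corep (fun r => a (g r)) i i' =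
  aprod (mtriple [seq g r | r <- enum 'I_k] (mseq i) (mseq i')).
Proof.
by rewrite mtriple_mseq /mprod big_map /= enumT /tensor_corep [index_enum _]unlock.
Qed.

Lemma mtriple_rev w s t : size s = size w -> size t = size w ->
  mtriple (winv w) (rev s) (rev t) = madj (mtriple w s t) :> monomial G 'I_N.
Proof.
move=> hs ht; rewrite /mtriple /winv /madj -!rev_zip ?size_zip ?size_map ?hs ?ht ?minnn //.
congr rev; elim: w s t hs ht => [|g w IH] [|x s] [|y t] //= [hs] [ht].
by rewrite IH.
Qed.

(** Unitarity is invariance of the nested pair partition of w followed by [winv w]; the other half,
    [tensor_corep_unitary'], uses the column version. *)
Lemma tensor_corep_unitary k (g : 'I_k -> G) (i i' : multi_index N k) :
  \sum_(r : multi_index N k) tensor_corep (fun r => a (g r)) i r *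
    star (tensor_corep (fun r => a (g r)) i' r) = (i == i')%:R.
Proof.
set w := [seq g r | r <- enum 'I_k].
have szw : size w = k by exact: size_map_ord.
have hi : size (mseq i ++ rev (mseq i')) = size (w ++ winv w).
  by rewrite !size_cat size_rev !size_mseq size_winv szw.
have := ncgen_fixed (qr_col ha) (qr_row_sum ha) (ncgen_id 'I_N w) hi.
rewrite take_size_cat ?drop_size_cat ?size_mseq ?szw // revK (inj_eq (@mseq_inj _ _)) => <-.
rewrite size_cat size_winv szw sum_words_cat !sum_multi_index.
(* The pair partition leaves a single second half, the reversal of the first. *)
apply: eq_bigr => r _; rewrite (bigD1_seq (rev (mseq r))) /= ?words_uniq //; last first.
  by rewrite mem_words size_rev size_mseq.
rewrite [X in _ + X]big1_seq ?addr0 => [|t]; last first.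
  rewrite mem_words => /andP [tr /eqP ht].
  rewrite take_size_cat ?drop_size_cat ?size_mseq // -(inj_eq (inv_inj (@revK _))) in tr *.
  by move: tr; rewrite revK eq_sym => /negPf ->.
rewrite take_size_cat ?drop_size_cat ?size_mseq // revK eqxx mtriple_cat ?size_mseq //.
by rewrite mprod_cat mtriple_rev ?size_mseq // -star_mprod -!tensor_corep_mprod.
Qed.

Lemma tensor_corep_unitary' k (g : 'I_k -> G) (i i' : multi_index N k) :
  \sum_(r : multi_index N k) star (tensor_corep (fun r => a (g r)) r i) *
    tensor_corep (fun r => a (g r)) r i' = (i == i')%:R.
Proof.
set w := [seq g r | r <- enum 'I_k].
have szw : size w = k by exact: size_map_ord.
have hi : size (rev (mseq i) ++ mseq i') = size (winv w ++ w).
  by rewrite !size_cat size_rev !size_mseq size_winv szw.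
have hid := ncgen_id 'I_N (winv w); rewrite winvK in hid.
have := ncgen_fixed_col (qr_row ha) (qr_col_sum ha) hid hi.
rewrite take_size_cat ?drop_size_cat ?size_winv ?szw ?size_rev ?size_mseq //.
rewrite (inj_eq (inv_inj (@revK _))) (inj_eq (@mseq_inj _ _)) => <-.
rewrite size_cat size_winv szw sum_words_cat -sum_words_rev !sum_multi_index.
apply: eq_bigr => r _; rewrite (bigD1_seq (mseq r)) /= ?words_uniq //; last first.
  by rewrite mem_words size_mseq.
rewrite [X in _ + X]big1_seq ?addr0 => [|t]; last first.
  rewrite mem_words => /andP [tr /eqP ht].
  rewrite take_size_cat ?drop_size_cat ?size_winv ?szw ?size_rev ?size_mseq //.
  by rewrite (inj_eq (inv_inj (@revK _))) eq_sym (negPf tr).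
rewrite take_size_cat ?drop_size_cat ?size_winv ?szw ?size_rev ?size_mseq // eqxx.
rewrite mtriple_cat ?size_winv ?szw ?size_rev ?size_mseq //.
by rewrite mprod_cat mtriple_rev ?size_mseq // -star_mprod -!tensor_corep_mprod.
Qed.

Variables (k l : nat) (g : 'I_k -> G) (h : 'I_l -> G).
Local Notation u := (tensor_corep (fun r => a (g r))).
Local Notation v := (tensor_corep (fun s => a (h s))).

Lemma bindex_mseq (i : multi_index N k) (j : multi_index N l) :
  bindex i j = mseq j ++ rev (mseq i).
Proof. by []. Qed.

Lemma mprod_bindex (i i' : multi_index N k) (j j' : multi_index N l) :
  aprod (mtriple (bword g h) (bindex i j) (bindex i' j')) = v j j' * star (u i i').
Proof.
rewrite !bindex_mseq /bword mtriple_cat ?size_mseq ?size_map_ord //.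
by rewrite mprod_cat mtriple_rev ?size_mseq ?size_map_ord // -star_mprod -!tensor_corep_mprod.
Qed.

Lemma sum_words_bindex (V : nmodType) (F : seq 'I_N -> V) :
  \sum_(s <- words 'I_N (l + k)) F s =
  \sum_(j : multi_index N l) \sum_(i : multi_index N k) F (bindex i j).
Proof.
rewrite sum_words_cat sum_multi_index; apply: eq_bigr => j _.
by rewrite -sum_words_rev sum_multi_index.
Qed.

(* T u = v T, solved for T by unitarity of u: T = v T u^*. *)
Lemma corep_HomP (T : 'Hom(tensor_space R N k, tensor_space R N l)) :
  corep_Hom u v T <-> forall i j,
   \sum_(j' : multi_index N l) \sum_(i' : multi_index N k)
     T (basis_vector R i') j' *: (v j j' * star (u i i')) =
   (T (basis_vector R i) j) *: 1.
Proof.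
split=> hT => [i j|j i].
  rewrite exchange_big /=.
  under eq_bigr => i' _.
    under eq_bigr do rewrite scalerAl.
    rewrite -mulr_suml hT mulr_suml.
    under eq_bigr do rewrite -scalerAl.
    over.
  rewrite exchange_big /= (bigD1 i) //= [X in _ + X]big1 ?addr0 => [|i1 i1i].
    by rewrite -scaler_sumr tensor_corep_unitary eqxx.
  by rewrite -scaler_sumr tensor_corep_unitary (negPf i1i) scaler0.
transitivity (\sum_i1 (T (basis_vector R i1) j *: 1) * u i1 i); last first.
  by apply: eq_bigr => i1 _; rewrite -scalerAl mul1r.
under [RHS]eq_bigr => i1 _.
  rewrite -hT mulr_suml.
  under eq_bigr do rewrite mulr_suml.
  over.
rewrite exchange_big /=; apply: eq_bigr => j' _; rewrite exchange_big /=.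
rewrite (bigD1 i) //= [X in _ + X]big1 ?addr0 => [|i' i'i].
  under eq_bigr do rewrite -scalerAl -mulrA.
  by rewrite -scaler_sumr -mulr_sumr tensor_corep_unitary' eqxx mulr1.
under eq_bigr do rewrite -scalerAl -mulrA.
by rewrite -scaler_sumr -mulr_sumr tensor_corep_unitary' (negPf i'i) mulr0 scaler0.
Qed.

Lemma T_partition_coef p (i : multi_index N k) (j : multi_index N l) :
  T_partition R N p (basis_vector R i) j = (delta_partition p i j)%:R.
Proof.
rewrite T_partition_basis sum_ffunE (bigD1 j) //= big1 ?addr0 => [|j' j'j].
  by rewrite !ffunE eqxx /= -[LHS]/(_ * 1) mulr1.
by rewrite !ffunE eq_sym (negPf j'j) scaler0.
Qed.

(** In the form T = v T u^* of [corep_HomP], the claim is that the vector of p is fixed along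
    [bword]. *)
Lemma T_partition_corep_Hom p : p \in NC_group g h -> corep_Hom u v (T_partition R N p).
Proof.
move=> hp; apply/corep_HomP => i j.
have [f hf E] := ncgen_of_NC_group N hp.
have hs : size (bindex i j) = size (bword g h).
  by rewrite bindexE size_map size_bpoints size_bword.
have := ncgen_fixed (qr_col ha) (qr_row_sum ha) hf hs.
rewrite T_partition_coef E scaler_nat => <-.
rewrite size_bword sum_words_bindex; apply: eq_bigr => j' _; apply: eq_bigr => i' _.
by rewrite T_partition_coef E scaler_nat mprod_bindex.
Qed.

End Frobenius.

(** * The vacuum state of the model *)

Section VacuumState.
Variables (R : realType) (G : groupType) (N : nat).
Local Notation H := (rkhs_complexification (haar_kernel_neq0 R G N)).
Local Notation b := (fun g i j => model R N (g : G) i j).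

Lemma mprod_model_fst x (u : H) y : (mprod b x u).1 y = u.1 (madj x ++ y).
Proof.
elim: x y => [|[[g i] j] x IH] y; first by rewrite mprod_nil.
by rewrite mprod_cons mxE bop_mulE /= IH -(cat1s (g, i, j) x) madj_cat -catA.
Qed.

Lemma mprod_model_snd x (u : H) y : (mprod b x u).2 y = u.2 (madj x ++ y).
Proof.
elim: x y => [|[[g i] j] x IH] y; first by rewrite mprod_nil.
by rewrite mprod_cons mxE bop_mulE /= IH -(cat1s (g, i, j) x) madj_cat -catA.
Qed.

Definition vacuum : H := (rkhs_ker (haar_kernel R G N) [::], 0).
(** By the reproducing property, evaluation at the empty monomial is pairing with the kernel vector
    there. Thus [vacuum_Re] and [vacuum_Im] are the real and imaginary parts of the vector state. *)
Definition vacuum_Re (T : bop H) : R := (T vacuum).1 [::].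
Definition vacuum_Im (T : bop H) : R := (T vacuum).2 [::].

Lemma vacuum_ReD S T : vacuum_Re (S + T) = vacuum_Re S + vacuum_Re T.
Proof. by rewrite /vacuum_Re bop_addE. Qed.

Lemma vacuum_ImD S T : vacuum_Im (S + T) = vacuum_Im S + vacuum_Im T.
Proof. by rewrite /vacuum_Im bop_addE. Qed.

Lemma vacuum_Re_sum (J : finType) (F : J -> bop H) :
  vacuum_Re (\sum_j F j) = \sum_j vacuum_Re (F j).
Proof. by elim/big_rec2: _ => // j s T _ <-; exact: vacuum_ReD. Qed.

Lemma vacuum_Im_sum (J : finType) (F : J -> bop H) :
  vacuum_Im (\sum_j F j) = \sum_j vacuum_Im (F j).
Proof. by elim/big_rec2: _ => // j s T _ <-; exact: vacuum_ImD. Qed.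

Lemma vacuum_Re_scale (c : R[i]) T :
  vacuum_Re (c *: T) = complex.Re c * vacuum_Re T - complex.Im c * vacuum_Im T.
Proof.
by rewrite /vacuum_Re bop_scaleE rkhs_complexification_fst rkhsDE rkhsNE !rkhsZE.
Qed.

Lemma vacuum_Im_scale (c : R[i]) T :
  vacuum_Im (c *: T) = complex.Re c * vacuum_Im T + complex.Im c * vacuum_Re T.
Proof.
by rewrite /vacuum_Im bop_scaleE rkhs_complexification_snd rkhsDE !rkhsZE.
Qed.

Lemma vacuum_mprod x : vacuum_Re (mprod b x) = haar R x /\ vacuum_Im (mprod b x) = 0.
Proof.
rewrite /vacuum_Re /vacuum_Im mprod_model_fst mprod_model_snd cats0; split=> //.
by rewrite /= /mkern haar_adj.
Qed.

Lemma vacuum_ReZ (c : R[i]) x : vacuum_Re (c *: mprod b x) = complex.Re c * haar R x.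
Proof. by have [h1 h2] := vacuum_mprod x; rewrite vacuum_Re_scale h1 h2 mulr0 subr0. Qed.

Lemma vacuum_ImZ (c : R[i]) x : vacuum_Im (c *: mprod b x) = complex.Im c * haar R x.
Proof. by have [h1 h2] := vacuum_mprod x; rewrite vacuum_Im_scale h1 h2 mulr0 add0r. Qed.

End VacuumState.

Lemma haar_mtriple (R : realType) (G : groupType) (I : finType) (w : seq G) (s t : seq I) :
  size s = size w -> size t = size w -> haar R (mtriple w s t) = ncproj R w s t.
Proof.
move=> hs ht; rewrite /haar /mtriple; congr (ncproj _ _ _ _).
- rewrite /mword -[LHS]/(map (fst \o fst) _) map_comp -!/(unzip1 _).
  by rewrite !unzip1_zip ?size_zip ?hs ?ht ?minnn.
- rewrite /mrow -[LHS]/(map (snd \o fst) _) map_comp -/(unzip1 _) -/(unzip2 _).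
  by rewrite unzip1_zip ?unzip2_zip ?size_zip ?hs ?ht ?minnn.
- by rewrite /mcol -/(unzip2 _) unzip2_zip // size_zip hs ht minnn.
Qed.

Section SpanOfPartitions.
Variables (R : realType) (N : nat) (G : groupType).
Variables (k l : nat) (g : 'I_k -> G) (h : 'I_l -> G).
Local Notation span := (<<[seq T_partition R N p | p in NC_group g h]>>%VS).

Lemma span_of_ncspan F : ncspan (bword g h) F ->
  exists2 S, S \in span & forall (i : multi_index N k) (j : multi_index N l),
    S (basis_vector R i) j = (F (bindex i j))%:C%C.
Proof.
have hsz (i : multi_index N k) (j : multi_index N l) : size (bindex i j) = size (bword g h).
  by rewrite bindexE size_map size_bpoints size_bword.
elim=> {F} [F hF|c phi f' F hphi _ [S hS SE] hF].
  exists 0; first exact: mem0v.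
  by move=> i j; rewrite hF // zero_lfunE ffunE.
have [p hp pE] := NC_group_of_ncgen hphi.
exists (c%:C%C *: T_partition R N p + S).
  by rewrite rpredD // rpredZ // memv_span // map_f // mem_enum.
move=> i j; rewrite add_lfunE scale_lfunE !ffunE SE T_partition_coef -pE hF //.
by rewrite rmorphD rmorphM rmorph_nat.
Qed.

Lemma lfun_basis_ext (I J : finType)
    (S T : 'Hom({ffun I -> R[i]^o}, {ffun J -> R[i]^o})) :
  (forall i j, S (basis_vector R i) j = T (basis_vector R i) j) -> S = T.
Proof.
move=> E; apply/lfunP => x.
have -> : x = \sum_i x i *: basis_vector R i.
  apply/ffunP => i; rewrite sum_ffunE (bigD1 i) //= big1 ?addr0 => [|i' i'i].
    by rewrite !ffunE eqxx /= -[RHS]/(_ * 1) mulr1.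
  by rewrite !ffunE eq_sym (negPf i'i) scaler0.
rewrite !linear_sum; apply: eq_bigr => i _; rewrite !linearZ; congr (_ *: _).
by apply/ffunP => j; exact: E.
Qed.

Variables (A : cstarAlgType R) (a : G -> 'M[A]_N).
Hypothesis hA : is_quantum_reflection_algebra a.

Lemma corep_Hom_span T :
  corep_Hom (tensor_corep (fun r => a (g r))) (tensor_corep (fun s => a (h s))) T ->
  T \in span.
Proof.
have [ha univ] := hA.
move=> /(corep_HomP ha) hT.
have [phi [_ phia _]] := univ _ _ (model_relations R G N).
have phiM x : phi (mprod (fun g i j => a g i j) x) =
    mprod (fun g i j => model R N (g : G) i j) x.
  by rewrite rmorph_prod; apply: eq_bigr => p _; exact: phia.
pose tau (i : multi_index N k) (j : multi_index N l) : R[i] := T (basis_vector R i) j.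
have hB (i : multi_index N k) (j : multi_index N l) :
    \sum_(j' : multi_index N l) \sum_(i' : multi_index N k)
     tau i' j' *: mprod (fun g i j => model R N (g : G) i j)
       (mtriple (bword g h) (bindex i j) (bindex i' j')) =
     tau i j *: mprod (fun g i j => model R N (g : G) i j) [::].
  have := congr1 phi (hT i j); rewrite linearZ rmorph1 mprod_nil => <-.
  rewrite linear_sum; apply: eq_bigr => j' _; rewrite linear_sum; apply: eq_bigr => i' _.
  by rewrite linearZ; congr (_ *: _); rewrite -(mprod_bindex ha); exact/esym/phiM.
have hsz (i : multi_index N k) (j : multi_index N l) : size (bindex i j) = size (bword g h).
  by rewrite bindexE size_map size_bpoints size_bword.
(* The vacuum state is real on monomials, so real and imaginary parts of T are fixed by P separately
   and each lies in the real span V. *)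
have hRe i j : complex.Re (tau i j) =
    \sum_(j' : multi_index N l) \sum_(i' : multi_index N k)
      complex.Re (tau i' j') * ncproj R (bword g h) (bindex i j) (bindex i' j').
  have := congr1 (@vacuum_Re R G N) (hB i j).
  rewrite vacuum_ReZ haar_nil mulr1 vacuum_Re_sum => <-; apply: eq_bigr => j' _.
  rewrite vacuum_Re_sum; apply: eq_bigr => i' _.
  by rewrite vacuum_ReZ haar_mtriple.
have hIm i j : complex.Im (tau i j) =
    \sum_(j' : multi_index N l) \sum_(i' : multi_index N k)
      complex.Im (tau i' j') * ncproj R (bword g h) (bindex i j) (bindex i' j').
  have := congr1 (@vacuum_Im R G N) (hB i j).
  rewrite vacuum_ImZ haar_nil mulr1 vacuum_Im_sum => <-; apply: eq_bigr => j' _.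
  rewrite vacuum_Im_sum; apply: eq_bigr => i' _.
  by rewrite vacuum_ImZ haar_mtriple.
have span_sum (c : multi_index N k -> multi_index N l -> R) :
    ncspan (bword g h) (fun s => \sum_(j' : multi_index N l) \sum_(i' : multi_index N k)
      c i' j' * ncproj R (bword g h) s (bindex i' j')).
  apply: ncspan_sum => j' _; apply: ncspan_sum => i' _; apply: ncspanZ.
  exact: ncproj_span.
have [S1 S1s S1E] := span_of_ncspan (span_sum (fun i j => complex.Re (tau i j))).
have [S2 S2s S2E] := span_of_ncspan (span_sum (fun i j => complex.Im (tau i j))).
have -> : T = S1 + 'i%C *: S2; last by rewrite rpredD // rpredZ.
apply: lfun_basis_ext => i j.
rewrite add_lfunE scale_lfunE !ffunE S1E S2E -hRe -hIm; exact: complexE.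
Qed.

End SpanOfPartitions.

Theorem theorem2p20 (R : realType) (N : nat) (hN : (4 <= N)%N) (G : groupType)
    (A : cstarAlgType R) (a : G -> 'M[A]_N)
    (hA : is_quantum_reflection_algebra a)
    (k l : nat) (g : 'I_k -> G) (h : 'I_l -> G) :
  corep_Hom (tensor_corep (fun r => a (g r))) (tensor_corep (fun s => a (h s)))
  = [set` <<[seq T_partition R N p | p in NC_group g h]>>%VS]%classic.
Proof.
apply/seteqP; split=> T /=; first exact: corep_Hom_span.
set X := [seq _ | p in _] => hT i j.
(* The intertwining condition is linear in T, so coordinates in the generating family reduce it to
   the maps of single partitions. *)
have {hT} -> : T = \sum_(r < size X) coord (in_tuple X) r T *: X`_r.
  by apply: (@coord_span _ _ _ (in_tuple X)); exact: hT.
have coefE (I J : finType) (c : 'I_(size X) -> R[i])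
    (S : 'I_(size X) -> 'Hom({ffun I -> R[i]^o}, {ffun J -> R[i]^o})) x j0 :
    (\sum_r c r *: S r) x j0 = \sum_r c r * S r x j0.
  by rewrite sum_lfunE sum_ffunE; apply: eq_bigr => r _; rewrite scale_lfunE ffunE.
have hX (r : 'I_(size X)) : corep_Hom (tensor_corep (fun r => a (g r)))
    (tensor_corep (fun s => a (h s))) X`_r.
  have /mapP [p hp ->] : X`_r \in X by exact: mem_nth.
  by apply: (T_partition_corep_Hom hA.1); rewrite mem_enum in hp.
under eq_bigr do rewrite coefE scaler_suml.
under [RHS]eq_bigr do rewrite coefE scaler_suml.
rewrite exchange_big [RHS]exchange_big /=; apply: eq_bigr => r _.
under eq_bigr do rewrite -scalerA.
under [RHS]eq_bigr do rewrite -scalerA.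
by rewrite -!scaler_sumr hX.
Qed.
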